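(* Fix a field $k$. The following are equivalent: (i) For every (possibly non-connected) reductive $k$-group $G$, every affine $k$-defined $G$-variety $V$, every $v\in V$ and every $\lambda\in Y_k(G)$ such that $v':=\lim_{a\to0}\lambda(a)\cdot v$ exists: if $v'$ is $G(k)$-conjugate to $v$, then $v'$ is $G^0(k)$-conjugate to $v$. (ii) For every (possibly non-connected) reductive $k$-group $G$ and every affine $k$-defined $G$-variety $V$, the preorder $\prec$ on the set of $G(k)$-orbits in $V$ is antisymmetric. (iii) For every connected reductive $k$-group $G$ and every affine $k$-defined $G$-variety $V$, the preorder $\prec$ on the set of $G(k)$-orbits in $V$ is antisymmetric.
   Context: $\overline{k}$ is a fixed algebraic closure of $k$. Algebraic groups and varieties are taken over $\overline{k}$ (identified with their $\overline{k}$-points); ''$k$-defined'' means endowed with a $k$-structure. Linear algebraic groups are smooth; reductive means trivial unipotent radical. An affine $k$-defined $G$-variety is an affine variety $V$ with a $G$-action such that both $V$ and the action are $k$-defined; $v\in V$ means a $\overline{k}$-point. $G^0$ is the identity component of $G$. $Y_k(G)$ is the set of $k$-defined cocharacters $\lambda:\overline{k}^*\to G$. $\lim_{a\to0}\lambda(a)\cdot v$ exists if the morphism $\overline{k}^*\to V$, $a\mapsto\lambda(a)\cdot v$ extends to $\overline{k}$; the limit is the value of the extension at $0$. A subset $X\subseteq V$ is cocharacter-closed (over $k$) if for every $x\in X$ and $\lambda\in Y_k(G)$ such that $x':=\lim_{a\to0}\lambda(a)\cdot x$ exists, $x'\in X$. The cocharacter-closure $\overline{X}^{\rm c}$ is the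 smallest cocharacter-closed subset of $V$ containing $X$. For $v,v'\in V$, write $G(k)\cdot v'\prec G(k)\cdot v$ if $v'\in\overline{G(k)\cdot v}^{\rm c}$; this is a preorder on the set of $G(k)$-orbits in $V$. *)

(* Defs.v *)
From HB Require Import structures.
From mathcomp Require Export all_boot all_order all_algebra.
From mathcomp Require Export mpoly.

Set Implicit Arguments.
Unset Strict Implicit.
Unset Printing Implicit Defensive.

Import GRing.Theory.
Local Open Scope ring_scope.

(* Varieties are identified with their kbar-points: an affine variety is a
   Zariski closed subset of some affine space kbar^m (row vectors), and a linear
   algebraic group is a subgroup of GL_n(kbar) that is closed in GL_n.  A
   k-structure on a closed subset X of kbar^m is given by its embedding: X is
   k-defined when its full (hence radical) vanishing ideal over kbar is generated
   by polynomials with coefficients in k, i.e. k[X] (x)_k kbar = kbar[X]. *)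

Section Zariski.
Variable K : fieldType.

Local Notation pset m := ('rV[K]_m -> Prop).

Definition peval m (p : {mpoly K[m]}) (x : 'rV[K]_m) : K := p.@[fun i => x 0 i].

Definition zariski_closed m (X : pset m) : Prop :=
  exists S : {mpoly K[m]} -> Prop,
    forall x, X x <-> (forall p, S p -> peval p x = 0).

Definition vanishes_on m (X : pset m) (p : {mpoly K[m]}) : Prop :=
  forall x, X x -> peval p x = 0.

(* Connectedness in the topology induced by the Zariski topology. *)
Definition zariski_connected m (X : pset m) : Prop :=
  forall Z1 Z2 : pset m, zariski_closed Z1 -> zariski_closed Z2 ->
    (forall x, X x -> Z1 x \/ Z2 x) ->
    (forall x, X x -> ~ (Z1 x /\ Z2 x)) ->
    (forall x, X x -> Z1 x) \/ (forall x, X x -> Z2 x).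

(* GL_n as a closed subset of affine space, via A |-> (entries of A, 1 / det A). *)
Definition gl_coord n (A : 'M[K]_n) : 'rV[K]_(n * n + 1) :=
  row_mx (mxvec A) ((\det A)^-1)%:M.

Local Notation mset n := ('M[K]_n -> Prop).

Definition gl_image n (H : mset n) : pset (n * n + 1) :=
  fun x => exists2 A, H A & x = gl_coord A.

Definition gl_subgroup n (H : mset n) : Prop :=
  [/\ forall A, H A -> A \in unitmx,
      H 1%:M,
      forall A B, H A -> H B -> H (A *m B)
    & forall A, H A -> H (invmx A)].

Definition gl_closed n (H : mset n) : Prop := zariski_closed (gl_image H).

Definition gl_connected n (H : mset n) : Prop := zariski_connected (gl_image H).

(* Connected component of 1. *)
Definition identity_component n (G : mset n) : mset n := fun A =>
  exists C : mset n,
    [/\ forall B, C B -> G B, gl_connected C, C 1%:M & C A].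

Definition unipotent_mx n (A : 'M[K]_n) : Prop :=
  exists N : nat, (A - 1%:M) ^+ N = 0.

Definition connected_normal_unipotent n (G U : mset n) : Prop :=
  [/\ gl_subgroup U /\ gl_closed U,
      forall A, U A -> G A,
      forall A B, G A -> U B -> U (A *m B *m invmx A),
      gl_connected U
    & forall A, U A -> unipotent_mx A].

Definition is_unipotent_radical n (G U : mset n) : Prop :=
  connected_normal_unipotent G U /\
  forall U' : mset n, connected_normal_unipotent G U' -> forall A, U' A -> U A.

(* No connectedness is required. *)
Definition reductive n (G : mset n) : Prop :=
  is_unipotent_radical G (fun A => A = 1%:M).

End Zariski.

Section KStructures.
Variables (k : fieldType) (kbar : closedFieldType) (iota : {rmorphism k -> kbar}).

Local Notation pset m := ('rV[kbar]_m -> Prop).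
Local Notation mset n := ('M[kbar]_n -> Prop).

Definition is_algebraic_closure : Prop := forall x : kbar, algebraicOver iota x.

Definition k_defined m (X : pset m) : Prop :=
  zariski_closed X /\
  forall p : {mpoly kbar[m]}, vanishes_on X p ->
    exists r : seq ({mpoly kbar[m]} * {mpoly k[m]}),
      (forall c, c \in r -> vanishes_on X (map_mpoly iota c.2)) /\
      p = \sum_(c <- r) c.1 * map_mpoly iota c.2.

(* f restricted to D is given by polynomials over k in the coordinates c. *)
Definition k_regular (T : Type) (m l : nat) (D : T -> Prop)
    (c : T -> 'rV[kbar]_m) (f : T -> 'rV[kbar]_l) : Prop :=
  exists P : 'I_l -> {mpoly k[m]},
    forall t, D t -> forall j, f t 0 j = peval (map_mpoly iota (P j)) (c t).

(* Multiplication and inversion of GL_n are defined over k, so they need no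
   further condition here. *)
Record k_group (n : nat) := KGroup {
  k_group_set :> mset n;
  k_group_subgroup : gl_subgroup k_group_set;
  k_group_defined : k_defined (gl_image k_group_set)
}.

(* The values of [gvar_act] outside G x V are irrelevant. *)
Record k_Gvariety (n : nat) (G : k_group n) (m : nat) := KGvariety {
  gvar_set :> pset m;
  gvar_act : 'M[kbar]_n -> 'rV[kbar]_m -> 'rV[kbar]_m;
  gvar_defined : k_defined gvar_set;
  gvar_act_in : forall g v, G g -> gvar_set v -> gvar_set (gvar_act g v);
  gvar_act1 : forall v, gvar_set v -> gvar_act 1%:M v = v;
  gvar_actM : forall g h v, G g -> G h -> gvar_set v ->
    gvar_act (g *m h) v = gvar_act g (gvar_act h v);
  gvar_act_regular :
    k_regular (fun t : 'M[kbar]_n * 'rV[kbar]_m => G t.1 /\ gvar_set t.2)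
      (fun t => row_mx (gl_coord t.1) t.2) (fun t => gvar_act t.1 t.2)
}.

(* [k_points G] is G(k); [k_points (identity_component G)] is G^0(k). *)
Definition k_points n (H : mset n) : mset n :=
  fun g => H g /\ exists g0 : 'M[k]_n, g = map_mx iota g0.

(* Y_k(G): a k-defined morphism from kbar^* to GL_n is a matrix over k[t, t^-1].
   The value of [lam] at 0 is irrelevant. *)
Definition k_cocharacter n (G : k_group n) (lam : kbar -> 'M[kbar]_n) : Prop :=
  [/\ forall a, a != 0 -> G (lam a),
      forall a b, a != 0 -> b != 0 -> lam (a * b) = lam a *m lam b
    & exists (N : nat) (P : 'M[{poly k}]_n), forall a, a != 0 ->
        lam a = (a ^+ N)^-1 *: map_mx (fun p => (map_poly iota p).[a]) P].

Section Gvariety.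
Variables (n : nat) (G : k_group n) (m : nat) (V : k_Gvariety G m).

(* The limit of lam(a).v as a -> 0 exists and equals v'. *)
Definition is_limit (lam : kbar -> 'M[kbar]_n) (v v' : 'rV[kbar]_m) : Prop :=
  exists phi : 'rV[{poly kbar}]_m,
    let phi_at a := map_mx (fun p => p.[a]) phi in
    [/\ forall a, V (phi_at a),
        forall a, a != 0 -> phi_at a = gvar_act V (lam a) v
      & phi_at 0 = v'].

(* [orbit_of H v v'] : v' is conjugate to v under H. *)
Definition orbit_of (H : mset n) (v : 'rV[kbar]_m) : pset m :=
  fun v' => exists2 g, H g & v' = gvar_act V g v.

Definition cocharacter_closed (X : pset m) : Prop :=
  (forall x, X x -> V x) /\
  forall x lam x', X x -> k_cocharacter G lam -> is_limit lam x x' -> X x'.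

Definition cocharacter_closure (X : pset m) : pset m := fun x =>
  forall C : pset m, cocharacter_closed C -> (forall y, X y -> C y) -> C x.

(* [orbit_prec v' v] : G(k).v' precedes G(k).v. *)
Definition orbit_prec (v' v : 'rV[kbar]_m) : Prop :=
  cocharacter_closure (orbit_of (k_points G) v) v'.

Definition orbit_prec_antisymmetric : Prop :=
  forall v v', V v -> V v' -> orbit_prec v' v -> orbit_prec v v' ->
    forall w, orbit_of (k_points G) v w <-> orbit_of (k_points G) v' w.

End Gvariety.
End KStructures.

(* Main.v *)
Require Import Defs.
From mathcomp Require Import ring zify.
From Stdlib Require Import Classical ClassicalEpsilon.

Set Implicit Arguments.
Unset Strict Implicit.
Unset Printing Implicit Defensive.

Import GRing.Theory.
Local Open Scope ring_scope.

(** (ii) implies (iii) because (iii) is a special case.  The other two implications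
    trade conjugacy under the component group for chains of limits.

    From (i) to (ii).  Two points that precede each other lie on a closed chain
    x_0, ..., x_r = x_0 in which a limit u_i of x_i is conjugate to x_(i+1) under
    G(k) ([prec_limit_chain]).  In the power V^r this chain is a single limit,
    namely that of (x_0, ..., x_(r-1)) along the cocharacter built from the r given
    ones, and the wreath product of G with the cyclic group of order r contains a
    rational element, which shifts by one place, that maps the starting point to
    the limit.  By (i) the two are conjugate under the identity component.  Its
    elements have no shift ([connected_wreath_shift]), so u_i is conjugate to
    x_i itself, and all x_i lie in one orbit ([limit_cycle]).  This requires that the
    wreath product is a reductive group over k ([wreath_group], [wreath_reductive])
    that acts on V^r ([wreath_variety]).

    From (iii) to (i).  If the limit v' of v equals g v with g in G(k), the points
    g^i v form a chain of limits along conjugates of the given cocharacter, and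
    g^N lies in the identity component for some N > 0, so that the chain returns to
    the orbit of v under the rational points of the identity component.  Hence v
    and v' precede each other for the identity component, and (iii) applies to it
    ([antisymmetric_limit]).  This requires that the identity component has finite
    index, is defined over k and is reductive.

    Finite index holds because affine space is Noetherian ([hilbert_basis],
    [identity_component_index]).

    Fields of definition are handled through linear disjointness: a closed set is
    defined over k if and only if linear relations over kbar between regular
    functions over k come from relations over k ([k_defined_lin_disjoint]).  This
    passes to images, products and unions, which settles the wreath product.  For
    the identity component, its characteristic function on G is a polynomial over
    kbar ([coset_separation], [identity_component_indicator]) and, being idempotent
    with value 1 at the rational point 1, it equals its own norm down to k
    ([lin_disjoint_identity_component]).

    As to reductivity, let U be a connected normal unipotent subgroup of the
    identity component.  Its conjugates under G generate a connected normal
    subgroup of G, which is unipotent by Kolchin's theorem ([unipotent_mul]), and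
    so is its closure; hence U is trivial ([reductive_identity_component]). *)

(** * Algebras of regular functions *)

Section Regular.
Variables (k K : fieldType) (iota : {rmorphism k -> K}).

(** Functions that coincide on [D] with a polynomial over [k] in the
    coordinates [c].  Leaving the space [T] and the index type of the
    coordinates abstract lets one treat affine varieties, matrix groups, and
    products of these on the same footing, without packing their coordinates
    into row vectors. *)
Inductive regular (T I : Type) (D : T -> Prop) (c : I -> T -> K) :
    (T -> K) -> Prop :=
| regular_cst a : regular D c (fun _ => iota a)
| regular_coord i : regular D c (c i)
| regular_add f g : regular D c f -> regular D c g ->
    regular D c (fun t => f t + g t)
| regular_mul f g : regular D c f -> regular D c g ->
    regular D c (fun t => f t * g t)
| regular_ext f g : (forall t, D t -> f t = g t) ->
    regular D c f -> regular D c g.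

Section Closure.
Variables (T I : Type) (D : T -> Prop) (c : I -> T -> K).
Local Notation reg := (regular D c).

Lemma regular_0 : reg (fun _ => 0).
Proof. by apply: regular_ext (regular_cst D c 0) => t _; rewrite rmorph0. Qed.

Lemma regular_1 : reg (fun _ => 1).
Proof. by apply: regular_ext (regular_cst D c 1) => t _; rewrite rmorph1. Qed.

Lemma regular_opp f : reg f -> reg (fun t => - f t).
Proof.
move=> hf; apply: regular_ext (regular_mul (regular_cst D c (-1)) hf) => t _.
by rewrite rmorphN1 mulN1r.
Qed.

Lemma regular_sub f g : reg f -> reg g -> reg (fun t => f t - g t).
Proof. by move=> hf hg; apply: regular_add hf (regular_opp hg). Qed.

Lemma regular_sum (J : Type) (r : seq J) (P : pred J) (F : J -> T -> K) :
  (forall j, P j -> reg (F j)) -> reg (fun t => \sum_(j <- r | P j) F j t).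
Proof.
move=> hF; elim: r => [|j r IH].
  by apply: regular_ext regular_0 => t _; rewrite big_nil.
have [Pj|nPj] := boolP (P j); last first.
  by apply: regular_ext IH => t _; rewrite big_cons (negbTE nPj).
apply: regular_ext (regular_add (hF j Pj) IH) => t _.
by rewrite big_cons Pj.
Qed.

Lemma regular_prod (J : Type) (r : seq J) (P : pred J) (F : J -> T -> K) :
  (forall j, P j -> reg (F j)) -> reg (fun t => \prod_(j <- r | P j) F j t).
Proof.
move=> hF; elim: r => [|j r IH].
  by apply: regular_ext regular_1 => t _; rewrite big_nil.
have [Pj|nPj] := boolP (P j); last first.
  by apply: regular_ext IH => t _; rewrite big_cons (negbTE nPj).
apply: regular_ext (regular_mul (hF j Pj) IH) => t _.
by rewrite big_cons Pj.
Qed.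

Lemma regular_exp f n : reg f -> reg (fun t => f t ^+ n).
Proof.
move=> hf; have := @regular_prod 'I_n (index_enum _) xpredT (fun _ => f).
move/(_ (fun _ _ => hf)); apply: regular_ext => t _.
by rewrite prodr_const card_ord.
Qed.

Lemma regular_mulmx p q r (A : T -> 'M[K]_(p, q)) (B : T -> 'M[K]_(q, r)) :
  (forall i j, reg (fun t => A t i j)) -> (forall i j, reg (fun t => B t i j)) ->
  forall i j, reg (fun t => (A t *m B t) i j).
Proof.
move=> hA hB i j.
have h : reg (fun t => \sum_l A t i l * B t l j).
  by apply: regular_sum => l _; apply: regular_mul.
by apply: regular_ext h => t _; rewrite mxE.
Qed.

Lemma regular_det n (A : T -> 'M[K]_n) :
  (forall i j, reg (fun t => A t i j)) -> reg (fun t => \det (A t)).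
Proof.
move=> hA; rewrite /determinant.
apply: regular_sum => s _; apply: regular_mul.
  by case: (perm.odd_perm s); [apply: regular_opp|]; exact: regular_1.
by apply: regular_prod => i _.
Qed.

Lemma regular_adj n (A : T -> 'M[K]_n) :
  (forall i j, reg (fun t => A t i j)) ->
  forall i j, reg (fun t => (\adj (A t)) i j).
Proof.
move=> hA i j.
have h : reg (fun t => (-1) ^+ (j + i) * \det (row' j (col' i (A t)))).
  apply: regular_mul.
    by apply: regular_exp; apply: regular_opp; exact: regular_1.
  apply: regular_det => u v.
  by apply: regular_ext (hA (lift j u) (lift i v)) => t _; rewrite !mxE.
by apply: regular_ext h => t _; rewrite mxE.
Qed.

Lemma regular_mono (D' : T -> Prop) f :
  (forall t, D' t -> D t) -> reg f -> regular D' c f.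
Proof.
move=> sD; elim=> {f} [a|i|f g _ hf _ hg|f g _ hf _ hg|f g e _ hf].
- exact: regular_cst.
- exact: regular_coord.
- exact: regular_add.
- exact: regular_mul.
- by apply: regular_ext hf => t /sD; apply: e.
Qed.

(** Regular functions are restrictions of polynomials, hence they extend. *)
Lemma regular_extend f :
  reg f -> exists2 f', regular (fun _ => True) c f' & forall t, D t -> f' t = f t.
Proof.
elim=> {f} [a|i|f g _ [f1 hf ef] _ [g1 hg eg]|f g _ [f1 hf ef] _ [g1 hg eg]
           |f g e _ [f1 hf ef]].
- by exists (fun _ => iota a) => //; apply: regular_cst.
- by exists (c i) => //; apply: regular_coord.
- exists (fun t => f1 t + g1 t); first exact: regular_add.
  by move=> t Dt; rewrite ef ?eg.
- exists (fun t => f1 t * g1 t); first exact: regular_mul.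
  by move=> t Dt; rewrite ef ?eg.
- by exists f1 => // t Dt; rewrite ef ?e.
Qed.

Lemma regular_comp (T' I' : Type) (D' : T' -> Prop) (c' : I' -> T' -> K)
    (phi : T -> T') f :
  (forall t, D t -> D' (phi t)) ->
  (forall i, reg (fun t => c' i (phi t))) ->
  regular D' c' f -> reg (fun t => f (phi t)).
Proof.
move=> sD hc; elim=> {f} [a|i|f g _ hf _ hg|f g _ hf _ hg|f g e _ hf].
- exact: regular_cst.
- exact: hc.
- exact: regular_add.
- exact: regular_mul.
- by apply: regular_ext hf => t /sD; apply: e.
Qed.

Lemma regular_eq_coords f t s : reg f -> D t -> D s ->
  (forall i, c i t = c i s) -> f t = f s.
Proof.
move=> hf Dt Ds e; elim: hf => {f} [a|i|f g _ hf _ hg|f g _ hf _ hg|f g ef _ hf] //.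
- by rewrite hf hg.
- by rewrite hf hg.
- by rewrite -!ef.
Qed.

End Closure.

Lemma regular_polyP (T : Type) m (D : T -> Prop) (c : 'I_m -> T -> K) f :
  regular D c f <->
  exists P : {mpoly k[m]}, forall t, D t -> f t = (map_mpoly iota P).@[fun i => c i t].
Proof.
split=> [|[P hP]].
  elim=> {f} [a|i|f g _ [P hP] _ [Q hQ]|f g _ [P hP] _ [Q hQ]|f g e _ [P hP]].
  - by exists a%:MP => t _; rewrite map_mpolyC ?raddf0 // mevalC.
  - by exists 'X_i => t _; rewrite map_mpolyX mevalXU.
  - by exists (P + Q) => t Dt; rewrite rmorphD mevalD hP ?hQ.
  - by exists (P * Q) => t Dt; rewrite rmorphM mevalM hP ?hQ.
  - by exists P => t Dt; rewrite -e // hP.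
apply: (regular_ext (f := fun t => (map_mpoly iota P).@[fun i => c i t])).
  by move=> t Dt; rewrite hP.
have h : regular D c (fun t => \sum_(m0 <- msupp P)
    iota P@_m0 * \prod_(i < m) c i t ^+ m0 i).
  apply: regular_sum => m0 _; apply: regular_mul; first exact: regular_cst.
  by apply: regular_prod => i _; apply: regular_exp; apply: regular_coord.
apply: regular_ext h => t _.
have -> : map_mpoly iota P = \sum_(m0 <- msupp P) iota P@_m0 *: 'X_[m0].
  rewrite {1}[P]mpolyE rmorph_sum; apply: eq_bigr => m0 _.
  by rewrite /= map_mpolyZ map_mpolyX.
rewrite raddf_sum /=; apply: eq_bigr => m0 _.
by rewrite mevalZ mevalX.
Qed.

(** * Linear independence over the small field *)

Definition free_on (T : Type) (D : T -> Prop) r (f : 'I_r -> T -> K) :=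
  forall a : 'I_r -> k,
    (forall t, D t -> \sum_i iota (a i) * f i t = 0) -> forall i, a i = 0.

(** As long as there is a relation, a function that occurs in it is discarded. *)
Lemma basis_on (T : Type) (D : T -> Prop) (J : finType) (y : J -> T -> K) :
  exists r (s : 'I_r -> J) (A : J -> 'I_r -> k),
    free_on D (fun j => y (s j)) /\
    forall i t, D t -> y i t = \sum_j iota (A i j) * y (s j) t.
Proof.
suff H : forall r (s : 'I_r -> J) (A : J -> 'I_r -> k),
    (forall i t, D t -> y i t = \sum_j iota (A i j) * y (s j) t) ->
    exists r' (s' : 'I_r' -> J) (A' : J -> 'I_r' -> k),
      free_on D (fun j => y (s' j)) /\
      forall i t, D t -> y i t = \sum_j iota (A' i j) * y (s' j) t.
  apply: (H #|J| enum_val (fun i j => (i == enum_val j)%:R)) => i t _.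
  rewrite (bigD1 (enum_rank i)) //= enum_rankK eqxx rmorph1 mul1r.
  rewrite big1 ?addr0 // => j nj; case: eqP => [ij|]; last by rewrite rmorph0 mul0r.
  by rewrite ij enum_valK eqxx in nj.
elim=> [|r IH] s A hA.
  by exists 0%N, s, A; split=> // a _ [].
case: (classic (free_on D (fun j => y (s j)))) => [fr|].
  by exists r.+1, s, A.
move=> nfr; have [a na] := not_all_ex_not _ _ nfr.
have [ha nz] := imply_to_and _ _ na.
have [j0 /eqP aj0] := not_all_ex_not _ _ nz.
apply: (IH (fun j => s (lift j0 j))
           (fun i j => A i (lift j0 j) - A i j0 / a j0 * a (lift j0 j))).
move=> i t Dt.
have iaj0 : iota (a j0) != 0 by rewrite fmorph_eq0.
have := ha t Dt; rewrite (bigD1_ord j0) //= => /eqP.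
rewrite addr_eq0 => /eqP e0.
have {e0} e0 : y (s j0) t =
    - (\sum_j iota (a (lift j0 j)) * y (s (lift j0 j)) t) / iota (a j0).
  by rewrite -e0 mulrAC mulfV ?mul1r.
rewrite (hA i t Dt) (bigD1_ord j0) //= e0 mulrA mulrN -mulrN -!sumrN.
rewrite mulr_sumr mulr_suml -big_split /=; apply: eq_bigr => j _.
rewrite rmorphB rmorphM rmorphM fmorphV.
by field.
Qed.

Definition free_scalars r (c : 'I_r -> K) :=
  forall a : 'I_r -> k, \sum_i iota (a i) * c i = 0 -> forall i, a i = 0.

Lemma basis_scalars (J : finType) (y : J -> K) :
  exists r (s : 'I_r -> J) (A : J -> 'I_r -> k),
    free_scalars (fun j => y (s j)) /\
    forall i, y i = \sum_j iota (A i j) * y (s j).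
Proof.
have [r [s [A [fr hA]]]] := basis_on (fun _ : unit => True) (fun i _ => y i).
exists r, s, A; split=> [a ha|i]; last exact: (hA i tt).
by apply: fr => t _.
Qed.

(** * Functions on products *)

Section Tensor.
Variables (T1 I1 T2 I2 : Type).
Variables (D1 : T1 -> Prop) (c1 : I1 -> T1 -> K).
Variables (D2 : T2 -> Prop) (c2 : I2 -> T2 -> K).

Definition prod_dom (t : T1 * T2) := D1 t.1 /\ D2 t.2.
Definition prod_coord (i : I1 + I2) (t : T1 * T2) :=
  match i with inl i => c1 i t.1 | inr i => c2 i t.2 end.

Lemma regular_tensor f : regular prod_dom prod_coord f ->
  exists (J : finType) (q : J -> T1 -> K) (s : J -> T2 -> K),
    [/\ forall l, regular D1 c1 (q l), forall l, regular D2 c2 (s l) &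
        forall x y, D1 x -> D2 y -> f (x, y) = \sum_l q l x * s l y].
Proof.
elim=> {f} [a|i|f g _ [N [q [s [hq hs e]]]] _ [N' [q' [s' [hq' hs' e']]]]
            |f g _ [N [q [s [hq hs e]]]] _ [N' [q' [s' [hq' hs' e']]]]
            |f g ef _ [N [q [s [hq hs e]]]]].
- exists 'I_1, (fun _ _ => iota a), (fun _ _ => 1); split.
  + by move=> _; apply: regular_cst.
  + by move=> _; apply: regular_1.
  + by move=> x y _ _; rewrite big_ord1 mulr1.
- case: i => i.
  + exists 'I_1, (fun _ => c1 i), (fun _ _ => 1); split.
    * by move=> _; apply: regular_coord.
    * by move=> _; apply: regular_1.
    * by move=> x y _ _; rewrite big_ord1 mulr1.
  + exists 'I_1, (fun _ _ => 1), (fun _ => c2 i); split.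
    * by move=> _; apply: regular_1.
    * by move=> _; apply: regular_coord.
    * by move=> x y _ _; rewrite big_ord1 mul1r.
- exists (N + N')%type,
    (fun l => match l with inl i => q i | inr i => q' i end),
    (fun l => match l with inl i => s i | inr i => s' i end); split.
  + by case.
  + by case.
  + by move=> x y Dx Dy; rewrite e // e' // big_sumType.
- exists (N * N')%type, (fun l x => q l.1 x * q' l.2 x),
    (fun l y => s l.1 y * s' l.2 y); split.
  + by move=> l; apply: regular_mul.
  + by move=> l; apply: regular_mul.
  + move=> x y Dx Dy; rewrite e // e' // mulr_suml.
    rewrite -[RHS](pair_bigA _ (fun i j => q i x * q' j x * (s i y * s' j y))) /=.
    apply: eq_bigr => i _; rewrite mulr_sumr; apply: eq_bigr => j _.
    by rewrite mulrACA.
- by exists N, q, s; split=> // x y Dx Dy; rewrite -ef ?e //.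
Qed.

(** Pass to a basis on the second factor of all the functions that occur in the
    tensor expansions.  The freeness of [s] is what makes the coefficients [q]
    computable from the values of [f]. *)
Lemma regular_tensor_free (J : finType) (f : J -> T1 * T2 -> K) :
  (forall j, regular prod_dom prod_coord (f j)) ->
  exists r (q : J -> 'I_r -> T1 -> K) (s : 'I_r -> T2 -> K),
    [/\ forall j l, regular D1 c1 (q j l), forall l, regular D2 c2 (s l),
        free_on D2 s &
        forall j x y, D1 x -> D2 y -> f j (x, y) = \sum_l q j l x * s l y].
Proof.
move=> hf.
pose P j (w : {N : finType & ((N -> T1 -> K) * (N -> T2 -> K))%type}) :=
  [/\ forall l, regular D1 c1 ((projT2 w).1 l),
      forall l, regular D2 c2 ((projT2 w).2 l) &
      forall x y, D1 x -> D2 y ->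
        f j (x, y) = \sum_l (projT2 w).1 l x * (projT2 w).2 l y].
have /(_ _)/constructive_indefinite_description hP : forall j, exists w, P j w.
  move=> j; have [N [q [s h]]] := regular_tensor (hf j).
  by exists (existT _ N (q, s)).
pose w j := proj1_sig (hP j); have hw j : P j (w j) := proj2_sig (hP j).
pose N j : finType := projT1 (w j).
have [r [s [A [fr hA]]]] :=
  basis_on D2 (fun u : {j : J & N j} => (projT2 (w (tag u))).2 (tagged u)).
exists r, (fun j l x => \sum_i (projT2 (w j)).1 i x * iota (A (Tagged N i) l)).
exists (fun l => (projT2 (w (tag (s l)))).2 (tagged (s l))); split=> //.
- move=> j l; apply: regular_sum => i _; apply: regular_mul.
    by have [hq _ _] := hw j; apply: hq.
  exact: regular_cst.
- by move=> l; have [_ hs _] := hw (tag (s l)); apply: hs.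
- move=> j x y Dx Dy; have [_ _ ->] := hw j => //.
  under [RHS]eq_bigr do rewrite mulr_suml.
  rewrite exchange_big /=; apply: eq_bigr => i _.
  rewrite (hA (Tagged N i) y Dy) /= mulr_sumr.
  by apply: eq_bigr => l _; rewrite mulrA.
Qed.
End Tensor.
End Regular.

(** * Rationality of vanishing ideals as linear disjointness *)

Section LinDisjoint.
Variables (k K : fieldType) (iota : {rmorphism k -> K}).

(** A criterion for being defined over [k] that mentions only the [k]-algebra
    of regular functions, not an embedding or an ideal: linear relations over
    [K] among functions defined over [k] come from relations over [k].  It is
    visibly stable under unions, and it passes to images and products. *)
Definition lin_disjoint (T I : Type) (D : T -> Prop) (c : I -> T -> K) :=
  forall r (a : 'I_r -> K) (f : 'I_r -> T -> K),
    free_scalars iota a -> (forall i, regular iota D c (f i)) ->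
    (forall t, D t -> \sum_i a i * f i t = 0) ->
    forall i t, D t -> f i t = 0.

(** Expand the scalars [a] on a free family [b]: each member of [b] contributes
    one relation over [k]. *)
Lemma lin_disjoint_relation (T I : Type) (D : T -> Prop) (c : I -> T -> K)
    (J : finType) (a : J -> K) (f : J -> T -> K) :
  lin_disjoint D c -> (forall j, regular iota D c (f j)) ->
  (forall t, D t -> \sum_j a j * f j t = 0) ->
  exists r (b : 'I_r -> K) (A : J -> 'I_r -> k),
    [/\ free_scalars iota b, forall j, a j = \sum_i iota (A j i) * b i &
      forall i t, D t -> \sum_j iota (A j i) * f j t = 0].
Proof.
move=> ld hf e; have [r [s [A [fr hA]]]] := basis_scalars iota a.
exists r, (fun j => a (s j)), A; split=> // i t Dt.
apply: (ld _ _ (fun i t => \sum_j iota (A j i) * f j t) fr) => // [i'|{t Dt}t Dt].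
  by apply: regular_sum => j _; apply: regular_mul => //; apply: regular_cst.
rewrite -[RHS](e t Dt); under eq_bigr do rewrite mulr_sumr.
rewrite exchange_big /=; apply: eq_bigr => j _; rewrite (hA j) mulr_suml.
by apply: eq_bigr => l _; ring.
Qed.

(** Independence over [k] persists over [K]: a relation over [K] decomposes into
    relations over [k], which are trivial. *)
Lemma lin_disjoint_free (T I : Type) (D : T -> Prop) (c : I -> T -> K) r
    (s : 'I_r -> T -> K) (b : 'I_r -> K) :
  lin_disjoint D c -> (forall l, regular iota D c (s l)) -> free_on iota D s ->
  (forall t, D t -> \sum_l b l * s l t = 0) -> forall l, b l = 0.
Proof.
move=> ld hs fr e l.
have [N [b' [A [_ hb hA]]]] := lin_disjoint_relation ld hs e.
rewrite hb big1 // => i _; rewrite (fr (fun j => A j i)) ?rmorph0 ?mul0r //.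
by move=> t; apply: hA.
Qed.

Lemma lin_disjoint_image (T I T' I' : Type) (D : T -> Prop) (c : I -> T -> K)
    (D' : T' -> Prop) (c' : I' -> T' -> K) (phi : T -> T') :
  (forall t, D t -> D' (phi t)) ->
  (forall i, regular iota D c (fun t => c' i (phi t))) ->
  (forall t', D' t' -> exists2 t, D t & forall i, c' i t' = c' i (phi t)) ->
  lin_disjoint D c -> lin_disjoint D' c'.
Proof.
move=> sD hc surj ld r a f fr hf e i t' Dt'.
have [t Dt et] := surj t' Dt'.
rewrite (regular_eq_coords (hf i) Dt' (sD t Dt) et).
apply: (ld r a (fun i t => f i (phi t)) fr) => // [j|u Du]; last exact/e/sD.
exact: regular_comp sD hc (hf j).
Qed.

Lemma lin_disjoint_union (T I J : Type) (D : T -> Prop) (c : I -> T -> K)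
    (E : J -> T -> Prop) :
  (forall j t, E j t -> D t) -> (forall t, D t -> exists j, E j t) ->
  (forall j, lin_disjoint (E j) c) -> lin_disjoint D c.
Proof.
move=> sE cov ld r a f fr hf e i t Dt; have [j Et] := cov t Dt.
apply: (ld j r a f fr) => // [i'|u Eu]; last exact/e/(sE j).
exact: (regular_mono (sE j)).
Qed.

(** A relation on [E] becomes a relation on [D] after multiplication by the
    idempotent [e], which is defined over [k]. *)
Lemma lin_disjoint_cut (T I : Type) (D E : T -> Prop) (c : I -> T -> K) e :
  regular iota D c e -> (forall t, E t -> D t /\ e t = 1) ->
  (forall t, D t -> ~ E t -> e t = 0) -> lin_disjoint D c -> lin_disjoint E c.
Proof.
move=> he hE hNE ld r a f fr hf e0 i t Et; have [Dt et] := hE t Et.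
have /(_ _)/constructive_indefinite_description hg :
    forall i, exists g, regular iota D c g /\ forall t, E t -> g t = f i t.
  move=> j; have [g hg eg] := regular_extend (hf j); exists g; split=> //.
  exact: (regular_mono _ hg).
pose g j := proj1_sig (hg j).
have [hg1 hg2] : (forall j, regular iota D c (g j)) /\
    forall j t, E t -> g j t = f j t.
  by split=> j; have [] := proj2_sig (hg j).
rewrite -hg2 // -[LHS]mulr1 -et.
apply: (ld r a (fun i t => g i t * e t) fr) => // [j|u Du].
  exact: regular_mul.
case: (classic (E u)) => Eu; last first.
  by apply: big1 => j _; rewrite hNE ?mulr0.
have [_ ->] := hE u Eu; rewrite -[RHS](e0 u Eu); apply: eq_bigr => j _.
by rewrite mulr1 hg2.
Qed.

(** Expand the functions along a family that is free on the second factor: it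
    stays free over [K], so the coefficients satisfy the relation on the first
    factor. *)
Lemma lin_disjoint_prod (T1 I1 T2 I2 : Type) (D1 : T1 -> Prop)
    (c1 : I1 -> T1 -> K) (D2 : T2 -> Prop) (c2 : I2 -> T2 -> K) :
  lin_disjoint D1 c1 -> lin_disjoint D2 c2 ->
  lin_disjoint (prod_dom D1 D2) (prod_coord c1 c2).
Proof.
move=> ld1 ld2 r a f fr hf e i [x y] [/= Dx Dy].
have [N [q [s [hq hs frs hqs]]]] := regular_tensor_free hf.
rewrite hqs // big1 // => l _; apply/eqP; rewrite mulf_eq0; apply/orP; left.
apply/eqP; apply: (ld1 r a (fun i => q i l) fr) => // {Dx} {}x Dx.
apply: (lin_disjoint_free (b := fun l => \sum_i a i * q i l x) ld2 hs frs).
move=> {Dy} {}y Dy; rewrite -[RHS](e (x, y)) //.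
under eq_bigr do rewrite mulr_suml.
rewrite exchange_big /=; apply: eq_bigr => j _; rewrite hqs // mulr_sumr.
by apply: eq_bigr => l' _; rewrite mulrA.
Qed.

(** At a [k]-rational point the regular functions over [k] have values in [k]. *)
Lemma lin_disjoint_point (T I : Type) (D : T -> Prop) (c : I -> T -> K) t :
  (forall i, exists a, c i t = iota a) -> (forall u, D u <-> u = t) ->
  lin_disjoint D c.
Proof.
move=> hc hD r a f fr hf e i u Du.
have rat g : regular iota D c g -> exists b, g t = iota b.
  elim=> {g} [b|j|g h _ [b hb] _ [b' hb']|g h _ [b hb] _ [b' hb']|g h egh _ [b hb]].
  - by exists b.
  - exact: hc.
  - by exists (b + b'); rewrite hb hb' rmorphD.
  - by exists (b * b'); rewrite hb hb' rmorphM.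
  - by exists b; rewrite -egh //; apply/hD.
have /(_ _)/constructive_indefinite_description hb i' := rat _ (hf i').
have := e t; rewrite (proj1 (hD u) Du) => /(_ (proj2 (hD t) erefl)) et.
rewrite (proj2_sig (hb i)) (fr (fun i => proj1_sig (hb i))) ?rmorph0 //.
by rewrite -[RHS]et; apply: eq_bigr => j _; rewrite -(proj2_sig (hb j)) mulrC.
Qed.

Definition pow_dom (T : Type) r (D : T -> Prop) (t : 'I_r -> T) :=
  forall i, D (t i).
Definition pow_coord (T I : Type) r (c : I -> T -> K) (j : 'I_r * I)
  (t : 'I_r -> T) := c j.2 (t j.1).

Lemma lin_disjoint_pow (T I : Type) (D : T -> Prop) (c : I -> T -> K) r :
  lin_disjoint D c -> lin_disjoint (@pow_dom T r D) (pow_coord c).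
Proof.
move=> ld; elim: r => [|r IH].
  have z : 'I_0 -> T by case.
  apply: (lin_disjoint_image (T := unit) (I := void) (D := fun _ => True)
     (c := fun _ _ => 0) (phi := fun _ => z)).
  - by move=> t _ [].
  - by move=> [[]].
  - by move=> t' _; exists tt => // [[[]]].
  - by apply: (lin_disjoint_point (t := tt)) => // -[].
apply: (lin_disjoint_image (T := T * ('I_r -> T)) (phi := fun u i =>
    if unlift ord0 i is Some j then u.2 j else u.1) _ _ _ (lin_disjoint_prod ld IH)).
- by move=> [x t] [/= Dx Dt] i; case: unliftP => [j _|_] /=; [apply: Dt|].
- move=> [i j]; rewrite /pow_coord /=; case: (unliftP ord0 i) => [l _|_].
    exact: (regular_coord _ _ _ (inr (l, j))).
  exact: (regular_coord _ _ _ (inl j)).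
- move=> t Dt; exists (t ord0, fun j => t (lift ord0 j)).
    by split=> [|j]; apply: Dt.
  by move=> [i j]; rewrite /pow_coord /=; case: unliftP => [l ->|->].
Qed.

End LinDisjoint.

Definition affine_coord (K : fieldType) m (i : 'I_m) (x : 'rV[K]_m) := x 0 i.

Lemma map_mpoly_id (K : fieldType) m (p : {mpoly K[m]}) : map_mpoly idfun p = p.
Proof. by apply/mpolyP => u; rewrite mcoeff_map_mpoly. Qed.

Lemma peval_sum (K : fieldType) m (J : Type) (r : seq J) (P : pred J)
    (F : J -> {mpoly K[m]}) x :
  peval (\sum_(j <- r | P j) F j) x = \sum_(j <- r | P j) peval (F j) x.
Proof. exact: raddf_sum. Qed.

Lemma pevalM (K : fieldType) m (p q : {mpoly K[m]}) x :
  peval (p * q) x = peval p x * peval q x.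
Proof. exact: mevalM. Qed.

Lemma pevalZ (K : fieldType) m a (p : {mpoly K[m]}) x : peval (a *: p) x = a * peval p x.
Proof. exact: mevalZ. Qed.

Section KDefined.
Variables (k : fieldType) (kbar : closedFieldType) (iota : {rmorphism k -> kbar}).

(** The scalars [d] are carried along so that one basis serves for them and for
    the coefficients of the polynomials. *)
Lemma mpoly_expand (J : finType) m (p : J -> {mpoly kbar[m]}) (d : J -> kbar) :
  exists r (b : 'I_r -> kbar) (q : J -> 'I_r -> {mpoly k[m]}) (g : J -> 'I_r -> k),
    [/\ free_scalars iota b,
      forall j, p j = \sum_i b i *: map_mpoly iota (q j i) &
      forall j, d j = \sum_i iota (g j i) * b i].
Proof.
pose y (u : {j : J & seq_sub (msupp (p j))} + J) :=
  match u with inl u => (p (tag u))@_(val (tagged u)) | inr j => d j end.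
have [r [s [A [fr hA]]]] := basis_scalars iota y.
pose tg j u := existT (fun j => seq_sub (msupp (p j))) j u.
pose coef (j : J) (i : 'I_r) m0 := if insub m0 is Some u
  then A (inl (tg j u)) i else 0.
exists r, (fun j => y (s j)),
  (fun j i => \sum_(m0 <- msupp (p j)) coef j i m0 *: 'X_[m0]),
  (fun j i => A (inr j) i); split=> [|j|j] //; last exact: (hA (inr j)).
rewrite {1}[p j]mpolyE.
under [RHS]eq_bigr do rewrite rmorph_sum scaler_sumr.
rewrite exchange_big /= big_seq [RHS]big_seq; apply: eq_bigr => m0 hm0.
pose u : seq_sub (msupp (p j)) := SeqSub hm0.
under eq_bigr do rewrite map_mpolyZ map_mpolyX scalerA.
rewrite -scaler_suml; congr (_ *: _).
rewrite -[LHS]/(y (inl (tg j u))) hA.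
by rewrite -[m0]/(val u); apply: eq_bigr => i _; rewrite /coef (valK u) mulrC.
Qed.

Lemma regular_peval m (X : 'rV[kbar]_m -> Prop) f :
  regular iota X (@affine_coord _ m) f <->
  exists P, forall x, X x -> f x = peval (map_mpoly iota P) x.
Proof. exact: regular_polyP. Qed.

(** If the ideal is generated over [k], then comparing coefficients along a basis
    of the scalars shows that the components of a vanishing polynomial are
    combinations of generators.  Conversely, linear disjointness makes the
    components over [k] of a vanishing polynomial vanish, and these generate. *)
Lemma k_defined_lin_disjoint m (X : 'rV[kbar]_m -> Prop) :
  k_defined iota X <-> zariski_closed X /\ lin_disjoint iota X (@affine_coord _ m).
Proof.
split=> [[clX gen]|[clX ld]]; split=> //.
  move=> r a f fr hf e i x Xx.
  have /(_ _)/constructive_indefinite_description hP i' :=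
    proj1 (regular_peval _ _) (hf i').
  pose P i := proj1_sig (hP i).
  have eP j y : X y -> f j y = peval (map_mpoly iota (P j)) y := proj2_sig (hP j) y.
  have /gen [s [hs es]] : vanishes_on X (\sum_i a i *: map_mpoly iota (P i)).
    move=> y Xy; rewrite peval_sum -[RHS](e y Xy); apply: eq_bigr => j _.
    by rewrite pevalZ eP.
  (* Expand the multipliers in the given generation, together with the
     scalars [a], along one basis [b], and compare coefficients of [b]. *)
  pose J := ('I_(size s) + 'I_r)%type.
  pose c0 : {mpoly kbar[m]} * {mpoly k[m]} := (0, 0).
  have [N [b [q [g [frb hq hg]]]]] := mpoly_expand
    (fun j : J => if j is inl j then (nth c0 s j).1 else 0)
    (fun j : J => if j is inr j then a j else 0).
  have key l : \sum_i g (inr i) l *: P i =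
      \sum_(j < size s) q (inl j) l * (nth c0 s j).2.
    apply/mpolyP => m0; apply/eqP; rewrite -subr_eq0; apply/eqP.
    apply: (frb (fun l => (\sum_i g (inr i) l *: P i)@_m0 -
      (\sum_(j < size s) q (inl j) l * (nth c0 s j).2)@_m0)).
    under eq_bigr do rewrite rmorphB mulrBl.
    rewrite sumrB; apply/eqP; rewrite subr_eq0; apply/eqP.
    transitivity ((\sum_i a i *: map_mpoly iota (P i))@_m0); last first.
      rewrite es (big_nth c0) big_mkord.
      transitivity ((\sum_(i < size s) \sum_l b l *:
          map_mpoly iota (q (inl i) l * (nth c0 s i).2))@_m0).
        congr (_@__); apply: eq_bigr => i' _; rewrite (hq (inl i')) mulr_suml.
        by apply: eq_bigr => l' _; rewrite rmorphM scalerAl.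
      rewrite exchange_big raddf_sum /=; apply: eq_bigr => l' _.
      rewrite -mcoeff_map_mpoly rmorph_sum !raddf_sum mulr_suml /=.
      by apply: eq_bigr => i' _; rewrite mcoeffZ mulrC.
    rewrite raddf_sum /=.
    transitivity (\sum_i \sum_l iota (g (inr i) l) * b l * iota (P i)@_m0).
      rewrite exchange_big /=; apply: eq_bigr => l' _.
      rewrite raddf_sum rmorph_sum mulr_suml /=; apply: eq_bigr => i' _.
      by rewrite mcoeffZ rmorphM mulrAC.
    apply: eq_bigr => i' _; rewrite mcoeffZ mcoeff_map_mpoly -mulr_suml.
    by rewrite -(hg (inr i')).
  have van l y : X y -> \sum_i iota (g (inr i) l) * f i y = 0.
    move=> Xy; transitivity (peval (map_mpoly iota (\sum_i g (inr i) l *: P i)) y).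
      rewrite rmorph_sum peval_sum; apply: eq_bigr => j _ /=.
      by rewrite map_mpolyZ pevalZ eP.
    rewrite key rmorph_sum peval_sum big1 // => j _.
    rewrite /= rmorphM pevalM hs ?mulr0 //.
    by apply: mem_nth.
  (* The coefficient matrix of the free family [a] has a left inverse. *)
  pose G := \matrix_(i, l) g (inr i) l.
  have fG : row_free G.
    apply/inj_row_free => v hv; apply/rowP => j; rewrite [RHS]mxE.
    apply: (fr (fun j => v 0 j)).
    under eq_bigr => j' _ do rewrite (hg (inr j')) mulr_sumr.
    rewrite exchange_big big1 //= => l _.
    under eq_bigr do rewrite mulrA -rmorphM.
    rewrite -mulr_suml -rmorph_sum.
    move/rowP/(_ l): hv; rewrite !mxE; under eq_bigr do rewrite mxE.
    by move=> ->; rewrite rmorph0 mul0r.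
  have [B GB] := row_freeP fG.
  transitivity (\sum_l iota (B l i) * \sum_j iota (g (inr j) l) * f j x); last first.
    by apply: big1 => l _; rewrite van ?mulr0.
  under eq_bigr do rewrite mulr_sumr.
  rewrite exchange_big (bigD1 i) //=.
  have eGB j : \sum_l iota (B l i) * (iota (g (inr j) l) * f j x)
      = iota ((j == i)%:R) * f j x.
    move/matrixP/(_ j i): GB; rewrite !mxE => <-.
    rewrite rmorph_sum mulr_suml; apply: eq_bigr => l _.
    by rewrite mxE rmorphM mulrA [_ * iota (g _ _)]mulrC.
  rewrite eGB eqxx rmorph1 mul1r big1 ?addr0 // => j nj.
  by rewrite eGB (negbTE nj) rmorph0 mul0r.
move=> p hp.
have [N [b [q [g [frb hq _]]]]] := mpoly_expand (fun _ : 'I_1 => p) (fun _ => 0).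
exists [seq (mpolyC m (b i), q ord0 i) | i <- enum 'I_N]; split.
  move=> c /mapP [i _ ->] /= x Xx.
  apply: (ld N b (fun i x => peval (map_mpoly iota (q ord0 i)) x) frb _ _ i x Xx).
    by move=> j; apply/regular_peval; exists (q ord0 j).
  move=> y Xy; rewrite -[RHS](hp y Xy) (hq ord0) peval_sum; apply: eq_bigr => j _.
  by rewrite pevalZ.
rewrite big_map big_enum (hq ord0) /=; apply: eq_bigr => i _.
by rewrite mul_mpolyC.
Qed.

End KDefined.

(** * The Zariski topology in coordinates *)

Notation polyfun := (@regular _ _ idfun _ _).

Section Topology.
Variable K : fieldType.

(** [Z] cuts out a closed subset of [D]; its points outside [D] are ignored, so
    that one need not form subtypes. *)
Definition closed_in (T I : Type) (D : T -> Prop) (c : I -> T -> K)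
    (Z : T -> Prop) :=
  exists2 S : (T -> K) -> Prop, forall f, S f -> polyfun D c f &
    forall t, D t -> (Z t <-> forall f, S f -> f t = 0).

Definition connected_in (T I : Type) (c : I -> T -> K) (H : T -> Prop) :=
  forall Z1 Z2, closed_in H c Z1 -> closed_in H c Z2 ->
    (forall t, H t -> Z1 t \/ Z2 t) -> (forall t, H t -> ~ (Z1 t /\ Z2 t)) ->
    (forall t, H t -> Z1 t) \/ (forall t, H t -> Z2 t).

Section Closed.
Variables (T I : Type) (D : T -> Prop) (c : I -> T -> K).

Lemma closed_zero f : polyfun D c f -> closed_in D c (fun t => f t = 0).
Proof.
move=> hf; exists (fun g => g = f) => [g -> //|t Dt].
by split=> [ft g ->|->].
Qed.

Lemma closed_eq f g : polyfun D c f -> polyfun D c g ->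
  closed_in D c (fun t => f t = g t).
Proof.
move=> hf hg; have [S hS eS] := closed_zero (regular_sub hf hg).
exists S => // t Dt; rewrite -eS //; split=> [->|/eqP]; first exact: subrr.
by rewrite subr_eq0 => /eqP.
Qed.

Lemma closed_ext Z Z' : (forall t, D t -> (Z t <-> Z' t)) ->
  closed_in D c Z -> closed_in D c Z'.
Proof. by move=> e [S hS eS]; exists S => // t Dt; rewrite -e // eS. Qed.

Lemma closed_all (J : Type) (P : J -> Prop) (Z : J -> T -> Prop) :
  (forall j, P j -> closed_in D c (Z j)) ->
  closed_in D c (fun t => forall j, P j -> Z j t).
Proof.
move=> hZ; exists (fun f => exists j, P j /\ exists S : (T -> K) -> Prop,
  [/\ forall f, S f -> polyfun D c f,
      forall t, D t -> (Z j t <-> forall f, S f -> f t = 0) & S f]).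
  by move=> f [j [Pj [S [hS _ Sf]]]]; apply: hS.
move=> t Dt; split=> [h f [j [Pj [S [_ eS Sf]]]]|h j Pj].
  by move/(eS t Dt): (h j Pj); apply.
have [S hS eS] := hZ j Pj.
by apply/(eS t Dt) => f Sf; apply: h; exists j; split=> //; exists S.
Qed.

Lemma closed_forall (J : Type) (Z : J -> T -> Prop) :
  (forall j, closed_in D c (Z j)) -> closed_in D c (fun t => forall j, Z j t).
Proof.
move=> hZ; apply: closed_ext (closed_all (P := fun _ => True) (fun j _ => hZ j)).
by move=> t _; split=> [h j|h j _]; apply: h.
Qed.

Lemma closed_and Z1 Z2 : closed_in D c Z1 -> closed_in D c Z2 ->
  closed_in D c (fun t => Z1 t /\ Z2 t).
Proof.
move=> h1 h2; apply: closed_ext (closed_forall (Z := fun b : bool => if b then Z1 else Z2) _).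
  by move=> t _; split=> [h|[? ?] []] //; split; [apply: (h true)|apply: (h false)].
by case.
Qed.

Lemma closed_or Z1 Z2 : closed_in D c Z1 -> closed_in D c Z2 ->
  closed_in D c (fun t => Z1 t \/ Z2 t).
Proof.
move=> [S1 h1 e1] [S2 h2 e2].
exists (fun f => exists f1 f2, [/\ S1 f1, S2 f2 & f = (fun t => f1 t * f2 t)]).
  by move=> f [f1 [f2 [S1f S2f ->]]]; apply: regular_mul; [apply: h1|apply: h2].
move=> t Dt; rewrite e1 // e2 //; split=> [[h|h] f [f1 [f2 [S1f S2f ->]]]|h].
- by rewrite h ?mul0r.
- by rewrite (h f2) ?mulr0.
- apply: NNPP => /not_or_and [/not_all_ex_not [f1 n1] /not_all_ex_not [f2 n2]].
  apply: (n1) => S1f; apply/eqP/negP => f1t; apply: (n2) => S2f; apply/eqP.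
  have /eqP := h _ (ex_intro _ f1 (ex_intro _ f2 (And3 S1f S2f erefl))).
  by rewrite mulf_eq0 (negbTE (introN idP f1t)).
Qed.

Lemma closed_false : closed_in D c (fun _ => False).
Proof.
apply: closed_ext (closed_zero (regular_1 _ D c)) => t _.
by split=> // /eqP; rewrite oner_eq0.
Qed.

Lemma closed_exists_ord r (Z : 'I_r -> T -> Prop) :
  (forall j, closed_in D c (Z j)) -> closed_in D c (fun t => exists j, Z j t).
Proof.
elim: r Z => [|r IH] Z hZ.
  by apply: closed_ext closed_false => t _; split=> // [[[]]].
apply: closed_ext (closed_or (hZ ord0) (IH (fun j => Z (lift ord0 j)) (fun j => hZ _))).
move=> t _; split=> [[h|[j h]]|[j]]; [by exists ord0|by exists (lift ord0 j)|].
by case: (unliftP ord0 j) => [j' ->|->]; [right; exists j'|left].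
Qed.

Lemma closed_mono (D' : T -> Prop) Z :
  (forall t, D' t -> D t) -> closed_in D c Z -> closed_in D' c Z.
Proof.
move=> sD [S hS eS]; exists S => [f /hS|t /sD]; last exact: eS.
exact: regular_mono.
Qed.

(** The defining functions extend, because they are restrictions of polynomials. *)
Lemma closed_extend (D' : T -> Prop) Z : (forall t, D t -> D' t) ->
  closed_in D c Z ->
  exists2 Z', closed_in D' c Z' & forall t, D t -> (Z' t <-> Z t).
Proof.
move=> sD [S hS eS].
pose S' f := polyfun D' c f /\ exists2 g, S g & forall t, D t -> f t = g t.
exists (fun t => forall f, S' f -> f t = 0).
  by exists S' => // f [].
move=> t Dt; rewrite eS //; split=> [h f Sf|h f [_ [g Sg ->]]] //; last exact: h.
have [f' hf' ef'] := regular_extend (hS f Sf).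
rewrite -ef' //; apply: h; split; last by exists f.
exact: regular_mono hf'.
Qed.

Lemma closed_comp (T' I' : Type) (D' : T' -> Prop) (c' : I' -> T' -> K)
    (phi : T -> T') Z :
  (forall t, D t -> D' (phi t)) ->
  (forall i, polyfun D c (fun t => c' i (phi t))) ->
  closed_in D' c' Z -> closed_in D c (fun t => Z (phi t)).
Proof.
move=> sD hc [S hS eS].
exists (fun f => exists2 g, S g & f = (fun t => g (phi t))).
  by move=> f [g Sg ->]; apply: regular_comp sD hc (hS g Sg).
move=> t Dt; rewrite eS; last exact: sD.
by split=> [h f [g Sg ->]|h g Sg]; [apply: h | apply: (h (fun t => g (phi t))); exists g].
Qed.

Lemma closed_eq_coords Z t s : closed_in D c Z -> D t -> D s ->
  (forall i, c i t = c i s) -> Z t -> Z s.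
Proof.
move=> [S hS eS] Dt Ds e /(eS t Dt) h; apply/(eS s Ds) => f Sf.
by rewrite -(regular_eq_coords (hS f Sf) Dt Ds e); apply: h.
Qed.

Definition closure_in (H : T -> Prop) (t : T) :=
  forall Z, closed_in D c Z /\ (forall u, H u -> Z u) -> Z t.

Lemma closure_in_closed H : closed_in D c (closure_in H).
Proof. by apply: closed_all => Z []. Qed.

Lemma closure_in_sub H t : H t -> closure_in H t.
Proof. by move=> Ht Z [_]; apply. Qed.

Lemma closure_in_min H Z t : closed_in D c Z -> (forall u, H u -> Z u) ->
  closure_in H t -> Z t.
Proof. by move=> hZ sZ; apply. Qed.

End Closed.

(** A separation of the closure induces one of [H]; if one part contains [H],
    it contains the closure. *)
Lemma connected_closure (T I : Type) (D : T -> Prop) (c : I -> T -> K) H :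
  (forall t, H t -> D t) -> connected_in c H ->
  connected_in c (fun t => D t /\ closure_in D c H t).
Proof.
move=> sD conn Z1 Z2 h1 h2 cov disj.
have sH t : H t -> D t /\ closure_in D c H t.
  by move=> Ht; split; [apply: sD|apply: closure_in_sub].
have sub Z : closed_in (fun t => D t /\ closure_in D c H t) c Z ->
    (forall t, H t -> Z t) -> forall t, D t /\ closure_in D c H t -> Z t.
  move=> hZ HZ t Ct.
  have [|Z' hZ' eZ'] := closed_extend (D' := D) _ hZ; first by move=> u [].
  apply/(eZ' t Ct); apply: (closure_in_min hZ') (proj2 Ct) => u Hu.
  by apply/eZ'; [apply: sH|apply: HZ].
have [] := conn Z1 Z2.
- exact: closed_mono sH h1.
- exact: closed_mono sH h2.
- by move=> t /sH; apply: cov.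
- by move=> t /sH; apply: disj.
- by move=> h; left; apply: sub.
- by move=> h; right; apply: sub.
Qed.

Lemma connected_ext (T I : Type) (c : I -> T -> K) (H H' : T -> Prop) :
  (forall t, H t <-> H' t) -> connected_in c H -> connected_in c H'.
Proof.
move=> e conn Z1 Z2 h1 h2 cov disj.
have [] := conn Z1 Z2.
- by apply: closed_mono h1 => t /e.
- by apply: closed_mono h2 => t /e.
- by move=> t /e; apply: cov.
- by move=> t /e; apply: disj.
- by move=> h; left=> t /e; apply: h.
- by move=> h; right=> t /e; apply: h.
Qed.

Lemma connected_image (T I T' I' : Type) (c : I -> T -> K) (c' : I' -> T' -> K)
    (H : T -> Prop) (H' : T' -> Prop) (phi : T -> T') :
  (forall t, H t -> H' (phi t)) ->
  (forall i, polyfun H c (fun t => c' i (phi t))) ->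
  (forall t', H' t' -> exists2 t, H t & forall i, c' i t' = c' i (phi t)) ->
  connected_in c H -> connected_in c' H'.
Proof.
move=> sH hc surj conn Z1 Z2 h1 h2 cov disj.
have up Z : closed_in H' c' Z -> (forall t, H t -> Z (phi t)) -> forall t', H' t' -> Z t'.
  move=> hZ h t' Ht'; have [t Ht et] := surj t' Ht'.
  by apply: (closed_eq_coords (t := phi t) hZ) => //; [apply: sH|apply: h].
have [] := conn (fun t => Z1 (phi t)) (fun t => Z2 (phi t)).
- exact: closed_comp sH hc h1.
- exact: closed_comp sH hc h2.
- by move=> t /sH; apply: cov.
- by move=> t /sH; apply: disj.
- by move=> h; left; apply: up.
- by move=> h; right; apply: up.
Qed.

(** Every piece lies in the part of a separation that contains [t0]. *)
Lemma connected_union (T I J : Type) (c : I -> T -> K) (H : T -> Prop)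
    (E : J -> T -> Prop) t0 :
  (forall j t, E j t -> H t) -> (forall t, H t -> exists2 j, E j t & E j t0) ->
  (forall j, connected_in c (E j)) -> connected_in c H.
Proof.
move=> sE cov conn Z1 Z2 h1 h2 Zcov disj.
have part Z Z' : closed_in H c Z -> closed_in H c Z' ->
    (forall t, H t -> Z t \/ Z' t) -> (forall t, H t -> ~ (Z t /\ Z' t)) ->
    Z t0 -> forall t, H t -> Z t.
  move=> h h' Zcov' disj' Zt0 t Ht; have [j Et Et0] := cov t Ht.
  have [] := conn j Z Z'.
  - exact: closed_mono (sE j) h.
  - exact: closed_mono (sE j) h'.
  - by move=> u /sE; apply: Zcov'.
  - by move=> u /sE; apply: disj'.
  - by apply.
  - by move=> /(_ t0 Et0) Zt0'; case: (disj' t0 (sE _ _ Et0)).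
case: (classic (exists t, H t)) => [[t Ht]|nH]; last first.
  by left=> t Ht; case: nH; exists t.
have [j _ Et0] := cov t Ht.
have [Z1t0|Z2t0] := Zcov t0 (sE j t0 Et0); [left|right].
  exact: (part Z1 Z2).
apply: (part Z2 Z1) => // [u /Zcov []|u /disj d [z z']]; by [right|left|apply: d].
Qed.

Lemma connected_point (T I : Type) (c : I -> T -> K) (t0 : T) :
  connected_in c (fun t => t = t0).
Proof.
move=> Z1 Z2 _ _ cov _.
by case: (cov t0 erefl) => h; [left|right] => _ ->.
Qed.

(** * Comparison with embedded varieties and matrix groups *)

Lemma zariski_closedP m (X : 'rV[K]_m -> Prop) :
  zariski_closed X <-> closed_in (fun _ => True) (@affine_coord K m) X.
Proof.
split=> [[S eS]|[S hS eS]].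
  exists (fun f => exists2 p, S p & f = peval p).
    move=> f [p Sp ->]; apply/regular_polyP; exists p => x _.
    by rewrite map_mpoly_id.
  move=> x _; rewrite eS; split=> [h f [p Sp ->]|h p Sp]; first exact: h.
  by apply: (h (peval p)); exists p.
exists (fun p => S (peval p) \/ exists2 f, S f & forall x, f x = peval p x).
move=> x; rewrite eS //; split=> [h p [/h //|[f Sf <-]]|h f Sf]; first exact: h.
have /regular_polyP [p ep] := hS f Sf.
rewrite map_mpoly_id in ep.
by rewrite ep //; apply: h; right; exists f => // y; rewrite ep.
Qed.

Lemma zariski_connectedP (T : Type) m (H : T -> Prop) (c : T -> 'rV[K]_m) :
  zariski_connected (fun x => exists2 t, H t & x = c t) <->
  connected_in (fun i t => c t 0 i) H.
Proof.
split=> [conn Z1 Z2 h1 h2 cov disj|conn Z1 Z2 h1 h2 cov disj].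
  have ext Z : closed_in H (fun i t => c t 0 i) Z ->
      exists2 Z', zariski_closed Z' & forall t, H t -> (Z' (c t) <-> Z t).
    move=> [S hS eS].
    exists (fun x => forall p, (exists2 f, S f & forall t, H t -> f t = peval p (c t)) ->
      peval p x = 0).
      by exists (fun p => exists2 f, S f & forall t, H t -> f t = peval p (c t)).
    move=> t Ht; rewrite eS //; split=> [h f Sf|h p [f Sf <- //]]; last exact: h.
    have /regular_polyP [p ep] := hS f Sf; rewrite map_mpoly_id in ep.
    by rewrite ep //; apply: h; exists f.
  have [Z1' h1' e1] := ext Z1 h1; have [Z2' h2' e2] := ext Z2 h2.
  have [] := conn Z1' Z2' h1' h2'.
  - by move=> _ [t Ht ->]; case: (cov t Ht) => z; [left; apply/e1|right; apply/e2].
  - move=> _ [t Ht ->] [/e1 z1 /e2 z2]; apply: (disj t Ht).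
    by split; [apply: z1|apply: z2].
  - by move=> h; left=> t Ht; apply/e1 => //; apply: h; exists t.
  - by move=> h; right=> t Ht; apply/e2 => //; apply: h; exists t.
have res Z : zariski_closed Z -> closed_in H (fun i t => c t 0 i) (fun t => Z (c t)).
  move=> /zariski_closedP; apply: closed_comp => // i; exact: regular_coord.
have [] := conn _ _ (res Z1 h1) (res Z2 h2).
- by move=> t Ht; apply: cov; exists t.
- by move=> t Ht; apply: disj; exists t.
- by move=> h; left=> _ [t Ht ->]; apply: h.
- by move=> h; right=> _ [t Ht ->]; apply: h.
Qed.

End Topology.

Definition matrix_coord (K : fieldType) n (i : 'I_(n * n + 1)) (A : 'M[K]_n) :=
  gl_coord A 0 i.

Definition unit_mx (K : fieldType) n (A : 'M[K]_n) : Prop := A \in unitmx.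

Section MatrixRegular.
Variables (k K : fieldType) (iota : {rmorphism k -> K}).

Section OnMatrices.
Variables (n : nat) (D : 'M[K]_n -> Prop).
Local Notation reg := (regular iota D (@matrix_coord K n)).

Lemma regular_entry i j : reg (fun A => A i j).
Proof.
apply: regular_ext (regular_coord _ _ _ (lshift 1 (mxvec_index i j))) => A _.
by rewrite /matrix_coord /gl_coord row_mxEl mxvecE.
Qed.

Lemma regular_detV : reg (fun A => (\det A)^-1).
Proof.
apply: regular_ext (regular_coord _ _ _ (rshift (n * n) ord0)) => A _.
by rewrite /matrix_coord /gl_coord row_mxEr mxE mulr1n.
Qed.

Lemma regular_invmx i j : (forall A, D A -> A \in unitmx) ->
  reg (fun A => invmx A i j).
Proof.
move=> sD; apply: (regular_ext (f := fun A => (\det A)^-1 * (\adj A) i j)).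
  by move=> A /sD Au; rewrite /invmx Au [RHS]mxE.
apply: regular_mul regular_detV _; apply: regular_adj; exact: regular_entry.
Qed.
End OnMatrices.

Lemma regular_matrix (T I : Type) (D : T -> Prop) (c : I -> T -> K) n
    (phi : T -> 'M[K]_n) :
  (forall i j, regular iota D c (fun t => phi t i j)) ->
  regular iota D c (fun t => (\det (phi t))^-1) ->
  forall i, regular iota D c (fun t => matrix_coord i (phi t)).
Proof.
move=> he hd i; case: (split_ordP i) => [{}i ->|{}i ->].
  case/mxvec_indexP: i => u v; apply: regular_ext (he u v) => t _.
  by rewrite /matrix_coord /gl_coord row_mxEl mxvecE.
apply: regular_ext hd => t _.
by rewrite /matrix_coord /gl_coord row_mxEr ord1 mxE mulr1n.
Qed.

(** The inverse determinant is the determinant of the inverse, so it suffices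
    to control the entries of both. *)
Lemma regular_matrix_inv (T I : Type) (D : T -> Prop) (c : I -> T -> K) n
    (phi : T -> 'M[K]_n) :
  (forall i j, regular iota D c (fun t => phi t i j)) ->
  (forall i j, regular iota D c (fun t => invmx (phi t) i j)) ->
  forall i, regular iota D c (fun t => matrix_coord i (phi t)).
Proof.
move=> he hi; apply: regular_matrix => //.
by apply: regular_ext (regular_det hi) => t _; rewrite det_inv.
Qed.
End MatrixRegular.

Section MatrixTopology.
Variables (K : fieldType) (n : nat).
Implicit Types H : 'M[K]_n -> Prop.

Lemma gl_connectedP H : gl_connected H <-> connected_in (@matrix_coord K n) H.
Proof. exact: zariski_connectedP. Qed.

(** The image of the general linear group in affine space is the closed set where
    the last coordinate times the determinant is [1]. *)
Lemma gl_closedP H : (forall A, H A -> A \in unitmx) ->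
  gl_closed H <-> closed_in (@unit_mx K n) (@matrix_coord K n) H.
Proof.
move=> sH; split=> [/zariski_closedP cl|[S hS eS]].
  apply: (closed_ext (Z := fun A => gl_image H (gl_coord A))) => [A _|].
    split=> [[B HB /eq_row_mx [/(can_inj mxvecK) -> _]]|HA] //.
    by exists A.
  by apply: closed_comp cl => // i; apply: regular_coord.
pose mat (x : 'rV[K]_(n * n + 1)) := vec_mx (lsubmx x) : 'M[K]_n.
pose dv (x : 'rV[K]_(n * n + 1)) := rsubmx x 0 0.
have entry i j : polyfun (fun _ => True) (@affine_coord K _) (fun x => mat x i j).
  apply: regular_ext (regular_coord _ _ _ (lshift 1 (mxvec_index i j))) => x _.
  by rewrite /affine_coord !mxE.
have eqv : closed_in (fun _ => True) (@affine_coord K _)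
    (fun x => \det (mat x) * dv x = 1).
  apply: closed_eq; last exact: regular_1.
  apply: regular_mul; first exact: regular_det.
  apply: regular_ext (regular_coord _ _ _ (rshift _ ord0)) => x _.
  by rewrite /affine_coord /dv mxE.
have coordK x : \det (mat x) * dv x = 1 -> x = gl_coord (mat x) /\ mat x \in unitmx.
  move=> e; have du : \det (mat x) \is a GRing.unit.
    by rewrite unitfE; apply/eqP => d0; move/eqP: e; rewrite d0 mul0r eq_sym oner_eq0.
  split; last by rewrite unitmxE.
  rewrite /gl_coord /mat vec_mxK -[LHS]hsubmxK; congr row_mx.
  apply/matrixP => i j; rewrite !ord1 [RHS]mxE mulr1n.
  by rewrite -[LHS](mulKr du) e mulr1.
apply/zariski_closedP.
apply: closed_ext (closed_and eqv (Z2 := fun x =>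
  forall p, (exists2 f, S f & forall A, A \in unitmx -> f A = peval p (gl_coord A)) ->
  peval p x = 0) _); last first.
  by apply/zariski_closedP; exists (fun p => exists2 f, S f &
    forall A, A \in unitmx -> f A = peval p (gl_coord A)).
move=> x _; split=> [[/coordK [ex ux] h]|[A HA ->]].
  exists (mat x) => //; apply/eS => // f Sf.
  have /regular_polyP [p ep] := hS f Sf; rewrite map_mpoly_id in ep.
  by have := h p; rewrite ep // {1}ex; apply; exists f.
have Au := sH A HA; split; last first.
  by move=> p [f Sf <- //]; apply: (proj1 (eS A Au) HA).
by rewrite /mat /dv /gl_coord row_mxKl row_mxKr mxvecK mxE mulr1n mulrV // -unitmxE.
Qed.

End MatrixTopology.

(** * Affine space is a Noetherian space *)

Section Noetherian.

Definition increasing (g : nat -> nat) := forall i j, (i < j)%N -> (g i < g j)%N.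

Lemma increasing_step g : (forall i, (g i < g i.+1)%N) -> increasing g.
Proof.
move=> h i j; elim: j => // j IH; rewrite ltnS leq_eqVlt => /orP [/eqP -> //|/IH].
by move=> ij; apply: ltn_trans (h j).
Qed.

(** Pick repeatedly an index where the minimum over the remaining tail is
    attained. *)
Lemma nondecreasing_subseq (u : nat -> nat) :
  exists2 g, increasing g & forall i j, (i < j)%N -> (u (g i) <= u (g j))%N.
Proof.
have low N : exists i, (N <= i)%N /\ forall j, (i <= j)%N -> (u i <= u j)%N.
  suff H v i : (N <= i)%N -> (u i <= v)%N ->
      exists i, (N <= i)%N /\ forall j, (i <= j)%N -> (u i <= u j)%N.
    exact: (H (u N) N).
  elim: v i => [|v IH] i Ni uv.
    by exists i; split=> // j _; move: uv; rewrite leqn0 => /eqP ->.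
  case: (classic (forall j, (i <= j)%N -> (u i <= u j)%N)) => [h|nh].
    by exists i.
  have [j nj] := not_all_ex_not _ _ nh; have [ij /negP] := imply_to_and _ _ nj.
  rewrite -ltnNge => uji; apply: (IH j (leq_trans Ni ij)).
  by rewrite -ltnS (leq_trans uji).
have hp N := constructive_indefinite_description _ (low N).
pose p N := proj1_sig (hp N).
pose g := fix g i := match i with 0%N => p 0%N | i'.+1 => p (g i').+1 end.
have gi : increasing g.
  by apply: increasing_step => i; have [] := proj2_sig (hp (g i).+1).
exists g => // i j ij; have gij := ltnW (gi i j ij).
by case: i {ij} gij => [|i] gij; [have [_] := proj2_sig (hp 0%N)
  |have [_] := proj2_sig (hp (g i).+1)]; apply.
Qed.

(** Dickson's lemma: pass to a subsequence along which every exponent in turn is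
    nondecreasing. *)
Lemma dickson n (u : nat -> 'X_{1..n}) : exists i j, (i < j)%N /\ (u i <= u j)%MM.
Proof.
suff [g gi hg] : exists2 g, increasing g &
    forall c, c \in enum 'I_n -> forall i j, (i < j)%N -> (u (g i) c <= u (g j) c)%N.
  exists (g 0%N), (g 1%N); split; first exact: gi.
  by apply/mnm_lepP => c; apply: hg; rewrite ?mem_enum.
elim: (enum 'I_n) => [|c s [g gi hg]]; first by exists id.
have [h hi hh] := nondecreasing_subseq (fun i => u (g i) c).
exists (fun i => g (h i)) => [i j /hi /gi //|d].
rewrite inE => /orP [/eqP -> //|ds i j /hi]; exact: hg.
Qed.

(** A semantic form of Hilbert's basis theorem.  Otherwise the ideals of the
    polynomials vanishing on the common zeros of the first terms increase
    strictly; choosing at each stage a new polynomial with minimal leading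
    monomial contradicts Dickson's lemma, because a division step would
    decrease it. *)
Lemma hilbert_basis (K : fieldType) n (f : nat -> {mpoly K[n]}) :
  exists N, forall x, (forall i, (i < N)%N -> peval (f i) x = 0) -> peval (f N) x = 0.
Proof.
apply: NNPP => no.
pose J N (p : {mpoly K[n]}) :=
  forall x, (forall i, (i < N)%N -> peval (f i) x = 0) -> peval p x = 0.
have JS M N p : (M <= N)%N -> J M p -> J N p.
  by move=> MN h x hx; apply: h => i iM; apply: hx; apply: leq_trans MN.
have new N : exists g, [/\ J N.+1 g, ~ J N g & forall g', J N.+1 g' -> ~ J N g' ->
    ~ (mlead g' < mlead g)%O].
  apply: NNPP => nog.
  suff H : forall m g, mlead g = m -> J N.+1 g -> J N g.
    by apply: no; exists N; apply: (H (mlead (f N)) (f N)) => // x; apply.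
  apply: (well_founded_ind (@ltom_wf n)) => m IH g eg Jg.
  apply: NNPP => nJ; apply: nog; exists g; split=> // g' Jg' nJ' lt.
  by apply: nJ'; apply: (IH (mlead g')); rewrite -?eg.
have hg N := constructive_indefinite_description _ (new N).
pose g N := proj1_sig (hg N).
have [i [j [ij div]]] := dickson (fun N => mlead (g N)).
have [Ji nJi _] := proj2_sig (hg i); have [Jj nJj minj] := proj2_sig (hg j).
rewrite -/(g i) in Ji nJi; rewrite -/(g j) in Jj nJj minj.
have nz (N : nat) (p : {mpoly K[n]}) : ~ J N p -> p != 0.
  by move=> h; apply/eqP => p0; apply: h => x _; rewrite p0 /peval meval0.
have gi0 := nz _ _ nJi; have gj0 := nz _ _ nJj.
pose q := (mleadc (g j) / mleadc (g i)) *: 'X_[mlead (g j) - mlead (g i)] * g i.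
have cq0 : mleadc (g j) / mleadc (g i) != 0.
  by rewrite mulf_neq0 // ?invr_eq0 mleadc_eq0.
have Jq : J j q.
  by move=> x hx; rewrite pevalM (JS _ _ _ ij Ji) ?mulr0.
have lq : mlead q = mlead (g j).
  rewrite /q -scalerAl mleadZ // mleadM ?mleadXm ?submK //.
  by rewrite -mleadc_eq0 mleadXm mcoeffX eqxx oner_eq0.
have cq : mleadc q = mleadc (g j).
  have e : ('X_[mlead (g j) - mlead (g i)] * g i)@_(mlead (g j)) = mleadc (g i).
    move: (submK div); set d := (_ - _)%MM => <-.
    by rewrite mulrC mcoeffMX.
  by rewrite lq /q -scalerAl mcoeffZ e divfK // mleadc_eq0.
have nJq : ~ J j (g j - q).
  move=> h; apply: nJj => x hx; rewrite -[g j](subrK q) /peval mevalD.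
  by rewrite -![_.@[_]]/(peval _ x) h // Jq // addr0.
apply: (minj (g j - q)) => // [x hx|].
  rewrite /peval mevalB -![_.@[_]]/(peval _ x) Jj // Jq ?subr0 // => l lj.
  by apply: hx; apply: ltnW.
have d0 := nz _ _ nJq.
rewrite Order.POrderTheory.lt_neqAle; apply/andP; split; last first.
  by have := mleadB_le (g j) q; rewrite lq Order.JoinTheory.joinxx.
by apply/eqP => e; move: d0; rewrite -mleadc_eq0 e mcoeffB -{2}lq cq subrr eqxx.
Qed.

Variables (K : fieldType) (m : nat).
Local Notation pset := ('rV[K]_m -> Prop).

(** A strictly decreasing sequence of closed sets provides polynomials [f i] that
    vanish on all later sets but not on the [i]-th one, against
    [hilbert_basis]. *)
Lemma zariski_noetherian_ind (P : pset -> Prop) :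
  (forall X, zariski_closed X ->
     (forall Y, zariski_closed Y -> (forall x, Y x -> X x) ->
        (exists2 x, X x & ~ Y x) -> P Y) -> P X) ->
  forall X, zariski_closed X -> P X.
Proof.
move=> step X0 cl0; apply: NNPP => bad0.
pose bad := {X | zariski_closed X /\ ~ P X}.
have next (X : bad) : exists Y : bad, (forall x, proj1_sig Y x -> proj1_sig X x) /\
    exists2 x, proj1_sig X x & ~ proj1_sig Y x.
  case: X => X [clX bX] /=; apply: NNPP => no; apply: bX; apply: step => // Y clY YX nXY.
  by apply: NNPP => bY; apply: no; exists (exist _ Y (conj clY bY)).
have hn X := constructive_indefinite_description _ (next X).
pose Y := fix Y i : bad := match i with
  | 0%N => exist _ X0 (conj cl0 bad0) | i'.+1 => proj1_sig (hn (Y i')) end.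
have YS i x : proj1_sig (Y i.+1) x -> proj1_sig (Y i) x.
  by have [h _] := proj2_sig (hn (Y i)); apply: h.
have Yle i j x : (i <= j)%N -> proj1_sig (Y j) x -> proj1_sig (Y i) x.
  move=> /subnK <-; elim: (j - i)%N => // d IH /YS; exact: IH.
have sep i : exists f : {mpoly K[m]}, (forall x, proj1_sig (Y i.+1) x -> peval f x = 0) /\
    exists2 x, proj1_sig (Y i) x & peval f x <> 0.
  have [_ [x Yx nYx]] := proj2_sig (hn (Y i)).
  rewrite -/(Y i.+1) in nYx.
  have [[S eS] _] := proj2_sig (Y i.+1).
  have [p np] := not_all_ex_not _ _ (fun h => nYx (proj2 (eS x) h)).
  have [Sp px] := imply_to_and _ _ np.
  by exists p; split; [move=> y /eS; apply|exists x].
have hf i := constructive_indefinite_description _ (sep i).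
have [N hN] := hilbert_basis (fun i => proj1_sig (hf i)).
have [_ [x Yx]] := proj2_sig (hf N); apply; apply: hN => i iN.
have [h _] := proj2_sig (hf i); apply: h; exact: Yle iN Yx.
Qed.

(** A closed set that is not connected splits into two smaller closed sets. *)
Lemma zariski_components (X : pset) : zariski_closed X ->
  exists (J : finType) (C : J -> pset),
    [/\ forall j, zariski_connected (C j), forall j x, C j x -> X x &
        forall x, X x -> exists j, C j x].
Proof.
move: X; apply: zariski_noetherian_ind => X clX IH.
case: (classic (zariski_connected X)) => [conn|nconn].
  by exists unit, (fun _ => X); split=> // x Xx; exists tt.
apply: NNPP => no; apply: nconn => Z1 Z2 cl1 cl2 cov disj.
apply: NNPP => /not_or_and [n1 n2].
have part Z : zariski_closed Z -> ~ (forall x, X x -> Z x) ->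
    exists (J : finType) (C : J -> pset),
    [/\ forall j, zariski_connected (C j), forall j x, C j x -> X x &
        forall x, X x -> Z x -> exists j, C j x].
  move=> clZ nZ; have [x nx] := not_all_ex_not _ _ nZ.
  have [Xx nZx] := imply_to_and _ _ nx.
  have [|||J [C [cC sC covC]]] := IH (fun x => X x /\ Z x).
  - apply/zariski_closedP/closed_and; exact/zariski_closedP.
  - by move=> y [].
  - by exists x => // [[]].
  by exists J, C; split=> // [j y /sC []|y Xy Zy] //; apply: covC.
have [J1 [C1 [c1 s1 v1]]] := part Z1 cl1 n1.
have [J2 [C2 [c2 s2 v2]]] := part Z2 cl2 n2.
apply: no; exists (J1 + J2)%type,
  (fun j => match j with inl j => C1 j | inr j => C2 j end); split.
- by case.
- by case=> j x; [apply: s1|apply: s2].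
- move=> x Xx; case: (cov x Xx) => Zx.
    by have [j Cx] := v1 x Xx Zx; exists (inl j).
  by have [j Cx] := v2 x Xx Zx; exists (inr j).
Qed.

End Noetherian.

(** * Closed subgroups of the general linear group *)

Lemma invmx_uniq (K : fieldType) n (A B : 'M[K]_n) : A *m B = 1%:M -> invmx A = B.
Proof.
by move=> e; have [Au _] := mulmx1_unit e; rewrite -(mulKmx Au B) e mulmx1.
Qed.

Lemma invmx_mul (K : fieldType) n (A B : 'M[K]_n) : A \in unitmx -> B \in unitmx ->
  invmx (A *m B) = invmx B *m invmx A.
Proof.
move=> Au Bu; apply: invmx_uniq; rewrite -mulmxA (mulmxA B) mulmxV //.
by rewrite mul1mx mulmxV.
Qed.

Section MatrixGroups.
Variables (K : fieldType) (n : nat).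
Local Notation mset := ('M[K]_n -> Prop).
Implicit Types (H G U : mset) (A B g : 'M[K]_n).
Local Notation mc := (@matrix_coord K n).
Local Notation GL := (@unit_mx K n).

Definition gl_morphism (phi : 'M[K]_n -> 'M[K]_n) :=
  (forall A, GL A -> GL (phi A)) /\
  forall i, polyfun GL mc (fun A => mc i (phi A)).

Lemma gl_morphism_entries (phi : 'M[K]_n -> 'M[K]_n) :
  (forall A, GL A -> GL (phi A)) ->
  (forall i j, polyfun GL mc (fun A => phi A i j)) ->
  (forall i j, polyfun GL mc (fun A => invmx (phi A) i j)) ->
  gl_morphism phi.
Proof. by move=> h1 h2 h3; split=> //; apply: regular_matrix_inv. Qed.

Lemma polyfun_const A i j : polyfun GL mc (fun _ => A i j).
Proof. exact: (regular_cst idfun). Qed.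

Lemma gl_morphism_mull g : GL g -> gl_morphism (fun A => g *m A).
Proof.
move=> gu; apply: gl_morphism_entries => [A Au|i j|i j].
- by rewrite /unit_mx unitmx_mul gu.
- apply: regular_mulmx => {}i {}j; [exact: polyfun_const|exact: regular_entry].
- apply: (regular_ext (f := fun A => (invmx A *m invmx g) i j)).
    by move=> A Au; rewrite invmx_mul.
  apply: regular_mulmx => {}i {}j; [exact: regular_invmx|exact: polyfun_const].
Qed.

Lemma gl_morphism_mulr g : GL g -> gl_morphism (fun A => A *m g).
Proof.
move=> gu; apply: gl_morphism_entries => [A Au|i j|i j].
- by rewrite /unit_mx unitmx_mul gu andbT.
- apply: regular_mulmx => {}i {}j; [exact: regular_entry|exact: polyfun_const].
- apply: (regular_ext (f := fun A => (invmx g *m invmx A) i j)).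
    by move=> A Au; rewrite invmx_mul.
  apply: regular_mulmx => {}i {}j; [exact: polyfun_const|exact: regular_invmx].
Qed.

Lemma gl_morphism_inv : gl_morphism (fun A => invmx A).
Proof.
apply: gl_morphism_entries => [A Au|i j|i j].
- by rewrite /unit_mx unitmx_inv.
- exact: regular_invmx.
- by apply: regular_ext (regular_entry _ _ i j) => A _; rewrite invmxK.
Qed.

Lemma gl_morphism_comp phi psi :
  gl_morphism phi -> gl_morphism psi -> gl_morphism (fun A => phi (psi A)).
Proof.
move=> [u h] [u' h']; split=> [A /u' /u //|i].
exact: regular_comp u' h' (h i).
Qed.

Lemma gl_morphism_conj g : GL g -> gl_morphism (fun A => g *m A *m invmx g).
Proof.
move=> gu; apply: (gl_morphism_comp (gl_morphism_mulr _) (gl_morphism_mull gu)).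
by rewrite /unit_mx unitmx_inv.
Qed.

Lemma connected_gl_image phi H : gl_morphism phi -> (forall A, H A -> GL A) ->
  connected_in mc H -> connected_in mc (fun B => exists2 A, H A & B = phi A).
Proof.
move=> [_ h] sH; apply: (connected_image (phi := phi)) => [A HA|i|_ [A HA ->]].
- by exists A.
- exact: regular_mono sH (h i).
- by exists A.
Qed.

Lemma closed_gl_preimage phi Z : gl_morphism phi ->
  closed_in GL mc Z -> closed_in GL mc (fun A => Z (phi A)).
Proof. by move=> [u h]; apply: closed_comp. Qed.

Definition gl_closure H A := GL A /\ closure_in GL mc H A.

Lemma gl_closure_sub H A : GL A -> H A -> gl_closure H A.
Proof. by move=> Au HA; split=> //; apply: closure_in_sub. Qed.

Lemma gl_closure_closed H : gl_closed (gl_closure H).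
Proof.
apply/gl_closedP => [A []//|].
apply: (closed_ext _ (closure_in_closed GL mc H)) => A Au.
by split=> [?|[]].
Qed.

Lemma gl_closure_min H Z A : gl_closed Z -> (forall A, Z A -> GL A) ->
  (forall A, H A -> Z A) -> gl_closure H A -> Z A.
Proof.
by move=> clZ uZ HZ [Au]; apply: closure_in_min => //; apply/gl_closedP.
Qed.

Lemma gl_closure_morphism phi H H' : gl_morphism phi ->
  (forall A, H A -> gl_closure H' (phi A)) ->
  forall A, gl_closure H A -> gl_closure H' (phi A).
Proof.
move=> hphi h A [Au cA]; split; first by case: hphi => /(_ A Au).
apply: (closure_in_min (closed_gl_preimage hphi (closure_in_closed GL mc H'))) cA => B HB.
by case: (h B HB).
Qed.

(** For [C] in [H], left translation by [C] maps [H], hence its closure, into the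
    closure; for [B] in the closure, right translation by [B] then does so too. *)
Lemma gl_closure_subgroup H : gl_subgroup H -> gl_subgroup (gl_closure H).
Proof.
move=> [Hu H1 HM HV]; split.
- by move=> A [].
- by apply: gl_closure_sub => //; apply: Hu.
- move=> A B cA cB; have [Bu _] := cB.
  have key C D : H C -> gl_closure H D -> gl_closure H (C *m D).
    move=> HC; apply: (gl_closure_morphism (phi := fun X => C *m X)).
      by apply: gl_morphism_mull; apply: Hu.
    by move=> X HX; apply: gl_closure_sub; [apply: Hu|]; apply: HM.
  apply: (gl_closure_morphism (phi := fun X => X *m B) (H := H)) => //.
    exact: gl_morphism_mulr.
  by move=> X HX; apply: key.
- apply: (gl_closure_morphism (phi := fun X => invmx X)) => [|X HX].
    exact: gl_morphism_inv.
  by apply: gl_closure_sub; [apply: Hu|]; apply: HV.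
Qed.

Lemma gl_closure_conj H g : GL g -> (forall A, H A -> GL A) ->
  (forall A, H A -> H (g *m A *m invmx g)) ->
  forall A, gl_closure H A -> gl_closure H (g *m A *m invmx g).
Proof.
move=> gu Hu h; apply: gl_closure_morphism (gl_morphism_conj gu) _ => A HA.
by apply: gl_closure_sub; [apply: Hu|]; apply: h.
Qed.

Lemma gl_closure_connected H : (forall A, H A -> GL A) ->
  connected_in mc H -> connected_in mc (gl_closure H).
Proof. by move=> Hu /(connected_closure Hu). Qed.

(** ** The identity component *)

Section IdentityComponent.
Variable G : mset.
Hypothesis Ggrp : gl_subgroup G.
Local Notation G0 := (identity_component G).

Let Gu A : G A -> GL A. Proof. by case: Ggrp => h _ _ _; apply: h. Qed.
Let G1 : G 1%:M. Proof. by case: Ggrp. Qed.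
Let GM A B : G A -> G B -> G (A *m B). Proof. by case: Ggrp => _ _ h _; apply: h. Qed.
Let GV A : G A -> G (invmx A). Proof. by case: Ggrp => _ _ _; apply. Qed.

Lemma identity_component_sub A : G0 A -> G A.
Proof. by move=> [C [sC _ _ CA]]; apply: sC. Qed.

Lemma identity_component_max C : (forall A, C A -> G A) -> connected_in mc C ->
  C 1%:M -> forall A, C A -> G0 A.
Proof. by move=> sC conn C1 A CA; exists C; split=> //; apply/gl_connectedP. Qed.

Lemma identity_component_connected : connected_in mc G0.
Proof.
pose J := {C : mset | [/\ forall B, C B -> G B, gl_connected C & C 1%:M]}.
apply: (connected_union (E := fun j : J => proj1_sig j) (t0 := 1%:M)).
- by move=> [C [sC conn C1]] A /= CA; exists C.
- by move=> A [C [sC conn C1 CA]]; exists (exist _ C (And3 sC conn C1)).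
- by move=> [C [sC conn C1]] /=; apply/gl_connectedP.
Qed.

Lemma identity_component1 : G0 1%:M.
Proof.
apply: (identity_component_max (C := fun A => A = 1%:M)) => // [A ->//|].
exact: connected_point.
Qed.

Lemma identity_component_unit A : G0 A -> GL A.
Proof. by move=> /identity_component_sub /Gu. Qed.

(** The image of the identity component meets the identity component in [phi 1],
    so that their union is connected. *)
Lemma identity_component_image phi A : gl_morphism phi ->
  (forall B, G B -> G (phi B)) -> G0 (phi 1%:M) -> G0 A -> G0 (phi A).
Proof.
move=> hphi sphi phi1 G0A.
pose E (b : bool) := if b then G0 else fun B => exists2 A, G0 A & B = phi A.
apply: (identity_component_max (C := fun B => exists b, E b B)).
- move=> B [[|] /=]; first exact: identity_component_sub.
  by move=> [C /identity_component_sub /sphi ? ->].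
- apply: (connected_union (E := E) (t0 := phi 1%:M)) => [b B ?|B [b EB]|[|]].
  + by exists b.
  + exists b => //; case: b EB => //= _; exists 1%:M => //.
    exact: identity_component1.
  + exact: identity_component_connected.
  + apply: connected_gl_image identity_component_connected => //.
    exact: identity_component_unit.
- by exists true; apply: identity_component1.
- by exists false; exists A.
Qed.

Lemma identity_component_subgroup : gl_subgroup G0.
Proof.
split.
- exact: identity_component_unit.
- exact: identity_component1.
- move=> A B G0A G0B; have GA := identity_component_sub G0A.
  apply: (identity_component_image (gl_morphism_mull (Gu GA))) => // [C|].
    exact: GM.
  by rewrite mulmx1.
- move=> A; apply: (identity_component_image gl_morphism_inv) => //.
  by rewrite invmx1; apply: identity_component1.
Qed.

Lemma identity_component_normal g A : G g -> G0 A -> G0 (g *m A *m invmx g).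
Proof.
move=> Gg; apply: (identity_component_image (gl_morphism_conj (Gu Gg))) => [B GB|].
  by apply: GM (GV Gg); apply: GM.
by rewrite mulmx1 mulmxV; [apply: identity_component1|apply: Gu].
Qed.

Hypothesis Gclosed : gl_closed G.

Lemma identity_component_closed : gl_closed G0.
Proof.
apply/gl_closedP; first exact: identity_component_unit.
apply: (closed_ext (Z := closure_in GL mc G0)); last exact: closure_in_closed.
move=> A Au; split=> [cA|]; last exact: closure_in_sub.
apply: (identity_component_max (C := gl_closure G0)) => //.
- by move=> B; apply: gl_closure_min => // C; apply: identity_component_sub.
- apply: gl_closure_connected identity_component_connected.
  exact: identity_component_unit.
- apply: gl_closure_sub identity_component1.
  exact: identity_component_unit identity_component1.
Qed.

(** The finitely many connected pieces of the Noetherian space [G] lie in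
    cosets of the identity component. *)
Lemma identity_component_index : exists (J : finType) (g : J -> 'M[K]_n),
  (forall j, G (g j)) /\ forall A, G A -> exists j, G0 (invmx (g j) *m A).
Proof.
have [J [C [cC sC cov]]] := zariski_components Gclosed.
pose E j A := C j (gl_coord A).
have sE j A : E j A -> G A.
  by move/sC => [B GB /eq_row_mx [/(can_inj mxvecK) -> _]].
have cE j : connected_in mc (E j).
  apply/gl_connectedP => Z1 Z2 cl1 cl2 Zcov disj.
  have CE x : C j x <-> gl_image (E j) x.
    split=> [Cx|[A EA ->]] //.
    by have [A GA ex] := sC j x Cx; exists A => //; rewrite /E -ex.
  have [] := cC j Z1 Z2 cl1 cl2.
  - by move=> x /CE; apply: Zcov.
  - by move=> x /CE; apply: disj.
  - by move=> h; left=> x /CE; apply: h.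
  - by move=> h; right=> x /CE; apply: h.
have hg j : exists g, G g /\ forall A, E j A -> E j g.
  case: (classic (exists A, E j A)) => [[A EA]|no].
    by exists A; split=> //; apply: sE EA.
  by exists 1%:M; split=> // A EA; case: no; exists A.
have hg' j := constructive_indefinite_description _ (hg j).
exists J, (fun j => proj1_sig (hg' j)); split=> [j|A GA].
  by have [] := proj2_sig (hg' j).
have [j EA] : exists j, E j A by apply: cov; exists A.
exists j; have [Gg Eg] := proj2_sig (hg' j).
move: (proj1_sig _) Gg Eg => g Gg /(_ A EA) Eg.
apply: (identity_component_max (C := fun B => exists2 A, E j A & B = invmx g *m A)).
- by move=> B [D /sE GD ->]; apply: GM => //; apply: GV.
- apply: connected_gl_image (cE j); last by move=> B /sE /Gu.
  by apply: gl_morphism_mull; apply: Gu; apply: GV.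
- by exists g => //; rewrite mulVmx //; apply: Gu.
- by exists A.
Qed.

Lemma subgroup_exp H g i : gl_subgroup H -> H g -> H (g ^+ i).
Proof.
move=> [_ H1 HM _] Hg; elim: i => [|i IH]; first exact: H1.
by rewrite exprS; apply: HM.
Qed.

(** Two powers of [g] lie in the same coset. *)
Lemma identity_component_power g : G g -> exists N, G0 (g ^+ N.+1).
Proof.
move=> Gg; have [J [h [hG cov]]] := identity_component_index.
have hj i := constructive_indefinite_description _ (cov (g ^+ i) (subgroup_exp i Ggrp Gg)).
pose f (i : 'I_#|J|.+1) := proj1_sig (hj i).
have : ~~ injectiveb f.
  apply/negP => /injectiveP /leq_card; rewrite card_ord ltnn //.
case/injectivePn => i [j nij eij].
wlog lt : i j nij eij / (i < j)%N => [hw|].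
  have /orP [ij|ji] : (i < j)%N || (j < i)%N by rewrite -neq_ltn.
    exact: (hw i j).
  by apply: (hw j i); rewrite // eq_sym.
have [_ _ M V] := identity_component_subgroup.
have Gi := proj2_sig (hj i); have Gj := proj2_sig (hj j).
rewrite -!/(f _) -eij in Gi Gj; move: (f i) (hG (f i)) Gi Gj => l Gl Gi Gj.
exists (j - i).-1; rewrite prednK ?subn_gt0 //.
have -> : g ^+ (j - i) = invmx (invmx (h l) *m g ^+ i) *m (invmx (h l) *m g ^+ j).
  rewrite -{2}(subnKC (ltnW lt)) exprD.
  have gu : g ^+ i \in unitmx := Gu (subgroup_exp i Ggrp Gg).
  have lu : invmx (h l) \in unitmx := Gu (GV Gl).
  rewrite invmx_mul // invmxK.
  rewrite -mulmxA mulKVmx; last exact: Gu.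
  by rewrite -[g ^+ i * _]/(g ^+ i *m _) mulKmx.
by apply: M => //; apply: V.
Qed.

End IdentityComponent.
End MatrixGroups.

(** * The identity component is defined over the small field *)

Lemma regular_polyfun (k K : fieldType) (iota : {rmorphism k -> K}) (T I : Type)
    (D : T -> Prop) (c : I -> T -> K) f : regular iota D c f -> polyfun D c f.
Proof.
elim=> {f} [a|i|f g _ hf _ hg|f g _ hf _ hg|f g e _ hf].
- exact: (regular_cst idfun).
- exact: regular_coord.
- exact: regular_add.
- exact: regular_mul.
- exact: regular_ext hf.
Qed.

Lemma lin_disjoint_gl_image (k : fieldType) (K : closedFieldType)
    (iota : {rmorphism k -> K}) n (H : 'M[K]_n -> Prop) :
  lin_disjoint iota (gl_image H) (@affine_coord K _) <->
  lin_disjoint iota H (@matrix_coord K n).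
Proof.
split.
  apply: (lin_disjoint_image (phi := fun x => vec_mx (lsubmx x))).
  - by move=> _ [A HA ->]; rewrite /gl_coord row_mxKl mxvecK.
  - move=> i; apply: regular_ext (regular_coord _ _ _ i) => _ [A _ ->].
    by rewrite /affine_coord /matrix_coord /gl_coord row_mxKl mxvecK.
  - move=> A HA; exists (gl_coord A); first by exists A.
    by move=> i; rewrite /gl_coord row_mxKl mxvecK.
apply: (lin_disjoint_image (phi := @gl_coord K n)).
- by move=> A HA; exists A.
- by move=> i; apply: regular_coord.
- by move=> _ [A HA ->]; exists A.
Qed.

Section Separation.
Variables (K : fieldType) (n : nat).
Local Notation mc := (@matrix_coord K n).
Local Notation GL := (@unit_mx K n).

(** If [f] vanishes on the closed subgroup [H] but not at [g], expand
    [f (x * y)] for [y] in [H] along functions of [y] that are linearly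
    independent on [H]: the coefficients vanish for [x] in [H].  Substituting
    [y = x^-1 * g], which lies in [H] exactly when [x] lies in [g H], turns the
    expansion into a function that is constant on that coset. *)
Lemma coset_separation (H : 'M[K]_n -> Prop) g :
  gl_subgroup H -> gl_closed H -> GL g -> ~ H g ->
  exists u, [/\ polyfun GL mc u, forall A, H A -> u A = 0 &
    forall A, H (invmx g *m A) -> u A = 1].
Proof.
move=> [Hu _ HM HV] /(gl_closedP Hu) [S hS eS] gu nHg.
have [f nf] := not_all_ex_not _ _ (fun h => nHg (proj2 (eS g gu) h)).
have [Sf fg] := imply_to_and _ _ nf; have hf := hS f Sf.
have hF (_ : unit) : polyfun (prod_dom GL H) (prod_coord mc mc) (fun t => f (t.1 *m t.2)).
  apply: (regular_comp (phi := fun t => t.1 *m t.2)) hf => [[A B] [/= Au HB]|].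
    by rewrite /unit_mx unitmx_mul Au; apply: Hu.
  have sub1 f' : polyfun GL mc f' ->
      polyfun (prod_dom GL H) (prod_coord mc mc) (fun t => f' t.1).
    apply: (regular_comp (phi := fst)) => [t []//|i].
    exact: (regular_coord _ _ (prod_coord mc mc) (inl i)).
  have sub2 f' : polyfun GL mc f' ->
      polyfun (prod_dom GL H) (prod_coord mc mc) (fun t => f' t.2).
    apply: (regular_comp (phi := snd)) => [t [_ /Hu]//|i].
    exact: (regular_coord _ _ (prod_coord mc mc) (inr i)).
  apply: regular_matrix => [i j|].
    apply: regular_mulmx => {}i {}j; [apply: (sub1 (fun A => A i j))
      |apply: (sub2 (fun A => A i j))]; exact: regular_entry.
  apply: (regular_ext (f := fun t => (\det t.1)^-1 * (\det t.2)^-1)).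
    by move=> t _; rewrite det_mulmx invfM.
  apply: regular_mul; [apply: (sub1 (fun A => (\det A)^-1))
    |apply: (sub2 (fun A => (\det A)^-1))]; exact: regular_detV.
have [r [q [s [hq hs frs e]]]] := regular_tensor_free hF.
have /(_ _)/constructive_indefinite_description hs' :
    forall l, exists s', polyfun GL mc s' /\ forall A, H A -> s' A = s l A.
  move=> l; have [s' h1 h2] := regular_extend (hs l); exists s'; split=> //.
  exact: regular_mono h1.
pose s' l := proj1_sig (hs' l).
have [hs1 hs2] : (forall l, polyfun GL mc (s' l)) /\
    forall l A, H A -> s' l A = s l A.
  by split=> l; have [] := proj2_sig (hs' l).
exists (fun A => (f g)^-1 * \sum_l q tt l A * s' l (invmx A *m g)); split.
- apply: regular_mul; first exact: (regular_cst idfun).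
  apply: regular_sum => l _; apply: regular_mul; first exact: hq.
  have [h1 h2] := gl_morphism_comp (gl_morphism_mulr gu) (@gl_morphism_inv K n).
  exact: regular_comp h1 h2 (hs1 l).
- move=> A HA; rewrite big1 ?mulr0 // => l _.
  rewrite (frs (fun l => q tt l A)) ?mul0r // => B HB.
  rewrite -(e tt A B (Hu A HA) HB) /=.
  by apply: (proj1 (eS _ (Hu _ (HM _ _ HA HB))) (HM _ _ HA HB)).
- move=> A HgA; have Au : GL A.
    by move: (Hu _ HgA); rewrite /unit_mx unitmx_mul => /andP [].
  have HAg : H (invmx A *m g).
    by have := HV _ HgA; rewrite invmx_mul ?invmxK // unitmx_inv.
  under eq_bigr do rewrite hs2 //.
  rewrite -(e tt A _ Au HAg) /= mulKVmx // mulVf //; exact/eqP.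
Qed.

(** Multiply the functions [1 - u], where [u] separates the identity component
    from another coset; there are finitely many cosets. *)
Lemma identity_component_indicator (G : 'M[K]_n -> Prop) :
  gl_subgroup G -> gl_closed G ->
  exists e, [/\ polyfun GL mc e, forall A, identity_component G A -> e A = 1 &
    forall A, G A -> ~ identity_component G A -> e A = 0].
Proof.
move=> Ggrp Gcl; set G0 := identity_component G.
have [J [g [hg cov]]] := identity_component_index Ggrp Gcl.
have G0grp := identity_component_subgroup Ggrp; have [_ G01 G0M G0V] := G0grp.
have G0cl := identity_component_closed Ggrp Gcl.
have [Gu _ _ _] := Ggrp.
have /(_ _)/constructive_indefinite_description hu : forall j, exists u,
    [/\ polyfun GL mc u, forall A, G0 A -> u A = 0 &
      ~ G0 (g j) -> forall A, G0 (invmx (g j) *m A) -> u A = 1].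
  move=> j; case: (classic (G0 (g j))) => hj.
    by exists (fun _ => 0); split=> //; apply: regular_0.
  by have [u [h1 h2 h3]] := coset_separation G0grp G0cl (Gu _ (hg j)) hj; exists u.
exists (fun A => \prod_j (1 - proj1_sig (hu j) A)); split.
- apply: regular_prod => j _; apply: regular_sub; first exact: regular_1.
  by have [] := proj2_sig (hu j).
- move=> A G0A; apply: big1 => j _; have [_ h _] := proj2_sig (hu j).
  by rewrite h ?subr0.
- move=> A GA nG0A; have [j G0j] := cov A GA.
  rewrite (bigD1 j) //=; have [_ _ ->] := proj2_sig (hu j) => //.
    by rewrite subrr mul0r.
  move=> G0g; apply: nG0A; rewrite -(mulKVmx (Gu _ (hg j)) A); exact: G0M.
Qed.

End Separation.

(** * Finite subalgebras of an algebraic extension *)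

Section FiniteSubalgebra.
Variables (k : fieldType) (kbar : closedFieldType) (iota : {rmorphism k -> kbar}).

Definition in_span (J : finType) (y : J -> kbar) (x : kbar) :=
  exists a : J -> k, x = \sum_j iota (a j) * y j.

Lemma in_span_gen (J : finType) (y : J -> kbar) j : in_span y (y j).
Proof.
exists (fun i => (i == j)%:R); rewrite (bigD1 j) //= eqxx rmorph1 mul1r.
by rewrite big1 ?addr0 // => i /negbTE ->; rewrite rmorph0 mul0r.
Qed.

Lemma in_span_comb (J J' : finType) (y : J -> kbar) (a : J' -> k) (x : J' -> kbar) :
  (forall j, in_span y (x j)) -> in_span y (\sum_j iota (a j) * x j).
Proof.
move=> /(_ _)/constructive_indefinite_description h.
exists (fun i => \sum_j a j * proj1_sig (h j) i).
under [RHS]eq_bigr do rewrite rmorph_sum mulr_suml.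
rewrite exchange_big /=; apply: eq_bigr => j _.
rewrite {1}(proj2_sig (h j)) mulr_sumr; apply: eq_bigr => i _.
by rewrite rmorphM mulrA.
Qed.

Lemma in_span_mul (J J' : finType) (y : J -> kbar) (y' : J' -> kbar) x x' :
  in_span y x -> in_span y' x' -> in_span (fun u : J * J' => y u.1 * y' u.2) (x * x').
Proof.
move=> [a ->] [a' ->]; exists (fun u => a u.1 * a' u.2).
rewrite mulr_suml -[RHS](pair_bigA _ (fun i j => iota (a i * a' j) * (y i * y' j))) /=.
apply: eq_bigr => i _; rewrite mulr_sumr; apply: eq_bigr => j _.
by rewrite rmorphM mulrACA.
Qed.

Lemma in_span_trans (J J' : finType) (y : J -> kbar) (y' : J' -> kbar) x :
  in_span y x -> (forall j, in_span y' (y j)) -> in_span y' x.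
Proof. by move=> [a ->] h; apply: in_span_comb. Qed.

Definition span_algebra (J : finType) (y : J -> kbar) :=
  in_span y 1 /\ forall i j, in_span y (y i * y j).

(** Reduce the monomial modulo an equation of [x]. *)
Lemma algebraic_power_span x : algebraicOver iota x ->
  exists d, forall m, in_span (fun i : 'I_d => x ^+ i) (x ^+ m).
Proof.
move=> [p p0 rp]; exists (size p).-1 => m.
exists (fun i : 'I__ => ('X^m %% p)`_i).
have -> : x ^+ m = (map_poly iota ('X^m %% p)).[x].
  rewrite -[LHS](_ : (map_poly iota 'X^m).[x] = _); last by rewrite map_polyXn hornerXn.
  rewrite {1}(divp_eq 'X^m p) rmorphD rmorphM hornerD hornerM /=.
  by rewrite (eqP rp) mulr0 add0r.
rewrite (@horner_coef_wide _ (size p).-1).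
  by apply: eq_bigr => i _; rewrite coef_map.
by rewrite size_map_poly -ltnS prednK ?size_poly_gt0 // ltn_modp.
Qed.

(** The products of powers of the given elements, with exponents bounded by the
    degrees of their equations, span an algebra; [c] is a basis of it.  Its
    structure constants give the regular representation. *)
Lemma finite_subalgebra (N : finType) (b : N -> kbar) :
  (forall i, algebraicOver iota (b i)) ->
  exists r (c : 'I_r -> kbar), [/\ free_scalars iota c, in_span c 1,
    forall i j, in_span c (c i * c j) & forall i, in_span c (b i)].
Proof.
move=> alg.
suff [J [y [[y1 yM] yb]]] : exists (J : finType) (y : J -> kbar),
    span_algebra y /\ forall i, i \in enum N -> in_span y (b i).
  have [r [s [A [fr hA]]]] := basis_scalars iota y.
  have sp x : in_span y x -> in_span (fun j => y (s j)) x.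
    by move=> hx; apply: (in_span_trans hx) => j; exists (A j).
  exists r, (fun j => y (s j)); split=> // [|i j|i]; apply: sp => //.
  by apply: yb; rewrite mem_enum.
elim: (enum N) => [|i l [J [y [[y1 yM] yb]]]].
  exists unit, (fun _ => 1); split=> //; split=> [|_ _]; rewrite ?mulr1;
    exact: (in_span_gen _ tt).
have [d hd] := algebraic_power_span (alg i).
have sub x : in_span y x -> in_span (fun u : J * 'I_d => y u.1 * b i ^+ u.2) x.
  by move=> hx; rewrite -[x]mulr1; apply: in_span_mul (hd 0%N).
exists (J * 'I_d)%type, (fun u : J * 'I_d => y u.1 * b i ^+ u.2); split; first split.
- exact: sub.
- move=> [j e] [j' e'] /=; rewrite mulrACA -exprD.
  exact: in_span_mul (yM j j') (hd _).
- move=> i'; rewrite inE => /orP [/eqP ->|/yb /sub //].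
  by rewrite -[X in in_span _ X]mul1r -[X in _ * X]expr1; apply: in_span_mul y1 (hd 1%N).
Qed.

End FiniteSubalgebra.

(** * Descent of the identity component *)

Section Descent.
Variables (k : fieldType) (kbar : closedFieldType) (iota : {rmorphism k -> kbar}).
Hypothesis kbar_closure : is_algebraic_closure iota.
Variable n : nat.
Local Notation mc := (@matrix_coord kbar n).
Local Notation GL := (@unit_mx kbar n).

Lemma polyfun_expand (f : 'M[kbar]_n -> kbar) : polyfun GL mc f ->
  exists N (b : 'I_N -> kbar) (q : 'I_N -> 'M[kbar]_n -> kbar),
    (forall i, regular iota GL mc (q i)) /\
    forall A, GL A -> f A = \sum_i b i * q i A.
Proof.
move=> /regular_polyP [p hp].
have [N [b [q [_ [_ hq _]]]]] := mpoly_expand iota (fun _ : 'I_1 => p) (fun _ => 0).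
exists N, b, (fun i A => peval (map_mpoly iota (q ord0 i)) (gl_coord A)); split.
  by move=> i; apply/regular_polyP; exists (q ord0 i).
move=> A Au; rewrite hp // map_mpoly_id (hq ord0).
rewrite -[LHS]/(peval _ (gl_coord A)) peval_sum.
by apply: eq_bigr => i _; rewrite pevalZ.
Qed.

(** Write the characteristic function [e] of the identity component as
    [\sum_i c i * e i], with [c] a basis of a finite subalgebra [L] of [kbar] and
    [e i] defined over [k], and let [M] be the image of [\sum_i e i (x) c i] under
    the regular representation of [L].  Linear disjointness turns [e ^+ 2 = e]
    and [e 1 = 1] into [M ^+ 2 = M] and [M 1 = 1], so [\det M] is an idempotent
    function defined over [k] whose value at [1] is [1].  By connectedness it is
    [1] on the identity component; where it is not [0], [M] is the identity, and
    applying [M] to the vector [c] shows that [e] is [1].  So the norm [\det M]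
    of [e] is [e] itself. *)
Lemma lin_disjoint_identity_component (G : 'M[kbar]_n -> Prop) :
  gl_subgroup G -> gl_closed G -> lin_disjoint iota G mc ->
  lin_disjoint iota (identity_component G) mc.
Proof.
move=> Ggrp Gcl ldG; set G0 := identity_component G.
have [Gu G1 _ _] := Ggrp.
have [e [he e1 e0]] := identity_component_indicator Ggrp Gcl.
have [N [b [q [hq eE]]]] := polyfun_expand he.
have [r [c [frc [o ho] cM bc]]] := finite_subalgebra (fun i => kbar_closure (b i)).
have /(_ _)/constructive_indefinite_description hB := bc.
pose B i := proj1_sig (hB i).
have bE i : b i = \sum_j iota (B i j) * c j := proj2_sig (hB i).
have /(_ _ _)/constructive_indefinite_description hgam := cM.
pose gam i j := proj1_sig (hgam i j).
have cE i j : c i * c j = \sum_l iota (gam i j l) * c l := proj2_sig (hgam i j).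
pose ek j (A : 'M[kbar]_n) := \sum_i iota (B i j) * q i A.
have hek j : regular iota GL mc (ek j).
  by apply: regular_sum => i _; apply: regular_mul => //; apply: regular_cst.
have ekE A : GL A -> e A = \sum_j c j * ek j A.
  move=> Au; rewrite eE //; under eq_bigr do rewrite bE mulr_suml.
  rewrite exchange_big /=; apply: eq_bigr => j _; rewrite mulr_sumr.
  by apply: eq_bigr => i _; ring.
pose M A := \matrix_(j, l) \sum_i ek i A * iota (gam i j l).
pose cv := \col_l c l.
have Mreg j l : regular iota GL mc (fun A => M A j l).
  apply: (regular_ext (f := fun A => \sum_i ek i A * iota (gam i j l))).
    by move=> A _; rewrite mxE.
  by apply: regular_sum => i _; apply: regular_mul => //; apply: regular_cst.
have Mcv A : GL A -> M A *m cv = e A *: cv.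
  move=> Au; apply/colP => j; rewrite !mxE ekE // mulr_suml.
  transitivity (\sum_l \sum_i ek i A * iota (gam i j l) * c l).
    by apply: eq_bigr => l _; rewrite !mxE mulr_suml.
  rewrite exchange_big /=; apply: eq_bigr => i _.
  rewrite mulrAC cE mulr_suml; apply: eq_bigr => l _; ring.
(* The entries of a row of [F] are functions over [k], and [F *m cv = 0] is a
   relation between them with the independent coefficients [c]. *)
have kill D (F : 'M[kbar]_n -> 'M[kbar]_r) : lin_disjoint iota D mc ->
    (forall j l, regular iota D mc (fun A => F A j l)) ->
    (forall A, D A -> F A *m cv = 0) -> forall A, D A -> F A = 0.
  move=> ld hF F0 A DA; apply/matrixP => j l; rewrite [RHS]mxE.
  apply: (ld r c (fun l A => F A j l) frc) DA => // {}A DA.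
  have := F0 A DA => /colP/(_ j); rewrite !mxE => F0j; rewrite -[RHS]F0j.
  by apply: eq_bigr => i _; rewrite mxE mulrC.
have e01 A : G A -> e A * e A = e A.
  move=> GA; case: (classic (G0 A)) => [/e1 ->|/(e0 A GA) ->].
    by rewrite mulr1.
  by rewrite mulr0.
have MM A : G A -> M A *m M A = M A.
  move=> GA; apply/eqP; rewrite -subr_eq0; apply/eqP.
  apply: (kill G (fun A => M A *m M A - M A)) => // [j l|{}A {}GA].
    apply: (regular_ext (f := fun A => (M A *m M A) j l - M A j l)).
      by move=> {GA}A _; rewrite !mxE.
    apply: (regular_mono (D := GL)) => //; apply: regular_sub => //.
    exact: regular_mulmx.
  have Au := Gu A GA.
  by rewrite mulmxBl -mulmxA Mcv // -scalemxAr Mcv // scalerA e01 ?subrr.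
have M1 : M 1%:M = 1%:M.
  apply/eqP; rewrite -subr_eq0; apply/eqP.
  apply: (kill (fun A => A = 1%:M) (fun A => M A - 1%:M)) => // [|j l|A ->].
  - apply: (lin_disjoint_point (t := 1%:M)) => // i.
    rewrite /matrix_coord /gl_coord det1 invr1.
    case: (split_ordP i) => {}i ->.
      case/mxvec_indexP: i => j l; rewrite row_mxEl mxvecE mxE.
      by exists (j == l)%:R; rewrite rmorph_nat.
    by rewrite row_mxEr mxE; exists (0 == i)%:R; rewrite rmorph_nat.
  - apply: (regular_ext (f := fun A => M A j l - (j == l)%:R)).
      by move=> A _; rewrite !mxE.
    apply: (regular_mono (D := GL)) => [A ->|]; first exact: Gu.
    apply: regular_sub => //; apply: regular_ext (regular_cst _ _ _ (j == l)%:R).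
    by move=> A _; rewrite rmorph_nat.
  - rewrite mulmxBl Mcv; last exact: Gu.
    rewrite e1 ?scale1r ?mul1mx ?subrr //; exact: identity_component1.
pose d A := \det (M A).
have dreg : regular iota GL mc d by apply: regular_det.
have dd A : G A -> d A * d A = d A by move=> GA; rewrite -det_mulmx MM.
have d01 A : G A -> d A = 1 \/ d A = 0.
  move=> /dd /eqP; rewrite -subr_eq0 -{3}[d A]mulr1 -mulrBr mulf_eq0 subr_eq0.
  by case/orP => /eqP; [right|left].
have cneq0 : cv != 0.
  apply/eqP => cv0; move/eqP: ho; rewrite big1 ?oner_eq0 // => i _.
  by move/colP/(_ i): cv0; rewrite !mxE => ->; rewrite mulr0.
have d1 A : G A -> d A = 1 -> G0 A.
  move=> GA dA; apply: NNPP => nG0.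
  have Mu : M A \in unitmx by rewrite unitmxE -/(d A) dA unitr1.
  have M1A : M A = 1%:M by rewrite -[LHS](mulKmx Mu) MM // mulVmx.
  have := Mcv A (Gu A GA); rewrite M1A mul1mx e0 // scale0r => /eqP.
  by rewrite (negbTE cneq0).
have G0G := @identity_component_sub _ _ G.
have dG0 A : G0 A -> d A = 1.
  have cl a : closed_in G0 mc (fun A => d A = a).
    apply: closed_eq; last exact: (regular_cst idfun).
    apply: (regular_mono (D := GL)) => [C /G0G /Gu //|].
    exact: regular_polyfun dreg.
  have [] := identity_component_connected (cl 1) (cl 0).
  - by move=> C /G0G; apply: d01.
  - by move=> C _ [-> /eqP]; rewrite oner_eq0.
  - by apply.
  - move=> /(_ 1%:M (identity_component1 Ggrp)) /eqP.
    by rewrite /d M1 det1 oner_eq0.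
apply: (lin_disjoint_cut (D := G) (e := d)) => //.
- exact: regular_mono dreg.
- by move=> A G0A; split; [apply: G0G|apply: dG0].
- by move=> A GA nG0; case: (d01 A GA) => // /(d1 A GA).
Qed.

Lemma identity_component_k_defined (G : k_group iota n) :
  k_defined iota (gl_image (identity_component G)).
Proof.
have [Gcl /lin_disjoint_gl_image ldG] := proj1 (k_defined_lin_disjoint _ _) (k_group_defined G).
have Ggrp := k_group_subgroup G.
apply/k_defined_lin_disjoint; split; first exact: identity_component_closed.
exact/lin_disjoint_gl_image/lin_disjoint_identity_component.
Qed.

Definition identity_component_group (G : k_group iota n) : k_group iota n :=
  KGroup (identity_component_subgroup (k_group_subgroup G))
    (identity_component_k_defined G).

End Descent.

(** * Groups of unipotent matrices *)

Section Nilpotent.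
Variable K : closedFieldType.

Lemma eigenvector_closed d (M : 'M[K]_d.+1) :
  exists a (v : 'rV_d.+1), v *m M = a *: v /\ v != 0.
Proof.
have [a ra] : exists a, root (char_poly M) a.
  by apply/closed_rootP; rewrite size_char_poly.
rewrite -eigenvalue_root_char in ra; have [v ve v0] := eigenvalueP ra.
by exists a, v.
Qed.

Lemma eigenvector_exp d (M : 'M[K]_d) a (v : 'rV_d) N :
  v *m M = a *: v -> v *m (M ^+ N) = a ^+ N *: v.
Proof.
move=> e; elim: N => [|N IH]; first by rewrite !expr0 mulmx1 scale1r.
by rewrite exprS -[M * _]/(M *m _) mulmxA e -scalemxAl IH scalerA -exprS.
Qed.

(** All eigenvalues are zero. *)
Lemma nilpotent_char_poly d (M : 'M[K]_d) N : M ^+ N = 0 -> char_poly M = 'X^d.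
Proof.
move=> MN; have [rs ers] := closed_field_poly_normal (char_poly M).
rewrite (monicP (char_poly_monic M)) scale1r in ers.
have rs0 z : z \in rs -> z = 0.
  move=> zrs; have : root (char_poly M) z by rewrite ers root_prod_XsubC.
  rewrite -eigenvalue_root_char => /eigenvalueP [v ve v0].
  move/eqP: (eigenvector_exp N ve); rewrite MN mulmx0 eq_sym scaler_eq0.
  by rewrite (negbTE v0) orbF expf_eq0 => /andP [_ /eqP].
have sz : size rs = d.
  by have := size_char_poly M; rewrite ers size_prod_XsubC => -[].
rewrite ers; have -> : rs = nseq d 0.
  rewrite -sz; apply/all_pred1P/allP => z /rs0 -> //=.
by rewrite big_nseq subr0 iter_mulr_1.
Qed.

Lemma nilpotent_exp d (M : 'M[K]_d) N : M ^+ N = 0 -> M ^+ d = 0.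
Proof.
case: d M => [|d] M MN; first by apply/matrixP => -[].
have := Cayley_Hamilton M; rewrite (nilpotent_char_poly MN).
by rewrite rmorphXn /= horner_mx_X.
Qed.

Lemma trace_unipotent d (u : 'M[K]_d) : unipotent_mx u -> \tr u = d%:R.
Proof.
case: d u => [|d] u [N uN]; first by rewrite /mxtrace big_ord0.
have := char_poly_trace (u - 1%:M) isT; rewrite (nilpotent_char_poly uN) /=.
rewrite coefXn ltn_eqF // => /eqP; rewrite eq_sym oppr_eq0 raddfB /= mxtrace1.
by rewrite subr_eq0 => /eqP.
Qed.

(** A matrix of maximal rank among those with rows in the subspace. *)
Lemma subspace_matrix d (P : 'rV[K]_d -> Prop) :
  P 0 -> (forall a v w, P v -> P w -> P (a *: v + w)) ->
  exists W : 'M[K]_d, forall v, P v <-> (v <= W)%MS.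
Proof.
move=> P0 Plin.
suff H j (W : 'M[K]_d) : (d <= j + \rank W)%N -> (forall v, (v <= W)%MS -> P v) ->
    exists W : 'M[K]_d, forall v, P v <-> (v <= W)%MS.
  apply: (H d 0) => [|v]; first by rewrite leq_addr.
  by rewrite submx0 => /eqP ->.
elim: j W => [|j IH] W rW hW.
  have fW : row_full W by rewrite /row_full eqn_leq rank_leq_row.
  by exists W => v; split=> [_|/hW //]; apply: submx_full.
case: (classic (exists2 v, P v & ~~ (v <= W)%MS)) => [[v Pv nv]|no]; last first.
  exists W => v; split=> [Pv|/hW //]; apply/negP => /negP nv.
  by apply: no; exists v.
apply: (IH (W + v)%MS).
  have : (W < W + v)%MS.
    by rewrite /ltmx addsmxSl /=; apply: contra nv; apply: submx_trans (addsmxSr _ _).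
  by move=> /rank_ltmx lt; apply: leq_trans rW _; rewrite addSn -addnS leq_add2l.
move=> w /sub_addsmxP [[x y] /= ->].
rewrite [y]mx11_scalar mul_scalar_mx addrC; apply: Plin => //.
by apply: hW; apply: submxMl.
Qed.

Section Monoid.
Variables (d : nat) (U : 'M[K]_d -> Prop).
Hypothesis U1 : U 1%:M.
Hypothesis UM : forall u u', U u -> U u' -> U (u *m u').
Hypothesis Uuni : forall u, U u -> unipotent_mx u.

Inductive mx_span : 'M[K]_d -> Prop :=
| mx_span0 : mx_span 0
| mx_span_step a u x : U u -> mx_span x -> mx_span (a *: u + x).

Lemma mx_span_gen u : U u -> mx_span u.
Proof. by move=> Uu; rewrite -[u]addr0 -[u]scale1r; apply: mx_span_step (mx_span0). Qed.

Lemma mx_span_lin a x y : mx_span x -> mx_span y -> mx_span (a *: x + y).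
Proof.
move=> hx hy; elim: hx => [|b u z Uu _ IH]; first by rewrite scaler0 add0r.
by rewrite scalerDr scalerA -addrA; apply: mx_span_step.
Qed.

Lemma mx_span_mul x y : mx_span x -> mx_span y -> mx_span (x *m y).
Proof.
move=> hx hy; elim: hx => [|b u z Uu _ IH]; first by rewrite mul0mx; apply: mx_span0.
rewrite mulmxDl -scalemxAl; apply: mx_span_lin IH.
elim: hy => [|c w t Uw _ IH']; first by rewrite mulmx0; apply: mx_span0.
by rewrite mulmxDr -scalemxAr; apply: mx_span_step IH'; apply: UM.
Qed.

(** All elements of [U] have trace [d], and so have their products with [u]. *)
Lemma trace_span u x : U u -> mx_span x -> \tr ((u - 1%:M) *m x) = 0.
Proof.
move=> Uu; elim=> [|a w y Uw _ IH]; first by rewrite mulmx0 mxtrace0.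
rewrite mulmxDr mxtraceD IH addr0 -scalemxAr mxtraceZ mulmxBl mul1mx raddfB /=.
by rewrite !trace_unipotent ?subrr ?mulr0 //; [apply: Uuni|apply: Uuni; apply: UM].
Qed.

Hypothesis irr : forall W : 'M[K]_d, (forall u, U u -> (W *m u <= W)%MS) ->
  W = 0 \/ row_full W.

(** The images of [v] under the algebra form a nonzero stable subspace. *)
Lemma irreducible_transitive (v w : 'rV[K]_d) : v != 0 ->
  exists2 x, mx_span x & v *m x = w.
Proof.
move=> v0; have [|a v1 v2 [x1 h1 <-] [x2 h2 <-]|W hW] :=
    @subspace_matrix d (fun w => exists2 x, mx_span x & v *m x = w).
- by exists 0; rewrite ?mulmx0 //; apply: mx_span0.
- exists (a *: x1 + x2); first exact: mx_span_lin.
  by rewrite mulmxDr -scalemxAr.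
have vW : (v <= W)%MS by apply/hW; exists 1%:M; rewrite ?mulmx1 //; apply: mx_span_gen.
case: (irr (W := W)) => [u Uu|W0|fW].
- apply/row_subP => i; rewrite row_mul; apply/hW.
  have /hW [x hx <-] := row_sub i W.
  exists (x *m u); last by rewrite mulmxA.
  by apply: mx_span_mul => //; apply: mx_span_gen.
- by move: vW; rewrite W0 submx0 (negbTE v0).
- by apply/hW; apply: submx_full.
Qed.

(** The image of [t] is stable under [x *m t], which has an eigenvalue [a] there,
    so that [t *m x *m t - a *: t] has smaller rank than [t] and is zero.
    Evaluating it at [w], where [x] is chosen to map [w *m t] to [v], gives the
    claim. *)
Lemma minimal_rank_one t : mx_span t -> t != 0 ->
  (forall t', mx_span t' -> t' != 0 -> (\rank t <= \rank t')%N) ->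
  forall v w : 'rV_d, w *m t != 0 -> exists a, v *m t = a *: (w *m t).
Proof.
move=> ht t0 min v w wt0; have [x hx ex] := irreducible_transitive v wt0.
pose R := row_base t; pose rho := R *m (x *m t) *m pinvmx R.
have Rrho : rho *m R = R *m (x *m t).
  apply: mulmxKpV; rewrite mulmxA.
  by apply: submx_trans (submxMl _ _) _; rewrite eq_row_base.
have rk0 : (0 < \rank t)%N by rewrite lt0n mxrank_eq0.
have [a [y [ey y0]]] : exists a (y : 'rV_(\rank t)), y *m rho = a *: y /\ y != 0.
  by move: rho {Rrho}; case: (\rank t) rk0 => // r _ M; apply: eigenvector_closed.
exists a; apply/eqP; rewrite -subr_eq0; apply: contraT => n0.
pose t' := t *m x *m t - a *: t.
have ht' : mx_span t'.
  rewrite /t' addrC -scaleNr; apply: mx_span_lin => //.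
  by apply: mx_span_mul => //; apply: mx_span_mul.
have t'0 : t' != 0.
  apply: contraNneq n0 => t'0; have : w *m t' = 0 by rewrite t'0 mulmx0.
  by rewrite mulmxBr !mulmxA ex -scalemxAr => ->.
have := min t' ht' t'0; rewrite leqNgt => /negP[].
have -> : t' = col_base t *m (rho - a%:M) *m R.
  rewrite mulmxBr mulmxBl -(mulmxA _ rho) Rrho mul_mx_scalar -scalemxAl.
  by rewrite mulmxA (mulmx_base t : col_base t *m R = t) mulmxA.
apply: (@leq_ltn_trans (\rank (rho - a%:M))).
  by rewrite (leq_trans (mxrankM_maxl _ _)) ?mxrankM_maxr.
rewrite ltn_neqAle rank_leq_row andbT.
apply: contraNN y0 => fr; apply/eqP/(row_free_inj (A := rho - a%:M) fr).
by rewrite mul0mx mulmxBr ey mul_mx_scalar subrr.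
Qed.

(** Burnside's theorem combined with the trace form: all elements of [U] have
    the same trace, so that [u - 1] is orthogonal to the algebra spanned by
    [U], which contains enough matrices of rank one to separate. *)
Lemma irreducible_unipotent_trivial u : U u -> u = 1%:M.
Proof.
move=> Uu; apply/eqP; rewrite -subr_eq0; apply: contraT => u0.
have [t [ht t0 min]] : exists t, [/\ mx_span t, t != 0 &
    forall t', mx_span t' -> t' != 0 -> (\rank t <= \rank t')%N].
  have one0 : (1%:M : 'M[K]_d) != 0.
    by apply: contraNneq u0 => e; rewrite -[_ - _]mulmx1 e mulmx0.
  suff H j t : (\rank t <= j)%N -> mx_span t -> t != 0 ->
      exists t, [/\ mx_span t, t != 0 &
      forall t', mx_span t' -> t' != 0 -> (\rank t <= \rank t')%N].
    exact: (H _ 1%:M (leqnn _) (mx_span_gen U1) one0).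
  elim: j t => [|j IH] t rt ht t0.
    by move: rt; rewrite leqn0 mxrank_eq0 (negbTE t0).
  case: (classic (exists t', [/\ mx_span t', t' != 0 & (\rank t' < \rank t)%N])).
    by move=> [t' [ht' t'0 lt]]; apply: (IH t') => //; rewrite -ltnS (leq_trans lt).
  move=> no; exists t; split=> // t' ht' t'0; rewrite leqNgt; apply/negP => lt.
  by apply: no; exists t'.
have [w wt0] : exists w : 'rV_d, w *m t != 0.
  have /rowV0Pn [v /submxP [w ->] v0] := t0; by exists w.
have [v vu0] : exists v : 'rV_d, v *m (u - 1%:M) != 0.
  have /rowV0Pn [v /submxP [w' ->] v0] := u0; by exists w'.
have rk1 := minimal_rank_one ht t0 min.
have [y hy ey] := irreducible_transitive v wt0.
have [x hx ex] := irreducible_transitive w vu0.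
have /(_ _)/constructive_indefinite_description hc : forall i, exists a,
    row i t = a *: (w *m t).
  by move=> i; rewrite rowE; apply: rk1.
pose c := \col_i proj1_sig (hc i).
have tE : t = c *m (w *m t).
  apply/row_matrixP => i; rewrite row_mul (proj2_sig (hc i)).
  by rewrite [row i c]mx11_scalar mul_scalar_mx !mxE.
have wc : w *m c = 1%:M.
  rewrite [w *m c]mx11_scalar; congr _%:M.
  have : ((w *m c) 0 0 - 1) *: (w *m t) = 0.
    rewrite scalerBl scale1r {2}tE mulmxA [w *m c]mx11_scalar mul_scalar_mx.
    by rewrite mxE mulr1n subrr.
  by move/eqP; rewrite scaler_eq0 (negbTE wt0) orbF subr_eq0 => /eqP.
have := trace_span Uu (mx_span_mul hx (mx_span_mul ht hy)).
rewrite mulmxA mxtrace_mulC {1}tE -!mulmxA mxtrace_mulC !mulmxA.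
by rewrite ey ex wc mxtrace1 => /eqP; rewrite oner_eq0.
Qed.

End Monoid.

(** Coordinates on the subspace [W], by [R], and on the quotient by it, by [Q]. *)
Lemma subspace_quotient d (W : 'M[K]_d) :
  exists (R : 'M_(\rank W, d)) (R' : 'M_(d, \rank W))
    (Q : 'M_(d, \rank (cokermx W))) (Q' : 'M_(\rank (cokermx W), d)),
    [/\ R *m R' = 1%:M, Q' *m Q = 1%:M, (R :=: W)%MS,
        forall m (X : 'M_(m, d)), (X <= W)%MS -> X *m R' *m R = X &
        forall m (X : 'M_(m, d)), (X <= W)%MS = (X *m Q == 0)].
Proof.
exists (row_base W), (pinvmx (row_base W)).
exists (col_base (cokermx W)), (pinvmx (col_base (cokermx W))); split.
- exact/mulmxVp/row_base_free.
- exact/mulVpmx/col_base_full.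
- exact: eq_row_base.
- by move=> m X XW; rewrite mulmxKpV // eq_row_base.
move=> m X; apply/idP/eqP => [|XQ].
  rewrite submxE => /eqP XW; apply: (row_free_inj (row_base_free (cokermx W))).
  by rewrite mul0mx -mulmxA mulmx_base.
by rewrite submxE -(mulmx_base (cokermx W)) mulmxA XQ mul0mx.
Qed.

(** Kolchin's theorem in the form that is used: by induction along a composition
    series, whose factors are trivial. *)
Lemma unipotent_monoid_nilpotent d (U : 'M[K]_d -> Prop) (us : seq 'M[K]_d) :
  U 1%:M -> (forall u u', U u -> U u' -> U (u *m u')) ->
  (forall u, U u -> unipotent_mx u) ->
  (forall u, u \in us -> U u) -> size us = d -> \prod_(u <- us) (u - 1%:M) = 0.
Proof.
elim/ltn_ind: d U us => d IH U us U1 UM Uuni sus usd.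
case: (classic (exists W : 'M[K]_d, [/\ forall u, U u -> (W *m u <= W)%MS,
    W != 0 & ~~ row_full W])); last first.
  move=> no.
  have irr (W : 'M[K]_d) : (forall u, U u -> (W *m u <= W)%MS) -> W = 0 \/ row_full W.
    move=> hW; case: (boolP (W == 0)) => [/eqP|W0]; [by left|right].
    by apply: contraT => fW; case: no; exists W.
  case: us sus usd => [_ /= d0|u us sus _].
    by apply/matrixP => i; case/negP: (negbT (ltn0 i)); rewrite d0.
  rewrite big_cons (irreducible_unipotent_trivial U1 UM Uuni irr (sus u _)).
    by rewrite subrr mul0r.
  exact: mem_head.
move=> [W [hW W0 fW]].
have [R [R' [Q [Q' [RK QK eR RK' subW]]]]] := subspace_quotient W.
have rQ : (\rank (cokermx W) + \rank W = d)%N.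
  by rewrite mxrank_coker subnK // rank_leq_row.
pose rho u := R *m u *m R'; pose sig u := Q' *m u *m Q.
have Rrho u : U u -> R *m u = rho u *m R.
  move=> Uu; rewrite RK' //.
  by apply: submx_trans (hW u Uu); apply: submxMr; rewrite eR.
have Qsig u : U u -> u *m Q = Q *m sig u.
  move=> Uu; apply/eqP; rewrite -subr_eq0 /sig !mulmxA -mulmxBl -subW.
  rewrite -[X in X - _]mul1mx -mulmxBl; apply: submx_trans (hW u Uu).
  by apply: submxMr; rewrite subW mulmxBl mul1mx -mulmxA QK mulmx1 subrr.
have rhoM u u' : U u -> U u' -> rho (u *m u') = rho u *m rho u'.
  by move=> Uu Uu'; rewrite {1}/rho mulmxA Rrho // -!(mulmxA (rho u)).
have sigM u u' : U u -> U u' -> sig (u *m u') = sig u *m sig u'.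
  by move=> Uu Uu'; rewrite {1}/sig -!mulmxA Qsig // !mulmxA.
have rho1 : rho 1%:M = 1%:M by rewrite /rho mulmx1.
have sig1 : sig 1%:M = 1%:M by rewrite /sig mulmx1.
have Rexp u N : U u -> R *m (u - 1%:M) ^+ N = (rho u - 1%:M) ^+ N *m R.
  move=> Uu; elim: N => [|N IHN]; first by rewrite mulmx1 mul1mx.
  rewrite !exprSr -![_ * _]/(_ *m _) mulmxA IHN -!mulmxA; congr (_ *m _).
  by rewrite mulmxBr mulmxBl mulmx1 mul1mx Rrho.
have Qexp u N : U u -> (u - 1%:M) ^+ N *m Q = Q *m (sig u - 1%:M) ^+ N.
  move=> Uu; elim: N => [|N IHN]; first by rewrite mulmx1 mul1mx.
  rewrite !exprS -![_ * _]/(_ *m _) -mulmxA IHN !mulmxA; congr (_ *m _).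
  by rewrite mulmxBr mulmxBl mulmx1 mul1mx Qsig.
have Rprod vs : (forall v, v \in vs -> U v) ->
    R *m \prod_(v <- vs) (v - 1%:M) = \prod_(v <- map rho vs) (v - 1%:M) *m R.
  rewrite big_map; elim: vs => [|v vs IHvs] svs; first by rewrite !big_nil mulmx1 mul1mx.
  have Uv : U v by apply: svs; apply: mem_head.
  rewrite !big_cons -![_ * _]/(_ *m _) mulmxA mulmxBr mulmx1 Rrho //.
  rewrite -{2}[R]mul1mx -mulmxBl -!mulmxA IHvs // => v' hv'.
  by apply: svs; rewrite inE hv' orbT.
have Qprod vs : (forall v, v \in vs -> U v) ->
    \prod_(v <- vs) (v - 1%:M) *m Q = Q *m \prod_(v <- map sig vs) (v - 1%:M).
  rewrite big_map; elim: vs => [|v vs IHvs] svs; first by rewrite !big_nil mulmx1 mul1mx.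
  have Uv : U v by apply: svs; apply: mem_head.
  rewrite !big_cons -![_ * _]/(_ *m _) -mulmxA IHvs; last first.
    by move=> v' hv'; apply: svs; rewrite inE hv' orbT.
  by rewrite !mulmxA mulmxBl mulmxBr mulmx1 mul1mx Qsig.
pose s := \rank (cokermx W); pose us1 := take s us; pose us2 := drop s us.
have s1 u : u \in us1 -> U u by move=> /mem_take /sus.
have s2 u : u \in us2 -> U u by move=> /mem_drop /sus.
have r0 : (0 < \rank W)%N by rewrite lt0n mxrank_eq0.
have s0 : (0 < s)%N.
  by rewrite lt0n; apply: contra fW => /eqP s0; apply/eqP; move: rQ; rewrite -/s s0.
have sd : (s < d)%N by move: rQ r0; rewrite -/s; lia.
have rd : (\rank W < d)%N by move: rQ s0; rewrite -/s; lia.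
have Q0 : \prod_(v <- us1) (v - 1%:M) *m Q = 0.
  rewrite Qprod // (IH s sd (fun v => exists2 u, U u & v = sig u)) ?mulmx0 //.
  - by exists 1%:M; rewrite ?sig1.
  - by move=> _ _ [u Uu ->] [u' Uu' ->]; exists (u *m u'); [apply: UM|rewrite sigM].
  - move=> _ [u Uu ->]; have [N uN] := Uuni u Uu; exists N.
    by rewrite -[LHS]mul1mx -{1}QK -mulmxA -Qexp // uN mul0mx mulmx0.
  - by move=> _ /mapP [u hu ->]; exists u => //; apply: s1.
  - by rewrite size_map size_take usd sd.
have R0 : R *m \prod_(v <- us2) (v - 1%:M) = 0.
  rewrite Rprod // (IH (\rank W) rd (fun v => exists2 u, U u & v = rho u)) ?mul0mx //.
  - by exists 1%:M; rewrite ?rho1.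
  - by move=> _ _ [u Uu ->] [u' Uu' ->]; exists (u *m u'); [apply: UM|rewrite rhoM].
  - move=> _ [u Uu ->]; have [N uN] := Uuni u Uu; exists N.
    by rewrite -[LHS]mulmx1 -{2}RK mulmxA -Rexp // uN mulmx0 mul0mx.
  - by move=> _ /mapP [u hu ->]; exists u => //; apply: s2.
  - by rewrite size_map size_drop usd; move: rQ; rewrite -/s; lia.
move/eqP: Q0; rewrite -subW -eR => /submxP [Y eY].
rewrite -(cat_take_drop s us) big_cat /= -/us1 -/us2 eY -[_ * _]/(_ *m _).
by rewrite -mulmxA R0 mulmx0.
Qed.

(** The kernels of the products of [i] factors [u - 1], with [u] in [U], form a
    filtration that is stable under the matrices normalizing [U], and [U] acts
    trivially on its successive quotients.  So [u *m h] acts there as the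
    unipotent [h]. *)
Lemma unipotent_mul d (U : 'M[K]_d -> Prop) (u h : 'M[K]_d) :
  U 1%:M -> (forall u u', U u -> U u' -> U (u *m u')) ->
  (forall u, U u -> unipotent_mx u) -> U u -> unipotent_mx h ->
  (forall v, U v -> exists2 v', U v' & h *m v = v' *m h) ->
  unipotent_mx (u *m h).
Proof.
move=> U1 UM Uuni Uu [N hN] hU.
pose F := fix F i (v : 'rV[K]_d) : Prop :=
  if i is i'.+1 then forall w, U w -> F i' (v *m w - v) else v = 0.
have F0 i : F i 0.
  by elim: i => //= i IH w _; rewrite mul0mx subr0.
have FD i v v' : F i v -> F i v' -> F i (v + v').
  elim: i v v' => [|i IH] v v' /=; first by move=> -> ->; rewrite addr0.
  move=> hv hv' w Uw; rewrite mulmxDl opprD addrACA; apply: IH; [exact: hv|exact: hv'].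
have FN i v : F i v -> F i (- v).
  elim: i v => [|i IH] v /=; first by move=> ->; rewrite oppr0.
  by move=> hv w Uw; rewrite mulNmx -opprD; apply: IH; apply: hv.
have Fh i v : F i v -> F i (v *m h).
  elim: i v => [|i IH] v /=; first by move=> ->; rewrite mul0mx.
  move=> hv w Uw; have [w' Uw' e] := hU w Uw.
  by rewrite -mulmxA e mulmxA -mulmxBl; apply/IH/hv.
have FS i v : F i v -> F i.+1 v.
  elim: i v => [|i IH] v; first by move=> /= -> w _; rewrite mul0mx subr0.
  by move=> hv w Uw; apply: IH; apply: hv.
have Fu i v : F i v -> F i (v *m u).
  case: i => [|i] hv; first by rewrite (hv : v = 0) mul0mx.
  by rewrite -[v *m u](subrK v); apply: (FD i.+1) => //; apply: FS; apply: hv.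
have Fuh i v : F i v -> F i (v *m (u *m h - 1%:M)).
  move=> hv; rewrite mulmxBr mulmx1 mulmxA; apply: (FD i); first exact/Fh/Fu.
  exact: FN.
have Fh1 i v : F i v -> F i (v *m (h - 1%:M)).
  by move=> hv; rewrite mulmxBr mulmx1; apply: (FD i); [apply: Fh|apply: FN].
have cong i v m : F i.+1 v ->
    F i (v *m (u *m h - 1%:M) ^+ m - v *m (h - 1%:M) ^+ m) /\
    F i.+1 (v *m (h - 1%:M) ^+ m).
  move=> hv; elim: m => [|m [IH1 IH2]]; first by rewrite mulmx1 subrr.
  rewrite !exprSr -![_ * _]/(_ *m _) !mulmxA; split; last exact: (Fh1 i.+1).
  set x := v *m (u *m h - _) ^+ m in IH1 *; set y := v *m (h - _) ^+ m in IH1 IH2 *.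
  have -> : x *m (u *m h - 1%:M) - y *m (h - 1%:M) =
      (x - y) *m (u *m h - 1%:M) + (y *m u - y) *m h.
    rewrite !mulmxBl !mulmxBr !mulmx1 !mulmxA !opprB [RHS]addrAC -!addrA.
    congr (_ + (_ + _)).
    by rewrite [RHS]addrCA [X in _ = _ + X]addrCA subrr addr0 addrC.
  by apply: FD; [apply: Fuh|apply: Fh; apply: IH2].
have step i v : F i.+1 v -> F i (v *m (u *m h - 1%:M) ^+ N).
  by move=> /(cong i v N) []; rewrite hN mulmx0 subr0.
have all_steps i v : F i v -> v *m (u *m h - 1%:M) ^+ (N * i) = 0.
  elim: i v => [|i IH] v hv; first by rewrite muln0 mulmx1.
  by rewrite mulnS exprD -[_ * _]/(_ *m _) mulmxA; apply: IH; apply: step.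
have Fd v : F d v.
  suff H i : forall us v, (size us + i = d)%N -> (forall w, w \in us -> U w) ->
      F i (v *m \prod_(w <- us) (w - 1%:M)).
    by have := H d [::] v erefl; rewrite big_nil mulmx1; apply.
  elim: i => [|i IH] us {}v sz hus.
    have us_d : size us = d by move: sz; rewrite addn0.
    by rewrite /= (unipotent_monoid_nilpotent U1 UM Uuni hus us_d) mulmx0.
  move=> /= w Uw; have := IH (rcons us w) v.
  rewrite -{3}cats1 big_cat big_seq1 /= -[_ * _]/(_ *m _) mulmxA mulmxBr mulmx1.
  apply.
    by rewrite size_rcons addSnnS.
  by move=> w'; rewrite mem_rcons inE => /orP [/eqP ->|/hus].
exists (N * d)%N; apply/row_matrixP => i; rewrite rowE row0.
exact: all_steps.
Qed.

End Nilpotent.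

(** * Reductivity *)

Section Reductive.
Variables (K : closedFieldType) (n : nat).
Local Notation mset := ('M[K]_n -> Prop).
Local Notation mc := (@matrix_coord K n).
Local Notation GL := (@unit_mx K n).
Implicit Types (G U : mset).

Lemma polyfun_exp (phi : 'M[K]_n -> 'M[K]_n) N :
  (forall i j, polyfun GL mc (fun A => phi A i j)) ->
  forall i j, polyfun GL mc (fun A => (phi A ^+ N) i j).
Proof.
move=> h; elim: N => [|N IH] i j; first exact: (polyfun_const 1%:M i j).
apply: (regular_ext (f := fun A => (phi A *m phi A ^+ N) i j)).
  by move=> A _; rewrite exprS.
exact: regular_mulmx.
Qed.

Lemma closed_unipotent : closed_in GL mc (fun A => (A - 1%:M) ^+ n = 0).
Proof.
apply: (closed_ext (Z := fun A => forall i j, ((A - 1%:M) ^+ n) i j = 0)).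
  by move=> A _; split=> [h|-> i j]; [apply/matrixP => i j; rewrite h|]; rewrite mxE.
apply: closed_forall => i; apply: closed_forall => j; apply: closed_zero.
apply: (polyfun_exp (phi := fun A => A - 1%:M)) => {}i {}j.
apply: (regular_ext (f := fun A : 'M[K]_n => A i j - (1%:M : 'M[K]_n) i j)) => [A _|].
  by rewrite !mxE.
by apply: regular_sub; [apply: regular_entry|apply: polyfun_const].
Qed.

Lemma unipotentP (A : 'M[K]_n) : unipotent_mx A <-> (A - 1%:M) ^+ n = 0.
Proof. by split=> [[N /nilpotent_exp]|e] //; exists n. Qed.

Lemma conj_unipotent_exp (g A : 'M[K]_n) N : g \in unitmx ->
  (g *m A *m invmx g - 1%:M) ^+ N = g *m (A - 1%:M) ^+ N *m invmx g.
Proof.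
move=> gu; elim: N => [|N IH]; first by rewrite mulmx1 mulmxV.
rewrite !exprS IH -![_ * _]/(_ *m _) !mulmxA; congr (_ *m _ *m _).
by rewrite mulmxBl mul1mx mulmxKV // mulmxBr mulmx1.
Qed.

Lemma trivial_connected_normal_unipotent G : gl_subgroup G ->
  connected_normal_unipotent G (fun A => A = 1%:M).
Proof.
move=> [Gu G1 _ _]; have sub1 : gl_subgroup (fun A : 'M[K]_n => A = 1%:M).
  split=> // [A ->|A B -> ->|A ->].
  - exact: unitmx1.
  - by rewrite mulmx1.
  - by rewrite invmx1.
split=> // [|A -> //|A B GA ->||A ->].
- split=> //; have [u1 _ _ _] := sub1; apply/gl_closedP => //.
  apply: (closed_ext (Z := fun A : 'M[K]_n => forall i j, A i j = (1%:M : 'M[K]_n) i j)).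
    by move=> A _; split=> [h|->] //; apply/matrixP.
  apply: closed_forall => i; apply: closed_forall => j.
  by apply: closed_eq; [apply: regular_entry|apply: polyfun_const].
- by rewrite mulmx1 mulmxV //; apply: Gu.
- by apply/gl_connectedP; apply: connected_point.
- by exists 1%N; rewrite subrr.
Qed.

Lemma reductive_intro G : gl_subgroup G ->
  (forall U, connected_normal_unipotent G U -> forall A, U A -> A = 1%:M) ->
  reductive G.
Proof. by move=> Ggrp h; split=> //; apply: trivial_connected_normal_unipotent. Qed.

(** The closure of [U] is again normal, connected and unipotent. *)
Lemma reductive_trivial G U : gl_subgroup G -> gl_closed G -> reductive G ->
  gl_subgroup U -> (forall A, U A -> G A) ->
  (forall A B, G A -> U B -> U (A *m B *m invmx A)) ->
  connected_in mc U -> (forall A, U A -> unipotent_mx A) ->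
  forall A, U A -> A = 1%:M.
Proof.
move=> [Gu _ _ _] Gcl [_ max] Ugrp UG Unorm Uconn Uuni A UA.
have Uu B : U B -> GL B by move=> /UG /Gu.
apply: (max (gl_closure U)); last exact: gl_closure_sub (Uu A UA) UA.
split.
- by split; [apply: gl_closure_subgroup|apply: gl_closure_closed].
- by move=> B; apply: gl_closure_min => // C; apply: UG.
- by move=> B C GB; apply: gl_closure_conj => // [|D]; [apply: Gu|apply: Unorm].
- by apply/gl_connectedP; apply: gl_closure_connected.
- move=> B [Bu cB]; apply/unipotentP.
  by apply: (closure_in_min closed_unipotent) cB => C /Uuni /unipotentP.
Qed.

Section IdentityComponentReductive.
Variables G U : mset.
Hypotheses (Ggrp : gl_subgroup G) (Gcl : gl_closed G).
Hypothesis hU : connected_normal_unipotent (identity_component G) U.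
Local Notation G0 := (identity_component G).

(** Words in elements of the conjugates of [U] form a group, because each conjugate
    contains the inverses of its elements. *)
Inductive conjugates_gen : 'M[K]_n -> Prop :=
| conjugates_gen1 : conjugates_gen 1%:M
| conjugates_genM g A B : G g -> U A -> conjugates_gen B ->
    conjugates_gen (g *m A *m invmx g *m B).

Let Gu A : G A -> A \in unitmx. Proof. by case: Ggrp => h _ _ _; apply: h. Qed.
Let GM A B : G A -> G B -> G (A *m B). Proof. by case: Ggrp => _ _ h _; apply: h. Qed.
Let GV A : G A -> G (invmx A). Proof. by case: Ggrp => _ _ _; apply. Qed.
Let UG0 A : U A -> G0 A. Proof. by case: hU => _ h _ _ _; apply: h. Qed.
Let U1 : U 1%:M. Proof. by case: hU => [[[_ h _ _] _] _ _ _ _]. Qed.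
Let UM A B : U A -> U B -> U (A *m B).
Proof. by case: hU => [[[_ _ h _] _] _ _ _ _]; apply: h. Qed.
Let UV A : U A -> U (invmx A).
Proof. by case: hU => [[[_ _ _ h] _] _ _ _ _]; apply: h. Qed.

Lemma conjugates_gen_sub A : conjugates_gen A -> G0 A.
Proof.
have [_ G01 G0M _] := identity_component_subgroup Ggrp.
elim=> [|g B C Gg UB _ IH] //; apply: G0M => //.
by apply: identity_component_normal => //; apply: UG0.
Qed.

Lemma conjugates_gen_mul A B :
  conjugates_gen A -> conjugates_gen B -> conjugates_gen (A *m B).
Proof.
elim=> [|g C D Gg UC _ IH] hB; first by rewrite mul1mx.
by rewrite -mulmxA; apply: conjugates_genM => //; apply: IH.
Qed.

Lemma conjugates_gen_elt g A : G g -> U A -> conjugates_gen (g *m A *m invmx g).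
Proof.
by move=> Gg UA; rewrite -[_ *m invmx g]mulmx1; apply: conjugates_genM (conjugates_gen1).
Qed.

Lemma conjugates_gen_conj g A : G g -> conjugates_gen A ->
  conjugates_gen (g *m A *m invmx g).
Proof.
move=> Gg; elim=> [|h B C Gh UB _ IH].
  by rewrite mulmx1 mulmxV ?Gu //; apply: conjugates_gen1.
have -> : g *m (h *m B *m invmx h *m C) *m invmx g =
    (g *m h) *m B *m invmx (g *m h) *m (g *m C *m invmx g).
  by rewrite invmx_mul ?Gu // !mulmxA mulmxKV ?Gu.
by apply: conjugates_genM => //; apply: GM.
Qed.

Lemma conjugates_gen_subgroup : gl_subgroup conjugates_gen.
Proof.
have gu A : conjugates_gen A -> A \in unitmx.
  by move=> /conjugates_gen_sub /identity_component_sub; apply: Gu.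
split=> //; [exact: conjugates_gen1|exact: conjugates_gen_mul|].
move=> A; elim=> [|g B C Gg UB hC IH]; first by rewrite invmx1; apply: conjugates_gen1.
have hB := conjugates_gen_elt Gg UB.
rewrite invmx_mul ?gu //; apply: conjugates_gen_mul => //.
rewrite (_ : invmx (g *m B *m invmx g) = g *m invmx B *m invmx g).
  by apply: conjugates_gen_elt => //; apply: UV.
have Bu : B \in unitmx by apply: Gu; apply: identity_component_sub; apply: UG0.
by apply: invmx_uniq; rewrite !mulmxA mulmxKV ?Gu // mulmxK // mulmxV ?Gu.
Qed.

(** Each conjugate of [U] is a normal subgroup of the identity component, so that
    [unipotent_mul] applies letter by letter. *)
Lemma conjugates_gen_unipotent A : conjugates_gen A -> unipotent_mx A.
Proof.
elim=> [|g B C Gg UB hC IH]; first by exists 1%N; rewrite subrr.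
have G0C := conjugates_gen_sub hC.
have [_ _ Unorm _ Uuni] := hU.
apply: (unipotent_mul (U := fun A => exists2 D, U D & A = g *m D *m invmx g)) => //.
- by exists 1%:M; rewrite // mulmx1 mulmxV ?Gu.
- move=> _ _ [D UD ->] [E UE ->]; exists (D *m E); first exact: UM.
  by rewrite !mulmxA mulmxKV ?Gu.
- move=> _ [D UD ->]; have [N DN] := Uuni D UD; exists N.
  by rewrite conj_unipotent_exp ?Gu // DN mulmx0 mul0mx.
- by exists B.
- move=> _ [D UD ->].
  (* [C'] is the conjugate of [C] by [g], hence normalizes [U] as well. *)
  pose C' := invmx g *m C *m g.
  have G0C' : G0 C'.
    by have := identity_component_normal Ggrp (GV Gg) G0C; rewrite invmxK.
  have C'u : C' \in unitmx by apply: Gu; apply: identity_component_sub.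
  exists (g *m (C' *m D *m invmx C') *m invmx g).
    by exists (C' *m D *m invmx C') => //; apply: Unorm.
  have eC : C = g *m C' *m invmx g by rewrite /C' !mulmxA mulmxK ?mulmxV ?mul1mx ?Gu.
  by clearbody C'; rewrite eC !mulmxA !mulmxKV ?C'u ?Gu.
Qed.

(** A conjugate of [U] is a connected subset containing [1], so that it lies in the
    identity component of the generated group. *)
Lemma conjugates_gen_connected : connected_in mc conjugates_gen.
Proof.
have grp := conjugates_gen_subgroup.
apply: (connected_ext (H := identity_component conjugates_gen)); last first.
  exact: identity_component_connected.
move=> A; split=> [/identity_component_sub //|].
have [_ C1 CM _] := identity_component_subgroup grp.
elim=> [|g B C Gg UB _ IH] //; apply: (CM) => //.
apply: (identity_component_max (C := fun A => exists2 D, U D & A = g *m D *m invmx g)).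
- by move=> _ [D UD ->]; apply: conjugates_gen_elt.
- apply: connected_gl_image; first by apply: gl_morphism_conj; apply: Gu.
    by move=> D /UG0 /identity_component_sub /Gu.
  by have [_ _ _ /gl_connectedP] := hU.
- by exists 1%:M; rewrite // mulmx1 mulmxV ?Gu.
- by exists B.
Qed.
End IdentityComponentReductive.

(** A connected normal unipotent subgroup of the identity component may fail to be
    stable under [G], but the group generated by its conjugates is stable, and it
    is still connected and unipotent. *)
Lemma reductive_identity_component G : gl_subgroup G -> gl_closed G ->
  reductive G -> reductive (identity_component G).
Proof.
move=> Ggrp Gcl Gred.
apply: reductive_intro (identity_component_subgroup Ggrp) _ => U hU A UA.
have [Gu G1 _ _] := Ggrp.
apply: (reductive_trivial Ggrp Gcl Gred (conjugates_gen_subgroup Ggrp hU)).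
- by move=> B /(conjugates_gen_sub Ggrp hU) /identity_component_sub.
- by move=> B C GB; apply: conjugates_gen_conj.
- exact: conjugates_gen_connected.
- by move=> B; apply: conjugates_gen_unipotent.
have := conjugates_gen_elt G1 UA; rewrite mul1mx invmx1 mulmx1; exact.
Qed.

End Reductive.

(** * Cocharacters and limits *)

Section KGroup.
Variables (k : fieldType) (kbar : closedFieldType) (iota : {rmorphism k -> kbar}).
Variables (n : nat) (G : k_group iota n).

Lemma k_group_unit A : G A -> A \in unitmx.
Proof. by case: (k_group_subgroup G) => h _ _ _; apply: h. Qed.

Lemma k_group1 : G 1%:M.
Proof. by case: (k_group_subgroup G). Qed.

Lemma k_groupM A B : G A -> G B -> G (A *m B).
Proof. by case: (k_group_subgroup G) => _ _ h _; apply: h. Qed.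

Lemma k_groupV A : G A -> G (invmx A).
Proof. by case: (k_group_subgroup G) => _ _ _; apply. Qed.
End KGroup.

Section Limits.
Variables (k : fieldType) (kbar : closedFieldType) (iota : {rmorphism k -> kbar}).

Lemma horner_eq0 (p : {poly kbar}) : (forall a, a != 0 -> p.[a] = 0) -> p = 0.
Proof.
move=> h; apply/eqP; have : p * 'X == 0.
  apply: contraT => /closed_nonrootP [a]; rewrite /root hornerM hornerX mulf_eq0.
  by rewrite negb_or => /andP [pa a0]; rewrite h ?eqxx in pa.
by rewrite mulf_eq0 polyX_eq0 orbF.
Qed.

(** Polynomials in these coordinates are the Laurent polynomials. *)
Definition torus_coord (b : bool) (a : kbar) := if b then a else a^-1.
Definition torus (a : kbar) : Prop := a != 0.

Lemma torus_laurent f : polyfun torus torus_coord f ->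
  exists N (p : {poly kbar}), forall a, a != 0 -> f a * a ^+ N = p.[a].
Proof.
elim=> {f} [b|[|]|f g _ [N [p hp]] _ [M [q hq]]|f g _ [N [p hp]] _ [M [q hq]]
           |f g e _ [N [p hp]]].
- by exists 0%N, b%:P => a _; rewrite hornerC mulr1.
- by exists 0%N, 'X => a _; rewrite hornerX mulr1.
- by exists 1%N, 1 => a a0; rewrite hornerE mulVf.
- exists (N + M)%N, (p * 'X^M + q * 'X^N) => a a0.
  by rewrite hornerD !hornerM !hornerXn -hp // -hq // exprD; ring.
- exists (N + M)%N, (p * q) => a a0.
  by rewrite hornerM -hp // -hq // exprD; ring.
- by exists N, p => a a0; rewrite -hp // e.
Qed.

(** The multiplicative group is even irreducible: a product of nonzero polynomials
    does not vanish on it. *)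
Lemma torus_connected : connected_in torus_coord torus.
Proof.
move=> Z1 Z2 [S1 hS1 e1] [S2 hS2 e2] cov _; apply: NNPP => /not_or_and [n1 n2].
have wit Z (S : (kbar -> kbar) -> Prop) :
    (forall f, S f -> polyfun torus torus_coord f) ->
    (forall t, torus t -> (Z t <-> forall f, S f -> f t = 0)) ->
    ~ (forall t, torus t -> Z t) ->
    exists2 p : {poly kbar}, p != 0 & forall a, torus a -> Z a -> p.[a] = 0.
  move=> hS e nZ; have [a na] := not_all_ex_not _ _ nZ.
  have [Ta nZa] := imply_to_and _ _ na.
  have [f nf] := not_all_ex_not _ _ (fun h => nZa (proj2 (e a Ta) h)).
  have [Sf fa] := imply_to_and _ _ nf.
  have [N [p hp]] := torus_laurent (hS f Sf); exists p.
    apply/eqP => p0; apply: fa; apply/eqP.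
    have /eqP := hp a Ta; rewrite p0 horner0 mulf_eq0 expf_eq0.
    by rewrite (negbTE (Ta : a != 0)) andbF orbF.
  by move=> b Tb /(e b Tb) Zb; rewrite -hp // Zb ?mul0r.
have [p1 p10 h1] := wit Z1 S1 hS1 e1 n1; have [p2 p20 h2] := wit Z2 S2 hS2 e2 n2.
have : p1 * p2 = 0.
  apply: horner_eq0 => a Ta; rewrite hornerM.
  by case: (cov a Ta) => [/(h1 a Ta)|/(h2 a Ta)] ->; rewrite ?mul0r ?mulr0.
by move/eqP; rewrite mulf_eq0 (negbTE p10) (negbTE p20).
Qed.

Section Group.
Variables (n : nat) (G : k_group iota n).

Let Gu := @k_group_unit _ _ _ _ G.
Let GM := @k_groupM _ _ _ _ G.
Let GV := @k_groupV _ _ _ _ G.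
Let G1 := k_group1 G.

Lemma cocharacter1 lam : k_cocharacter G lam -> lam 1 = 1%:M.
Proof.
move=> [hG hM _]; have u := Gu (hG 1 (oner_neq0 _)).
have := hM 1 1 (oner_neq0 _) (oner_neq0 _); rewrite mulr1 => e.
by rewrite -[LHS](mulKmx u) -e mulVmx.
Qed.

Lemma cocharacterV lam a : k_cocharacter G lam -> a != 0 -> invmx (lam a) = lam a^-1.
Proof.
move=> hl a0; have [hG hM _] := hl; apply: invmx_uniq.
by rewrite -hM ?invr_eq0 // mulfV // (cocharacter1 hl).
Qed.

(** The image of the connected multiplicative group is connected and contains
    [1]. *)
Lemma cocharacter_identity_component lam a : k_cocharacter G lam -> a != 0 ->
  identity_component G (lam a).
Proof.
move=> hl a0; have [hG hM [N [P hP]]] := hl.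
apply: (identity_component_max (C := fun A => exists2 a, torus a & A = lam a)).
- by move=> _ [b b0 ->]; apply: hG.
- have entry i j : polyfun torus torus_coord (fun b => lam b i j).
    apply: (regular_ext (f := fun b => b^-1 ^+ N *
        \sum_(l < size (map_poly iota (P i j))) (map_poly iota (P i j))`_l * b ^+ l)).
      by move=> b b0; rewrite hP // !mxE horner_coef exprVn.
    apply: regular_mul.
      by apply: regular_exp; apply: (regular_coord _ _ torus_coord false).
    apply: regular_sum => l _; apply: regular_mul; first exact: (regular_cst idfun).
    by apply: regular_exp; apply: (regular_coord _ _ torus_coord true).
  apply: (connected_image (phi := lam) _ _ _ torus_connected).
  + by move=> b b0; exists b.
  + apply: regular_matrix_inv => // i j.
    apply: (regular_ext (f := fun b => lam b^-1 i j)).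
      by move=> b b0; rewrite (cocharacterV hl).
    apply: regular_comp (entry i j) => [b|[]]; first by rewrite /torus invr_eq0.
      exact: (regular_coord _ _ torus_coord false).
    apply: regular_ext (regular_coord _ _ torus_coord true) => b _.
    by rewrite /torus_coord invrK.
  + by move=> _ [b b0 ->]; exists b.
- by exists 1; rewrite ?(cocharacter1 hl) //; apply: oner_neq0.
- by exists a.
Qed.

Definition rational_mx (A : 'M[kbar]_n) := exists A0 : 'M[k]_n, A = map_mx iota A0.

Lemma rational_mul A B : rational_mx A -> rational_mx B -> rational_mx (A *m B).
Proof. by move=> [A0 ->] [B0 ->]; exists (A0 *m B0); rewrite map_mxM. Qed.

Lemma rational_inv A : rational_mx A -> rational_mx (invmx A).
Proof. by move=> [A0 ->]; exists (invmx A0); rewrite map_invmx. Qed.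

Lemma rational_1 : rational_mx 1%:M.
Proof. by exists 1%:M; rewrite map_mx1. Qed.

Lemma rational_exp A N : rational_mx A -> rational_mx (A ^+ N).
Proof.
move=> hA; elim: N => [|N IH]; first exact: rational_1.
by rewrite exprS; apply: rational_mul.
Qed.

Lemma cocharacter_conj lam g : k_cocharacter G lam -> G g -> rational_mx g ->
  k_cocharacter G (fun a => g *m lam a *m invmx g).
Proof.
move=> [hG hM [N [P hP]]] Gg rg; have [h0 eh] := rational_inv rg.
case: rg => g0 eg; split.
- by move=> a a0; apply: GM (GV Gg); apply: GM (hG a a0).
- by move=> a b a0 b0; rewrite hM // !mulmxA mulmxKV // Gu.
exists N, (map_mx polyC g0 *m P *m map_mx polyC h0) => a a0.
rewrite hP // -scalemxAr -scalemxAl; congr (_ *: _).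
have ev : (fun p => (map_poly iota p).[a]) =1 (horner_eval a \o map_poly iota) by [].
rewrite !(eq_map_mx _ ev) !map_mxM; congr (_ *m _ *m _).
  by rewrite eg; apply/matrixP => i j; rewrite !mxE /= /horner_eval map_polyC hornerC.
by rewrite eh; apply/matrixP => i j; rewrite !mxE /= /horner_eval map_polyC hornerC.
Qed.

Lemma cocharacter_trivial : k_cocharacter G (fun _ => 1%:M).
Proof.
split=> // [a b _ _|]; first by rewrite mulmx1.
exists 0%N, 1%:M => a _; rewrite invr1 scale1r; apply/matrixP => i j.
by rewrite !mxE rmorph_nat -polyC_natr hornerC.
Qed.

Variables (m : nat) (V : k_Gvariety G m).

Lemma act_regular j : regular iota (prod_dom G V)
  (prod_coord (@matrix_coord kbar n) (@affine_coord kbar m))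
  (fun t => gvar_act V t.1 t.2 0 j).
Proof.
have [P hP] := gvar_act_regular V.
have h : regular iota (prod_dom G V)
    (fun i (t : 'M[kbar]_n * 'rV[kbar]_m) => row_mx (gl_coord t.1) t.2 0 i)
    (fun t => gvar_act V t.1 t.2 0 j).
  by apply/regular_polyP; exists (P j) => t Dt; apply: hP.
apply: (regular_comp (phi := id) _ _ h) => // i.
case: (split_ordP i) => {}i ->.
  apply: regular_ext (regular_coord _ _ _ (inl i)) => t _.
  by rewrite row_mxEl.
apply: regular_ext (regular_coord _ _ _ (inr i)) => t _.
by rewrite row_mxEr.
Qed.

Lemma act_fixed_regular g j : G g ->
  polyfun V (@affine_coord kbar m) (fun x => gvar_act V g x 0 j).
Proof.
move=> Gg; apply: (regular_comp (phi := pair g) _ _ (regular_polyfun (act_regular j))) => //.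
case=> i; first exact: (regular_cst idfun _ _ (matrix_coord i g)).
exact: (regular_coord idfun _ _ i).
Qed.

Lemma curve_polyfun (c : 'I_m -> kbar -> kbar) f :
  (forall i, exists p : {poly kbar}, forall a, c i a = p.[a]) ->
  polyfun (fun _ => True) c f -> exists p : {poly kbar}, forall a, f a = p.[a].
Proof.
move=> hc; elim=> {f} [b|i|f g _ [p hp] _ [q hq]|f g _ [p hp] _ [q hq]|f g e _ [p hp]] //.
- by exists b%:P => a; rewrite hornerC.
- by exists (p + q) => a; rewrite hornerD hp hq.
- by exists (p * q) => a; rewrite hornerM hp hq.
- by exists p => a; rewrite -hp e.
Qed.

(** [g] acts by polynomials, so that it maps the curve extending [lam a v] to a
    curve of the same kind. *)
Lemma limit_conj lam v v' g : k_cocharacter G lam -> G g -> V v ->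
  is_limit V lam v v' ->
  is_limit V (fun a => g *m lam a *m invmx g) (gvar_act V g v) (gvar_act V g v').
Proof.
move=> [hG hM _] Gg Vv [phi [phiV phiE phi0]].
pose phi_at a := map_mx (fun p : {poly kbar} => p.[a]) phi.
have /(_ _)/constructive_indefinite_description hq : forall j, exists q : {poly kbar},
    forall a, gvar_act V g (phi_at a) 0 j = q.[a].
  move=> j; apply: (curve_polyfun (c := fun i a => phi_at a 0 i)).
    by move=> i; exists (phi 0 i) => a; rewrite mxE.
  apply: (regular_comp (phi := phi_at)) (act_fixed_regular j Gg) => [a _|i].
    exact: phiV.
  exact: (regular_coord idfun _ (fun i a => phi_at a 0 i) i).
exists (\row_j proj1_sig (hq j)).
have e a : map_mx (fun p : {poly kbar} => p.[a]) (\row_j proj1_sig (hq j)) =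
    gvar_act V g (phi_at a).
  by apply/rowP => j; rewrite !mxE -(proj2_sig (hq j)).
split=> [a|a a0|]; rewrite e.
- exact: gvar_act_in Gg (phiV a).
- have Gl := hG a a0; have VGv := gvar_act_in Gg Vv.
  rewrite /phi_at phiE // -!gvar_actM //; first by rewrite mulmxKV // Gu.
    by apply: GM (GV Gg); apply: GM.
- by rewrite /phi_at phi0.
Qed.

Lemma limit_in lam v v' : is_limit V lam v v' -> V v'.
Proof. by move=> [phi [phiV _ <-]]. Qed.

End Group.

Section Restriction.
Hypothesis kbar_closure : is_algebraic_closure iota.
Variables (n : nat) (G : k_group iota n) (m : nat) (V : k_Gvariety G m).
Local Notation G0 := (identity_component_group kbar_closure G).

Lemma restricted_act_regular :
  k_regular iota (fun t : 'M[kbar]_n * 'rV[kbar]_m => G0 t.1 /\ V t.2)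
    (fun t => row_mx (gl_coord t.1) t.2) (fun t => gvar_act V t.1 t.2).
Proof.
have [P hP] := gvar_act_regular V; exists P => t [G0t Vt]; apply: hP.
by split=> //; apply: identity_component_sub G0t.
Qed.

Definition restricted_variety : k_Gvariety G0 m :=
  @KGvariety _ _ iota n G0 m V (gvar_act V) (gvar_defined V)
    (fun g v Gg Vv => gvar_act_in (identity_component_sub Gg) Vv)
    (@gvar_act1 _ _ _ _ _ _ V)
    (fun g h v Gg Gh Vv => gvar_actM (identity_component_sub Gg)
       (identity_component_sub Gh) Vv)
    restricted_act_regular.

Lemma cocharacter_restrict lam : k_cocharacter G lam -> k_cocharacter G0 lam.
Proof.
move=> hl; have [_ hM hP] := hl.
by split=> // a a0; apply: cocharacter_identity_component hl a0.
Qed.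

(** If [v' = g v] with [g] in [G(k)], then the points [g ^ i v] form a chain of
    limits along the conjugates of the cocharacter, and this chain closes up in
    the orbit of the identity component because a power of [g] lies in it. *)
Lemma antisymmetric_limit lam v v' :
  orbit_prec_antisymmetric restricted_variety ->
  V v -> k_cocharacter G lam -> is_limit V lam v v' ->
  orbit_of V (k_points iota G) v v' ->
  orbit_of V (k_points iota (identity_component G)) v v'.
Proof.
move=> anti Vv hl lim [g [Gg rg] ev'].
have Vv' := limit_in lim; have Ggrp := k_group_subgroup G; have [Gu G1 GM GV] := Ggrp.
have [Gcl _] := k_group_defined G.
have [_ G01 _ G0V] := identity_component_subgroup Ggrp.
have [N G0N] := identity_component_power Ggrp Gcl Gg.
pose h := invmx (g ^+ N.+1).
have G0h : identity_component G h by apply: G0V.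
have Gh := identity_component_sub G0h.
have rh : rational_mx h by apply/rational_inv/rational_exp.
have Ge i : G (g ^+ i) by apply: subgroup_exp.
have step := cocharacter_restrict.
have fwd : orbit_prec restricted_variety v' v.
  move=> C [sC clC] orbC; apply: (clC v lam v') => //; last exact: step.
  apply: orbC; exists 1%:M; last by rewrite gvar_act1.
  by split=> //; apply: rational_1.
have back : orbit_prec restricted_variety v v'.
  move=> C [sC clC] orbC.
  suff H i : C (gvar_act V (h *m g ^+ i.+1) v).
    by have := H N; rewrite mulVmx ?gvar_act1 //; apply: Gu.
  elim: i => [|i IH].
    apply: orbC; exists h; first by split.
    by rewrite expr1 gvar_actM // ev'.
  have Ghi := GM _ _ Gh (Ge i.+1).
  apply: (clC _ (fun a => (h *m g ^+ i.+1) *m lam a *m invmx (h *m g ^+ i.+1)) _ IH).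
    apply/step/cocharacter_conj => //.
    by apply: rational_mul rh _; apply: rational_exp.
  have := limit_conj hl Ghi Vv lim; rewrite ev'.
  by rewrite -gvar_actM // -mulmxA -[_ ^+ _ *m g]/(_ * _) -exprSr.
have [_] := anti v v' Vv Vv' fwd back v'.
apply; exists 1%:M; last by rewrite gvar_act1.
by split=> //; apply: rational_1.
Qed.

End Restriction.
End Limits.

(** * Block monomial matrices *)

Section Blocks.
Variables (S : comNzRingType) (R n : nat).
Local Notation idx := 'I_R.+1.

Definition block_index (x : 'I_(R.+1 * n)) : idx * 'I_n :=
  enum_val (cast_ord (esym (mxvec_cast R.+1 n)) x).

Lemma block_indexK a i : block_index (mxvec_index a i) = (a, i).
Proof. by rewrite /block_index /mxvec_index cast_ordK enum_rankK. Qed.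

Definition block (A : 'M[S]_(R.+1 * n)) (a b : idx) : 'M[S]_n :=
  \matrix_(i, j) A (mxvec_index a i) (mxvec_index b j).

Lemma block_ext A B : (forall a b, block A a b = block B a b) -> A = B.
Proof.
move=> e; apply/matrixP => x y; case/mxvec_indexP: x => a i; case/mxvec_indexP: y => b j.
by move/matrixP/(_ i j): (e a b); rewrite !mxE.
Qed.

Lemma block_mul A B a b :
  block (A *m B) a b = \sum_c block A a c *m block B c b.
Proof.
apply/matrixP => i j; rewrite summxE !mxE.
rewrite (reindex _ (curry_mxvec_bij _ _)) /=.
transitivity (\sum_(p : idx * 'I_n) A (mxvec_index a i) (mxvec_index p.1 p.2) *
  B (mxvec_index p.1 p.2) (mxvec_index b j)); first by apply: eq_bigr => -[c l].
rewrite -(pair_bigA _ (fun c l => A (mxvec_index a i) (mxvec_index c l) *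
  B (mxvec_index c l) (mxvec_index b j))) /=.
by apply: eq_bigr => c _; rewrite mxE; apply: eq_bigr => l _; rewrite !mxE.
Qed.

(** The element of the wreath product with base part [g] and cyclic shift [s]. *)
Definition monomial (s : idx) (g : idx -> 'M[S]_n) : 'M[S]_(R.+1 * n) :=
  \matrix_(x, y) if (block_index y).1 == (block_index x).1 + s
    then g (block_index x).1 (block_index x).2 (block_index y).2 else 0.

Lemma block_monomial s g a b :
  block (monomial s g) a b = if b == a + s then g a else 0.
Proof.
by apply/matrixP => i j; rewrite !mxE !block_indexK /=; case: eqP => // _; rewrite mxE.
Qed.

Lemma block_monomial_shift s g a : block (monomial s g) a (a + s) = g a.
Proof. by rewrite block_monomial eqxx. Qed.

Lemma monomial_ext s g g' : (forall a, g a = g' a) -> monomial s g = monomial s g'.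
Proof. by move=> e; apply/matrixP => x y; rewrite !mxE e. Qed.

Lemma monomial_mul s g s' g' :
  monomial s g *m monomial s' g' = monomial (s + s') (fun a => g a *m g' (a + s)).
Proof.
apply: block_ext => a b; rewrite block_mul (bigD1 (a + s)) //=.
rewrite big1 => [|c /negbTE nc]; last by rewrite block_monomial nc mul0mx.
rewrite addr0 !block_monomial eqxx addrA; case: eqP => // _.
by rewrite mulmx0.
Qed.

Lemma monomial1 : monomial 0 (fun _ => 1%:M) = 1%:M.
Proof.
apply: block_ext => a b; rewrite block_monomial addr0; apply/matrixP => i j.
rewrite [RHS]mxE; have -> : (1%:M : 'M[S]_(R.+1 * n)) (mxvec_index a i) (mxvec_index b j)
    = ((a == b) && (i == j))%:R.
  rewrite mxE; congr (_%:R); congr nat_of_bool; apply/eqP/andP => [e|[/eqP -> /eqP -> //]].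
  by have := congr1 block_index e; rewrite !block_indexK => -[-> ->].
by rewrite eq_sym; case: eqP => _; rewrite mxE.
Qed.

Lemma monomial_exp g N : monomial 0 g ^+ N = monomial 0 (fun a => g a ^+ N).
Proof.
elim: N => [|N IH]; first by rewrite expr0 -[LHS]monomial1.
rewrite exprS IH -[_ * _]/(_ *m _) monomial_mul addr0.
by apply: monomial_ext => a; rewrite addr0 exprS.
Qed.

Lemma monomial_sub1 g : monomial 0 g - 1%:M = monomial 0 (fun a => g a - 1%:M).
Proof.
rewrite -monomial1; apply/matrixP => x y; rewrite !mxE.
by case: eqP; rewrite ?subr0 // mxE => _; rewrite !mxE.
Qed.

End Blocks.

Lemma monomial_inv (K : fieldType) R n (s : 'I_R.+1) (g : 'I_R.+1 -> 'M[K]_n) :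
  (forall a, g a \in unitmx) ->
  invmx (monomial s g) = monomial (- s) (fun a => invmx (g (a - s))).
Proof.
move=> gu; apply: invmx_uniq; rewrite monomial_mul subrr -[RHS]monomial1.
by apply: monomial_ext => a; rewrite addrK mulmxV.
Qed.

Lemma map_monomial (S S' : comNzRingType) (f : {rmorphism S -> S'}) R n
    (s : 'I_R.+1) (g : 'I_R.+1 -> 'M[S]_n) :
  map_mx f (monomial s g) = monomial s (fun a => map_mx f (g a)).
Proof. by apply/matrixP => x y; rewrite !mxE; case: eqP; rewrite ?rmorph0 // mxE. Qed.

(** * The wreath product of a group with a cyclic group *)

Section Wreath.
Variables (k : fieldType) (kbar : closedFieldType) (iota : {rmorphism k -> kbar}).
Variables (R n : nat) (G : k_group iota n).
Local Notation idx := 'I_R.+1.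
Local Notation mc := (@matrix_coord kbar n).
Local Notation MC := (@matrix_coord kbar (R.+1 * n)).

Let Gu := @k_group_unit _ _ _ _ G.
Let GM := @k_groupM _ _ _ _ G.
Let GV := @k_groupV _ _ _ _ G.
Let G1 := k_group1 G.

Definition wreath (A : 'M[kbar]_(R.+1 * n)) :=
  exists (s : idx) (g : idx -> 'M_n), (forall a, G (g a)) /\ A = monomial s g.

Lemma wreath_subgroup : gl_subgroup wreath.
Proof.
have VW A : wreath A -> wreath (invmx A).
  move=> [s [g [hg ->]]]; exists (- s), (fun a => invmx (g (a - s))).
  by split=> [a|]; [apply: GV|apply: monomial_inv => a; apply: Gu].
split=> //.
- move=> A [s [g [hg ->]]].
  have [] := @mulmx1_unit _ _ (monomial s g)
    (monomial (- s) (fun a => invmx (g (a - s)))) => //.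
  rewrite monomial_mul subrr -[RHS]monomial1; apply: monomial_ext => a.
  by rewrite addrK mulmxV // Gu.
- by exists 0, (fun _ => 1%:M); rewrite monomial1.
- move=> A B [s [g [hg ->]]] [s' [g' [hg' ->]]].
  exists (s + s'), (fun a => g a *m g' (a + s)); split=> [a|]; first exact: GM.
  exact: monomial_mul.
Qed.

Lemma wreath_unit A : wreath A -> A \in unitmx.
Proof. by case: wreath_subgroup => h _ _ _; apply: h. Qed.

Lemma block_inv_monomial s (g : idx -> 'M_n) a : (forall a, G (g a)) ->
  block (invmx (monomial s g)) (a + s) a = invmx (g a).
Proof.
move=> hg; rewrite monomial_inv => [|b]; last exact: Gu.
by rewrite block_monomial addrK eqxx.
Qed.

Section BlockRegular.
Variables (k' : fieldType) (iota' : {rmorphism k' -> kbar}).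
Variable D : 'M[kbar]_(R.+1 * n) -> Prop.

Lemma regular_block a b i j : regular iota' D MC (fun A => block A a b i j).
Proof.
apply: regular_ext (regular_entry _ _ (mxvec_index a i) (mxvec_index b j)) => A _.
by rewrite mxE.
Qed.

Lemma regular_block_inv a b i j : (forall A, D A -> A \in unitmx) ->
  regular iota' D MC (fun A => block (invmx A) a b i j).
Proof.
move=> sD; apply: (regular_ext (f := fun A => invmx A (mxvec_index a i) (mxvec_index b j))).
  by move=> A _; rewrite [RHS]mxE.
exact: regular_invmx.
Qed.
End BlockRegular.

(** The entries of the blocks and, through the inverse matrix, the inverses of
    their determinants are polynomial functions. *)
Lemma wreath_closed : gl_closed wreath.
Proof.
apply/gl_closedP; first exact: wreath_unit.
pose kap s a (A : 'M[kbar]_(R.+1 * n)) : 'rV[kbar]_(n * n + 1) :=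
  row_mx (mxvec (block A a (a + s))) (\det (block (invmx A) (a + s) a))%:M.
apply: (closed_ext (Z := fun A => exists s, (forall a b, b != a + s ->
    forall i j, block A a b i j = 0) /\ forall a, gl_image G (kap s a A))).
  move=> A Au; split=> [[s [off on]]|[s [g [hg ->]]]].
    exists s, (fun a => block A a (a + s)); split=> [a|].
      by have [B GB /eq_row_mx [/(can_inj mxvecK) -> _]] := on a.
    apply: block_ext => a b; rewrite block_monomial; case: eqP => [-> //|/eqP nb].
    by apply/matrixP => i j; rewrite off // mxE.
  exists s; split=> [a b /negbTE nb i j|a].
    by rewrite block_monomial nb mxE.
  exists (g a) => //.
  by rewrite /kap block_monomial_shift block_inv_monomial // det_inv.
apply: closed_exists_ord => s; apply: closed_and.
  apply: closed_forall => a; apply: closed_all => b _.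
  apply: closed_forall => i; apply: closed_forall => j.
  by apply: closed_zero; apply: regular_block.
apply: closed_forall => a.
have [Gcl _] := k_group_defined G.
apply: (closed_comp (phi := kap s a) (D' := fun _ => True))
  (proj1 (zariski_closedP _) Gcl) => // i.
rewrite /affine_coord /kap; case: (split_ordP i) => {}i ->.
  case/mxvec_indexP: i => u v.
  apply: regular_ext (regular_block _ _ a (a + s) u v) => A _.
  by rewrite row_mxEl mxvecE.
apply: (regular_ext (f := fun A => \det (block (invmx A) (a + s) a))) => [A _|].
  by rewrite row_mxEr ord1 mxE mulr1n.
by apply: regular_det => u v; apply: regular_block_inv.
Qed.

Lemma regular_pow_coord (f : 'M[kbar]_n -> kbar) a : regular iota G mc f ->
  regular iota (@pow_dom _ R.+1 G) (pow_coord mc) (fun t => f (t a)).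
Proof.
apply: (regular_comp (phi := fun t : idx -> 'M[kbar]_n => t a)) => [t Dt|i]; first exact: Dt.
exact: (regular_coord _ _ _ (a, i)).
Qed.

(** The elements with a given shift are parametrized by a power of [G]. *)
Lemma wreath_lin_disjoint : lin_disjoint iota wreath MC.
Proof.
apply: (lin_disjoint_union (E := fun (s : idx) A =>
    exists g : idx -> 'M_n, (forall a, G (g a)) /\ A = monomial s g)).
- by move=> s A h; exists s.
- by move=> A [s h]; exists s.
move=> s; have [_ /lin_disjoint_gl_image ldG] :=
  proj1 (k_defined_lin_disjoint _ _) (k_group_defined G).
apply: (lin_disjoint_image (phi := monomial s) _ _ _ (lin_disjoint_pow (r := R.+1) ldG)).
- by move=> g hg; exists g.
- have entry s' (h : idx -> (idx -> 'M[kbar]_n) -> 'M[kbar]_n) :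
      (forall a i j,
        regular iota (@pow_dom _ R.+1 G) (pow_coord mc) (fun t => h a t i j)) ->
      forall x y, regular iota (@pow_dom _ R.+1 G) (pow_coord mc)
        (fun t => monomial s' (fun a => h a t) x y).
    move=> hh x y; pose f t := if (block_index y).1 == (block_index x).1 + s'
      then h (block_index x).1 t (block_index x).2 (block_index y).2 else 0.
    apply: (regular_ext (f := f)); first by move=> t _; rewrite mxE.
    by rewrite /f; case: eqP => _; [apply: hh|apply: regular_0].
  apply: regular_matrix_inv => x y.
    apply: (entry s (fun a t => t a)) => a i j.
    by apply: (regular_pow_coord (f := fun A => A i j)); apply: regular_entry.
  apply: (regular_ext (f := fun t => monomial (- s) (fun a => invmx (t (a - s))) x y)).
    by move=> t Dt; rewrite monomial_inv // => a; apply/Gu/Dt.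
  apply: (entry (- s) (fun a t => invmx (t (a - s)))) => a i j.
  apply: (regular_pow_coord (f := fun A => invmx A i j)).
  by apply: regular_invmx; apply: Gu.
- by move=> A [g [hg ->]]; exists g.
Qed.

Lemma wreath_k_defined : k_defined iota (gl_image wreath).
Proof.
apply/k_defined_lin_disjoint; split; first exact: wreath_closed.
exact/lin_disjoint_gl_image/wreath_lin_disjoint.
Qed.

Definition wreath_group : k_group iota (R.+1 * n) :=
  KGroup wreath_subgroup wreath_k_defined.

(** From here on the blocks are nonempty, so that the shift is determined by
    the matrix. *)
Hypothesis n_gt0 : (0 < n)%N.

Lemma unit_neq0 (A : 'M[kbar]_n) : A \in unitmx -> A != 0.
Proof.
move=> Au; apply/eqP => A0; have := mulmxV Au; rewrite A0 mul0mx.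
move=> /matrixP /(_ (Ordinal n_gt0) (Ordinal n_gt0)); rewrite !mxE eqxx => /eqP.
by rewrite eq_sym oner_eq0.
Qed.

(** The matrices without shift and those with a nonzero shift are separated by the
    closed conditions that the block in position [(0, 0)] is the only nonzero one
    in its row and that it is zero. *)
Lemma connected_wreath_shift C : (forall A, C A -> wreath A) ->
  connected_in MC C -> C 1%:M ->
  forall A, C A -> exists2 g : idx -> 'M_n, (forall a, G (g a)) & A = monomial 0 g.
Proof.
move=> sC conn C1.
have cl a b : closed_in C MC (fun A => block A a b = 0).
  apply: (closed_ext (Z := fun A => forall i j, block A a b i j = 0)).
    by move=> A _; split=> [h|-> i j]; [apply/matrixP => i j; rewrite h|]; rewrite mxE.
  apply: closed_forall => i; apply: closed_forall => j; apply: closed_zero.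
  exact: regular_block.
have [|||h A CA|h] := conn (fun A => forall b, b != 0 -> block A 0 b = 0)
    (fun A => block A 0 0 = 0) _ (cl 0 0).
- by apply: closed_all => b _; apply: cl.
- move=> A /sC [s [g [hg ->]]]; have [->|s0] := eqVneq s 0; [left=> b nb|right].
    by rewrite block_monomial addr0 (negbTE nb).
  by rewrite block_monomial add0r eq_sym (negbTE s0).
- move=> A /sC [s [g [hg ->]]] [h1 h2]; have /eqP[] := unit_neq0 (Gu (hg 0)).
  have [s0|s0] := eqVneq s 0.
    by rewrite -h2 s0 block_monomial addr0 eqxx.
  by rewrite -(h1 s s0) block_monomial add0r eqxx.
- have [s [g [hg eA]]] := sC A CA; exists g => //; rewrite eA.
  have [-> //|s0] := eqVneq s 0; have := h A CA s s0; rewrite eA block_monomial add0r eqxx.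
  by move/eqP; rewrite (negbTE (unit_neq0 (Gu (hg 0)))).
- have := h _ C1; rewrite -monomial1 block_monomial addr0 eqxx => /eqP.
  by rewrite (negbTE (unit_neq0 (unitmx1 _ _))).
Qed.

(** A connected normal unipotent subgroup has trivial shifts, and its
    projections to the factors are connected, unipotent and normal in [G]. *)
Lemma wreath_reductive : reductive G -> reductive wreath_group.
Proof.
move=> Gred; apply: (reductive_intro wreath_subgroup) => U.
move=> [[[Uu U1 UM UV] _] UW Unorm /gl_connectedP Uconn Uuni] A UA.
have base B : U B -> exists2 g : idx -> 'M_n, (forall a, G (g a)) & B = monomial 0 g.
  exact: connected_wreath_shift.
have blk a B C : U B -> U C -> block (B *m C) a a = block B a a *m block C a a.
  move=> /base [g _ ->] /base [h _ ->]; rewrite monomial_mul !block_monomial !addr0 eqxx.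
  by [].
have binv a B : U B -> invmx (block B a a) = block (invmx B) a a.
  move=> UB; apply: invmx_uniq; rewrite -blk //; last exact: UV.
  by rewrite mulmxV ?Uu // -monomial1 block_monomial addr0 eqxx.
have trivial a B : U B -> block B a a = 1%:M.
  move=> UB; have [Gcl _] := k_group_defined G.
  apply: (reductive_trivial (U := fun X => exists2 C, U C & X = block C a a)
    (k_group_subgroup G) Gcl Gred); last by exists B.
  - split.
    + by move=> _ [C /base [g hg ->] ->]; rewrite block_monomial addr0 eqxx; apply: Gu.
    + by exists 1%:M => //; rewrite -monomial1 block_monomial addr0 eqxx.
    + by move=> _ _ [C UC ->] [C' UC' ->]; exists (C *m C'); [apply: UM|rewrite blk].
    + by move=> _ [C UC ->]; exists (invmx C); [apply: UV|rewrite binv].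
  - by move=> _ [C /base [g hg ->] ->]; rewrite block_monomial addr0 eqxx.
  - move=> X _ GX [C UC ->]; pose h b := if b == a then X else 1%:M.
    have hG b : G (h b) by rewrite /h; case: eqP.
    exists (monomial 0 h *m C *m invmx (monomial 0 h)).
      by apply: Unorm => //; exists 0, h.
    have [g hg ->] := base C UC.
    rewrite monomial_inv => [|b]; last exact: Gu.
    by rewrite !monomial_mul !block_monomial !subr0 !addr0 eqxx /h eqxx.
  - apply: (connected_image (phi := fun C => block C a a) _ _ _ Uconn).
    + by move=> C UC; exists C.
    + apply: regular_matrix_inv => i j; first exact: regular_block.
      apply: (regular_ext (f := fun C => block (invmx C) a a i j)).
        by move=> C UC; rewrite binv.
      exact: regular_block_inv.
    + by move=> _ [C UC ->]; exists C.
  - move=> _ [C UC ->]; have [N] := Uuni C UC; have [g hg ->] := base C UC.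
    rewrite monomial_sub1 monomial_exp => /(congr1 (fun M => block M a a)).
    rewrite !block_monomial addr0 eqxx => gN; exists N; rewrite gN.
    by apply/matrixP => i j; rewrite !mxE.
have [g hg eA] := base A UA; rewrite eA -monomial1; apply: monomial_ext => a.
by rewrite -(trivial a A UA) eA block_monomial addr0 eqxx.
Qed.

End Wreath.

(** * The wreath product acting on a power of a variety *)

Section Packing.
Variables (S : nmodType) (r m : nat).

Definition component (x : 'rV[S]_(r * m)) (a : 'I_r) : 'rV[S]_m := row a (vec_mx x).

Definition pack (f : 'I_r -> 'rV[S]_m) : 'rV[S]_(r * m) :=
  mxvec (\matrix_(a, i) f a 0 i).

Lemma packK f a : component (pack f) a = f a.
Proof. by rewrite /component mxvecK; apply/rowP => i; rewrite !mxE. Qed.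

Lemma component_ext x y : (forall a, component x a = component y a) -> x = y.
Proof.
move=> e; apply: (can_inj vec_mxK); apply/row_matrixP; exact: e.
Qed.

Lemma pack_entry f a i : pack f 0 (mxvec_index a i) = f a 0 i.
Proof. by rewrite mxvecE mxE. Qed.

Lemma component_entry x a i : component x a 0 i = x 0 (mxvec_index a i).
Proof. by rewrite !mxE. Qed.
End Packing.

Section WreathAction.
Variables (k : fieldType) (kbar : closedFieldType) (iota : {rmorphism k -> kbar}).
Variables (R n : nat) (G : k_group iota n) (m : nat) (V : k_Gvariety G m).
Hypothesis n_gt0 : (0 < n)%N.
Local Notation idx := 'I_R.+1.
Local Notation W := (wreath_group R G).
Local Notation MC := (@matrix_coord kbar (R.+1 * n)).
Local Notation VC := (@affine_coord kbar (R.+1 * m)).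

Let Gu := @k_group_unit _ _ _ _ G.
Let GM := @k_groupM _ _ _ _ G.
Let G1 := k_group1 G.

Definition power_set (x : 'rV[kbar]_(R.+1 * m)) := forall a, V (component x a).

Lemma power_k_defined : k_defined iota power_set.
Proof.
have [Vcl Vld] := proj1 (k_defined_lin_disjoint _ _) (gvar_defined V).
apply/k_defined_lin_disjoint; split.
  apply/zariski_closedP; apply: closed_forall => a.
  apply: (closed_comp (phi := fun x : 'rV[kbar]_(R.+1 * m) => component x a) _ _
    (proj1 (zariski_closedP _) Vcl)) => // i.
  apply: regular_ext (regular_coord _ _ _ (mxvec_index a i)) => x _.
  by rewrite /affine_coord component_entry.
apply: (lin_disjoint_image (phi := @pack kbar R.+1 m) _ _ _ (lin_disjoint_pow (r := R.+1) Vld)).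
- by move=> f hf a; rewrite packK; apply: hf.
- move=> i; case/mxvec_indexP: i => a i.
  apply: regular_ext (regular_coord _ _ _ (a, i)) => f _.
  by rewrite /affine_coord pack_entry.
- move=> x hx; exists (component x); first exact: hx.
  suff -> : pack (component x) = x by [].
  by apply: component_ext => a; rewrite packK.
Qed.

(** Characteristic function of the elements with shift [s]; it is polynomial
    because it uses the inverse of the matrix. *)
Definition shift_indicator (s : idx) (A : 'M[kbar]_(R.+1 * n)) :=
  \det (block A 0 s) * \det (block (invmx A) s 0).

Lemma det_zero : \det (0 : 'M[kbar]_n) = 0.
Proof.
by apply/eqP; have := unit_neq0 n_gt0 (A := 0 : 'M[kbar]_n);
   rewrite unitmxE unitfE eqxx; case: eqP => // _ /(_ isT).
Qed.

Lemma shift_indicator_monomial s s' (g : idx -> 'M_n) : (forall a, G (g a)) ->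
  shift_indicator s (monomial s' g) = (s == s')%:R.
Proof.
move=> hg; rewrite /shift_indicator block_monomial add0r; case: eqP => [->|_].
  have := block_inv_monomial s' 0 hg; rewrite add0r => ->.
  by rewrite det_inv mulrV // -unitmxE Gu.
by rewrite det_zero mul0r.
Qed.

(** On an element with shift [s] only one summand is nonzero; the sum over all
    shifts makes the action visibly polynomial. *)
Definition wreath_act (A : 'M[kbar]_(R.+1 * n)) (x : 'rV[kbar]_(R.+1 * m)) :=
  pack (fun a => \sum_s shift_indicator s A *:
    gvar_act V (block A a (a + s)) (component x (a + s))).

Lemma wreath_act_monomial s (g : idx -> 'M_n) x a : (forall a, G (g a)) ->
  component (wreath_act (monomial s g) x) a = gvar_act V (g a) (component x (a + s)).
Proof.
move=> hg; rewrite packK (bigD1 s) //= shift_indicator_monomial // eqxx scale1r.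
rewrite block_monomial_shift big1 ?addr0 // => s' /negbTE ns.
by rewrite shift_indicator_monomial // ns scale0r.
Qed.

Lemma wreath_act_in A x : W A -> power_set x -> power_set (wreath_act A x).
Proof.
by move=> [s [g [hg ->]]] hx a; rewrite wreath_act_monomial //; apply: gvar_act_in.
Qed.

Lemma wreath_act1 x : power_set x -> wreath_act 1%:M x = x.
Proof.
move=> hx; apply: component_ext => a; rewrite -monomial1 wreath_act_monomial //.
by rewrite addr0 gvar_act1.
Qed.

Lemma wreath_actM A B x : W A -> W B -> power_set x ->
  wreath_act (A *m B) x = wreath_act A (wreath_act B x).
Proof.
move=> [s [g [hg ->]]] [s' [h [hh ->]]] hx; apply: component_ext => a.
rewrite monomial_mul !wreath_act_monomial //; last by move=> b; apply: GM.
by rewrite gvar_actM // addrA.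
Qed.

Lemma regular_peval_comp (T I : Type) (D : T -> Prop) (c : I -> T -> kbar) l
    (P : {mpoly k[l]}) (y : T -> 'rV[kbar]_l) :
  (forall i, regular iota D c (fun t => y t 0 i)) ->
  regular iota D c (fun t => peval (map_mpoly iota P) (y t)).
Proof.
move=> hy; apply: (regular_comp (phi := y) (D' := fun _ => True)
  (c' := @affine_coord kbar l) (f := peval (map_mpoly iota P))) => //.
by apply/regular_peval; exists P.
Qed.

(** For the wrong shifts, [P i] is evaluated at points that do not come from
    [G], but these values are multiplied by zero. *)
Lemma wreath_act_regular :
  k_regular iota
    (fun t : 'M[kbar]_(R.+1 * n) * 'rV[kbar]_(R.+1 * m) => W t.1 /\ power_set t.2)
    (fun t => row_mx (gl_coord t.1) t.2) (fun t => wreath_act t.1 t.2).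
Proof.
have [P hP] := gvar_act_regular V.
pose T := ('M[kbar]_(R.+1 * n) * 'rV[kbar]_(R.+1 * m))%type.
pose D (t : T) := W t.1 /\ power_set t.2.
pose c i (t : T) := row_mx (gl_coord t.1) t.2 0 i.
have reg1 f : regular iota W MC f -> regular iota D c (fun t => f t.1).
  apply: (regular_comp (phi := fst)) => [t []//|i].
  apply: regular_ext (regular_coord _ _ _ (lshift _ i)) => t _.
  by rewrite /c row_mxEl.
have reg2 i : regular iota D c (fun t => t.2 0 i).
  apply: regular_ext (regular_coord _ _ _ (rshift _ i)) => t _.
  by rewrite /c row_mxEr.
have Wu A : W A -> A \in unitmx by apply: wreath_unit.
pose y a s (t : T) := row_mx (row_mx (mxvec (block t.1 a (a + s)))
  (\det (block (invmx t.1) (a + s) a))%:M) (component t.2 (a + s)).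
have hy a s i : regular iota D c (fun t => y a s t 0 i).
  case: (split_ordP i) => {}i ->; first case: (split_ordP i) => {}i ->.
  - case/mxvec_indexP: i => u v.
    apply: regular_ext (reg1 _ (regular_block _ _ a (a + s) u v)) => t _.
    by rewrite /y !row_mxEl mxvecE.
  - apply: (regular_ext (f := fun t => \det (block (invmx t.1) (a + s) a))).
      by move=> t _; rewrite /y row_mxEl row_mxEr ord1 mxE mulr1n.
    apply: (reg1 (fun A => \det (block (invmx A) (a + s) a))).
    by apply: regular_det => u v; apply: regular_block_inv.
  - apply: regular_ext (reg2 (mxvec_index (a + s) i)) => t _.
    by rewrite /y row_mxEr component_entry.
have /(_ _)/constructive_indefinite_description hQ : forall l, exists Q : {mpoly k[_]},
    forall t, D t ->
      wreath_act t.1 t.2 0 l = peval (map_mpoly iota Q) (row_mx (gl_coord t.1) t.2).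
  move=> l.
  suff /regular_polyP [Q hQ] : regular iota D c (fun t => wreath_act t.1 t.2 0 l).
    by exists Q.
  case/mxvec_indexP: l => a i.
  apply: (regular_ext (f := fun t => \sum_s shift_indicator s t.1 *
      peval (map_mpoly iota (P i)) (y a s t))).
    move=> [_ x] [[s [g [hg /= ->]]] hx]; rewrite pack_entry summxE.
    apply: eq_bigr => s' _; rewrite mxE shift_indicator_monomial //.
    case: eqP => [->|_]; last by rewrite !mul0r.
    rewrite !mul1r block_monomial_shift /y /= block_monomial_shift.
    rewrite (block_inv_monomial _ _ hg) det_inv.
    by rewrite (hP (g a, component x (a + s))) //; split; [apply: hg|apply: hx].
  apply: regular_sum => s _; apply: regular_mul; last exact: regular_peval_comp.
  apply: (reg1 (shift_indicator s)).
  by apply: regular_mul; apply: regular_det => u v;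
    [apply: regular_block|apply: regular_block_inv].
exists (fun l => proj1_sig (hQ l)) => t Dt l; exact: (proj2_sig (hQ l)).
Qed.

Definition wreath_variety : k_Gvariety W (R.+1 * m) :=
  KGvariety power_k_defined wreath_act_in wreath_act1 wreath_actM wreath_act_regular.

(** The sum [M] of the exponents serves as a common denominator. *)
Lemma diagonal_cocharacter (lam : idx -> kbar -> 'M[kbar]_n) :
  (forall a, k_cocharacter G (lam a)) ->
  k_cocharacter W (fun t => monomial 0 (fun a => lam a t)).
Proof.
move=> hl; split.
- move=> t t0; exists 0, (fun a => lam a t); split=> // a.
  by have [h _ _] := hl a; apply: h.
- move=> t u t0 u0; rewrite monomial_mul addr0; apply: monomial_ext => a.
  by have [_ h _] := hl a; rewrite addr0 h.
have /(_ _)/constructive_indefinite_description hN :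
    forall a, exists NP : nat * 'M[{poly k}]_n,
    forall t, t != 0 -> lam a t =
      (t ^+ NP.1)^-1 *: map_mx (fun p => (map_poly iota p).[t]) NP.2.
  by move=> a; have [_ _ [N [P h]]] := hl a; exists (N, P).
pose N a := (proj1_sig (hN a)).1; pose P a := (proj1_sig (hN a)).2.
have NP a t : t != 0 ->
    lam a t = (t ^+ N a)^-1 *: map_mx (fun p => (map_poly iota p).[t]) (P a).
  exact: (proj2_sig (hN a)).
pose M := (\sum_a N a)%N.
have NM a : (N a <= M)%N by rewrite /M (bigD1 a) //= leq_addr.
exists M, (monomial 0 (fun a => 'X^(M - N a) *: P a)) => t t0.
apply/matrixP => x z; rewrite !mxE; case: eqP => _; last first.
  by rewrite rmorph0 horner0 mulr0.
rewrite NP // !mxE rmorphM hornerM /= map_polyXn hornerXn mulrA; congr (_ * _).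
have -> : t ^+ M = t ^+ (M - N (block_index x).1) * t ^+ N (block_index x).1.
  by rewrite -exprD subnK.
by rewrite invfM mulrAC mulVf ?mul1r // expf_neq0.
Qed.

Lemma diagonal_limit (lam : idx -> kbar -> 'M[kbar]_n) (p q : idx -> 'rV[kbar]_m) :
  (forall a, k_cocharacter G (lam a)) ->
  (forall a, is_limit V (lam a) (p a) (q a)) ->
  is_limit wreath_variety (fun t => monomial 0 (fun a => lam a t)) (pack p) (pack q).
Proof.
move=> hl /(_ _)/constructive_indefinite_description hphi.
pose phi a := proj1_sig (hphi a).
exists (pack phi).
have e t : map_mx (fun f : {poly kbar} => f.[t]) (pack phi) =
    pack (fun a => map_mx (fun f : {poly kbar} => f.[t]) (phi a)).
  apply/rowP => l; case/mxvec_indexP: l => a i.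
  by rewrite pack_entry !mxE pack_entry.
split=> [t|t t0|]; rewrite e.
- by move=> a; rewrite packK; have [h _ _] := proj2_sig (hphi a); apply: h.
- apply: component_ext => a; rewrite packK wreath_act_monomial; last first.
    by move=> b; have [h _ _] := hl b; apply: h.
  by rewrite addr0 packK; have [_ h _] := proj2_sig (hphi a); apply: h.
- apply: component_ext => a; rewrite !packK.
  by have [_ _] := proj2_sig (hphi a).
Qed.

(** A cycle of limits is a single limit in the power of [V], and the endpoint
    is conjugate to the starting point by an element that shifts the factors.
    If the two are also conjugate under the identity component, which shifts
    nothing, then the cycle stays in one orbit. *)
Lemma limit_cycle (lam : idx -> kbar -> 'M[kbar]_n) (p q : idx -> 'rV[kbar]_m) (s : idx) :
  (forall (v : 'rV[kbar]_(R.+1 * m)) (lam : kbar -> 'M[kbar]_(R.+1 * n)) v',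
    wreath_variety v -> k_cocharacter W lam -> is_limit wreath_variety lam v v' ->
    orbit_of wreath_variety (k_points iota W) v v' ->
    orbit_of wreath_variety (k_points iota (identity_component W)) v v') ->
  (forall a, V (p a)) -> (forall a, k_cocharacter G (lam a)) ->
  (forall a, is_limit V (lam a) (p a) (q a)) ->
  (forall a, orbit_of V (k_points iota G) (p (a + s)) (q a)) ->
  forall a, orbit_of V (k_points iota G) (p a) (q a).
Proof.
move=> stmt hp hl lim hq a.
have /(_ _)/constructive_indefinite_description hg : forall a, exists g0 : 'M[k]_n,
    G (map_mx iota g0) /\ q a = gvar_act V (map_mx iota g0) (p (a + s)).
  by move=> b; have [g [Gg [g0 eg]] eq] := hq b; exists g0; rewrite -eg.
pose g0 b := proj1_sig (hg b).
have [Gg qE] : (forall b, G (map_mx iota (g0 b))) /\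
    forall b, q b = gvar_act V (map_mx iota (g0 b)) (p (b + s)).
  by split=> b; have [] := proj2_sig (hg b).
have [||||A [WA [A0 eA]] eq] :=
  stmt (pack p) (fun t => monomial 0 (fun a => lam a t)) (pack q).
- by move=> b; rewrite packK.
- exact: diagonal_cocharacter.
- exact: diagonal_limit.
- exists (monomial s (fun b => map_mx iota (g0 b))).
    split; first by exists s, (fun b => map_mx iota (g0 b)).
    by exists (monomial s g0); rewrite map_monomial.
  by apply: component_ext => b; rewrite wreath_act_monomial // !packK qE.
have [h hG eh] : exists2 h : idx -> 'M_n, (forall a, G (h a)) & A = monomial 0 h.
  apply: (connected_wreath_shift n_gt0 (C := identity_component W)) WA.
  - exact: identity_component_sub.
  - exact: identity_component_connected.
  - exact: identity_component1 (wreath_subgroup R G).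
exists (h a); last first.
  by rewrite -[LHS](packK q) eq eh wreath_act_monomial // packK addr0.
split=> //; exists (block A0 a a); apply/matrixP => i j.
rewrite !mxE; have := congr1 (fun M => block M a a i j) eA.
by rewrite eh block_monomial addr0 eqxx => ->; rewrite !mxE.
Qed.

End WreathAction.

(** * Chains of limits *)

Section Chains.
Variables (k : fieldType) (kbar : closedFieldType) (iota : {rmorphism k -> kbar}).
Variables (n : nat) (G : k_group iota n) (m : nat) (V : k_Gvariety G m).
Local Notation Gk := (k_points iota G).

Let Gu := @k_group_unit _ _ _ _ G.
Let GM := @k_groupM _ _ _ _ G.
Let GV := @k_groupV _ _ _ _ G.
Let G1 := k_group1 G.

Lemma orbit_refl v : V v -> orbit_of V Gk v v.
Proof. by move=> Vv; exists 1%:M; [split=> //; apply: rational_1|rewrite gvar_act1]. Qed.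

Lemma orbit_sym v w : V v -> orbit_of V Gk v w -> orbit_of V Gk w v.
Proof.
move=> Vv [g [Gg rg] ->]; exists (invmx g).
  by split; [apply: GV|apply: rational_inv].
by rewrite -gvar_actM ?mulVmx ?gvar_act1 ?Gu //; apply: GV.
Qed.

Lemma orbit_trans u v w : V u -> orbit_of V Gk u v -> orbit_of V Gk v w ->
  orbit_of V Gk u w.
Proof.
move=> Vu [g [Gg rg] ->] [h [Gh rh] ->]; exists (h *m g).
  by split; [apply: GM|apply: rational_mul].
by rewrite gvar_actM.
Qed.

Lemma orbit_in v w : V v -> orbit_of V Gk v w -> V w.
Proof. by move=> Vv [g [Gg _] ->]; apply: gvar_act_in. Qed.

Lemma limit_const v : V v -> is_limit V (fun _ => 1%:M) v v.
Proof.
move=> Vv; exists (map_mx polyC v).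
have e a : map_mx (fun p : {poly kbar} => p.[a]) (map_mx polyC v) = v.
  by apply/rowP => i; rewrite !mxE hornerC.
by split=> [a|a _|]; rewrite e ?gvar_act1.
Qed.

(** Conjugation of the endpoint is allowed so that chains can move inside the
    orbits of the rational points. *)
Definition limit_step v w := V v /\ exists lam u,
  [/\ k_cocharacter G lam, is_limit V lam v u & orbit_of V Gk w u].

Definition limit_chain v w := exists r (x : nat -> 'rV[kbar]_m),
  [/\ x 0%N = v, x r = w & forall i, (i < r)%N -> limit_step (x i) (x i.+1)].

Lemma chain_concat r t (x y : nat -> 'rV[kbar]_m) :
  x r = y 0%N -> (forall i, (i < r)%N -> limit_step (x i) (x i.+1)) ->
  (forall i, (i < t)%N -> limit_step (y i) (y i.+1)) ->
  exists z, [/\ z 0%N = x 0%N, z r = x r, z (r + t)%N = y t &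
    forall i, (i < r + t)%N -> limit_step (z i) (z i.+1)].
Proof.
move=> xr hx hy.
exists (fun i => if (i <= r)%N then x i else y (i - r)%N); split=> //.
- by rewrite leqnn.
- case: leqP => [rt|_]; last by rewrite addKn.
  have t0 : t = 0%N by lia.
  by rewrite t0 addn0.
- move=> i irt; case: (ltngtP i r) => [ir|ri|ir]; first exact: hx.
    by rewrite subSn ?(ltnW ri) //; apply: hy; lia.
  by rewrite ir subSnn xr; apply: hy; lia.
Qed.

Lemma limit_chain_cat u v w : limit_chain u v -> limit_chain v w -> limit_chain u w.
Proof.
move=> [r [x [x0 xr hx]]] [t [y [y0 yt hy]]].
have [|z [z0 _ zt hz]] := chain_concat _ hx hy; first by rewrite xr.
by exists (r + t)%N, z; split=> //; [rewrite z0|rewrite zt].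
Qed.

Lemma limit_chain1 v w : limit_step v w -> limit_chain v w.
Proof.
move=> h; exists 1%N, (fun i => if i is 0%N then v else w); split=> //.
by case.
Qed.

(** The points reached from [v] by chains form a cocharacter-closed set. *)
Lemma prec_limit_chain v w : V v -> orbit_prec V w v -> limit_chain v w.
Proof.
move=> Vv /(_ (fun w => V w /\ limit_chain v w)) [|w' orb|//]; last first.
  have Vw' := orbit_in Vv orb; split=> //; apply: limit_chain1.
  split=> //; exists (fun _ => 1%:M), v; split.
  - exact: cocharacter_trivial.
  - exact: limit_const.
  - exact: orbit_sym.
split=> [x []//|x lam x' [Vx ch] hl lim]; have Vx' := limit_in lim.
split=> //; apply: limit_chain_cat ch _; apply: limit_chain1.
by split=> //; exists lam, x'; split=> //; apply: orbit_refl.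
Qed.

(** The matrices of size zero are all equal, so that the action is trivial. *)
Lemma limit_trivial lam v w : n = 0%N -> V v -> is_limit V lam v w -> w = v.
Proof.
move=> n0 Vv [phi [_ hphi <-]]; apply/rowP => i; rewrite mxE.
have lam1 a : lam a = 1%:M.
  by apply/matrixP => j; case/negP: (negbT (ltn0 j)); rewrite -n0.
have /eqP : phi 0 i - (v 0 i)%:P = 0.
  apply: horner_eq0 => a a0; rewrite hornerD hornerN hornerC.
  have := hphi a a0; rewrite lam1 gvar_act1 // => /rowP /(_ i).
  by rewrite mxE => ->; rewrite subrr.
by rewrite subr_eq0 => /eqP ->; rewrite hornerC.
Qed.

Definition limits_conjugate_connected (N : nat) (H : k_group iota N) :=
  forall (l : nat) (X : k_Gvariety H l) v lam v',
    X v -> k_cocharacter H lam -> is_limit X lam v v' ->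
    orbit_of X (k_points iota H) v v' ->
    orbit_of X (k_points iota (identity_component H)) v v'.

(** Two points that precede each other lie on a closed chain of limits, to which
    [limit_cycle] applies. *)
Lemma antisymmetric_of_limits :
  reductive G ->
  (forall N (H : k_group iota N), reductive H -> limits_conjugate_connected H) ->
  orbit_prec_antisymmetric V.
Proof.
move=> Gred stmt v v' Vv Vv' hv'v hvv'.
suff orb : orbit_of V Gk v v'.
  move=> w; split; apply: orbit_trans => //.
  exact: orbit_sym.
have [r [x [x0 xr hx]]] := prec_limit_chain Vv hv'v.
have [t [y [y0 yt hy]]] := prec_limit_chain Vv' hvv'.
have [|z [z0 zr zrt hz]] := chain_concat _ hx hy; first by rewrite xr.
rewrite {}x0 in z0; rewrite {}xr in zr; rewrite {}yt in zrt.
case: (posnP (r + t)%N) => [rt0|rt_gt0].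
  have r0 : r = 0%N by lia.
  by rewrite -zr r0 z0; apply: orbit_refl.
pose R := (r + t)%N.-1; have RE : R.+1 = (r + t)%N by rewrite /R; lia.
have zV i : (i <= r + t)%N -> V (z i).
  by rewrite leq_eqVlt => /orP [/eqP ->|/hz []//]; rewrite zrt.
have /(_ _)/constructive_indefinite_description hs : forall a : 'I_R.+1,
    exists lu : (kbar -> 'M[kbar]_n) * 'rV[kbar]_m,
    [/\ k_cocharacter G lu.1, is_limit V lu.1 (z a) lu.2 & orbit_of V Gk (z a.+1) lu.2].
  move=> a; have [|_ [lam [u [h1 h2 h3]]]] := hz a; first by rewrite -RE.
  by exists (lam, u).
pose lam a := (proj1_sig (hs a)).1; pose q a := (proj1_sig (hs a)).2.
have hl a : k_cocharacter G (lam a) by have [] := proj2_sig (hs a).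
have lim a : is_limit V (lam a) (z a) (q a) by have [] := proj2_sig (hs a).
have conj (a : 'I_R.+1) : orbit_of V Gk (z a.+1) (q a) by have [] := proj2_sig (hs a).
have Vz (a : 'I_R.+1) : V (z a) by apply: zV; rewrite -RE ltnW.
pose s : 'I_R.+1 := inZp 1.
have zs (a : 'I_R.+1) : z (a + s) = z a.+1.
  have -> : nat_of_ord (a + s) = (a.+1 %% R.+1)%N by rewrite /= modnDmr addn1.
  have := ltn_ord a; rewrite leq_eqVlt => /orP [/eqP e|lt]; last by rewrite modn_small.
  by rewrite e modnn z0 RE zrt.
have key (a : 'I_R.+1) : orbit_of V Gk (z a) (q a).
  case: (posnP n) => [n0|n_gt0].
    by rewrite (limit_trivial n0 (Vz a) (lim a)); apply: orbit_refl.
  apply: (limit_cycle (s := s) (p := fun a : 'I_R.+1 => z a) (n_gt0 := n_gt0) _ Vz hl lim).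
    exact: (stmt _ _ (wreath_reductive R n_gt0 Gred)).
  by move=> b; rewrite zs.
have orbz i : (i <= r + t)%N -> orbit_of V Gk v (z i).
  elim: i => [_|i IH lt]; first by rewrite z0; apply: orbit_refl.
  apply: (orbit_trans Vv (IH (ltnW lt))).
  have iR : (i < R.+1)%N by rewrite RE.
  apply: (orbit_trans (zV _ (ltnW lt)) (key (Ordinal iR))).
  by apply: orbit_sym (conj (Ordinal iR)); apply: zV.
by rewrite -zr; apply: orbz; apply: leq_addr.
Qed.

End Chains.

(** * The equivalence *)

Theorem corollary7p15 (k : fieldType) (kbar : closedFieldType)
    (iota : {rmorphism k -> kbar}) (kbar_closure : is_algebraic_closure iota) :
  let stmt_i :=
    forall (n : nat) (G : k_group iota n), reductive G ->
    forall (m : nat) (V : k_Gvariety G m) (v : 'rV[kbar]_m)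
           (lam : kbar -> 'M[kbar]_n) (v' : 'rV[kbar]_m),
      V v -> k_cocharacter G lam -> is_limit V lam v v' ->
      orbit_of V (k_points iota G) v v' ->
      orbit_of V (k_points iota (identity_component G)) v v' in
  let stmt_ii :=
    forall (n : nat) (G : k_group iota n), reductive G ->
    forall (m : nat) (V : k_Gvariety G m), orbit_prec_antisymmetric V in
  let stmt_iii :=
    forall (n : nat) (G : k_group iota n), gl_connected G -> reductive G ->
    forall (m : nat) (V : k_Gvariety G m), orbit_prec_antisymmetric V in
  (stmt_i <-> stmt_ii) /\ (stmt_ii <-> stmt_iii).
Proof.
move=> stmt_i stmt_ii stmt_iii.
have i_ii : stmt_i -> stmt_ii.
  move=> hi n G Gred m V; apply: antisymmetric_of_limits Gred _ => N H Hred l X.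
  exact: hi.
have ii_iii : stmt_ii -> stmt_iii by move=> hii n G _; apply: hii.
have iii_i : stmt_iii -> stmt_i.
  move=> hiii n G Gred m V v lam v' Vv hl lim orb.
  apply: (antisymmetric_limit (kbar_closure := kbar_closure)) Vv hl lim orb.
  have Ggrp := k_group_subgroup G; have [Gcl _] := k_group_defined G.
  apply: hiii; last exact: reductive_identity_component.
  exact/gl_connectedP/identity_component_connected.
by split; split=> // h; [apply/iii_i/ii_iii|apply/i_ii/iii_i].
Qed.
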